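(* Let $n\ge 3$ and let $\overline{\mathbf T}=\overline{\mathbf T}(T)$ be the space of tensors of the type of the second fundamental tensor of an almost contact metric structure on a $(2n+1)$-dimensional Euclidean space $T$, with the action of $H=U(n)\times 1$. Then there is an orthogonal decomposition $$\overline{\mathbf T}(T)=\bigoplus_{i=1}^{12}\overline{\mathbf T}_i,$$ where the subspaces $\overline{\mathbf T}_1,\dots,\overline{\mathbf T}_{12}$ (defined in the context) are invariant and irreducible under the action of $H$. Their dimensions are, respectively, $\frac13n(n-1)(n-2)$, $\frac23n(n-1)(n+1)$, $n(n+1)(n-2)$, $2n$, $n^2-1$, $n^2-n$, $1$, $n^2-1$, $n^2+n$, $1$, $2n$, $n^2-n$.
   Context: $T$ is a real vector space of dimension $2n+1$ with inner product $\langle\,,\rangle$, $\xi\in T$ is a unit vector, $V=\xi^\perp$, and $F:T\to T$ is linear with $F\xi=0$, $F(V)\subset V$, $F^2=-I$ on $V$, $\langle FX,FY\rangle=\langle X,Y\rangle$ for $X,Y\in V$. $H=U(n)\times1=\{a\in O(T): a\xi=\xi,\ aF=Fa\}$. $\overline{\mathbf T}(T)$ is the space of $h\in\otimes^3T^*$, $h_{XYZ}=h(X,Y,Z)$, with $h_{XYZ}=-h_{XZY}$ for $X,Y,Z\in T$ and $h_{XYZ}=-h_{X\,FY\,FZ}$ for $X\in T$, $Y,Z\in V$. Inner product: $\langle h,h'\rangle=\sum_{i,j,k}h_{E_iE_jE_k}h'_{E_iE_jE_k}$ over an orthonormal basis of $T$. Action: $(ah)_{XYZ}=h_{a^{-1}X\,a^{-1}Y\,a^{-1}Z}$.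 For an orthonormal basis $E_1,\dots,E_n,FE_1,\dots,FE_n,\xi$ of $T$ put $\beta(U)=\sum_{i=1}^n(h_{E_iE_iU}+h_{FE_iFE_iU})$, $\overline\beta(U)=\sum_{i=1}^n(h_{E_i\,FE_i\,U}-h_{FE_i\,E_i\,U})$, $U\in T$. $\mathfrak S$ denotes the cyclic sum over $X,Y,Z$. $\overline{\mathbf T}_i$ is the set of $h\in\overline{\mathbf T}$ satisfying, for all $X,Y,Z\in V$: $\overline{\mathbf T}_1$: $h_{XYZ}=-h_{YXZ}$, $h_{XY\xi}=h_{\xi X\xi}=h_{\xi XY}=0$; $\overline{\mathbf T}_2$: $\mathfrak S\,h_{XYZ}=0$, $h_{XY\xi}=h_{\xi X\xi}=h_{\xi XY}=0$; $\overline{\mathbf T}_3$: $h_{XYZ}-h_{FX\,FY\,Z}=\beta(Z)=0$, $h_{XY\xi}=h_{\xi X\xi}=h_{\xi XY}=0$; $\overline{\mathbf T}_4$: $h_{XYZ}=\frac1{2(n-1)}\big(\langle X,Y\rangle\beta(Z)-\langle X,Z\rangle\beta(Y)-\langle X,FY\rangle\beta(FZ)+\langle X,FZ\rangle\beta(FY)\big)$, $h_{XY\xi}=h_{\xi X\xi}=h_{\xi XY}=0$; $\overline{\mathbf T}_5$: $h_{XY\xi}=-h_{YX\xi}$, $h_{FX\,FY\,\xi}=h_{XY\xi}$, $\overline\beta(\xi)=0$, $h_{XYZ}=h_{\xi X\xi}=h_{\xi XY}=0$; $\overline{\mathbf T}_6$: $h_{XY\xi}=-h_{YX\xi}$, $h_{FX\,FY\,\xi}=-h_{XY\xi}$,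 $h_{XYZ}=h_{\xi X\xi}=h_{\xi XY}=0$; $\overline{\mathbf T}_7$: $h_{XY\xi}=-\frac1{2n}\langle X,FY\rangle\overline\beta(\xi)$, $h_{XYZ}=h_{\xi X\xi}=h_{\xi XY}=0$; $\overline{\mathbf T}_8$: $h_{XY\xi}=h_{YX\xi}$, $h_{FX\,FY\,\xi}=h_{XY\xi}$, $\beta(\xi)=0$, $h_{XYZ}=h_{\xi X\xi}=h_{\xi XY}=0$; $\overline{\mathbf T}_9$: $h_{XY\xi}=h_{YX\xi}$, $h_{FX\,FY\,\xi}=-h_{XY\xi}$, $h_{XYZ}=h_{\xi X\xi}=h_{\xi XY}=0$; $\overline{\mathbf T}_{10}$: $h_{XY\xi}=\frac1{2n}\langle X,Y\rangle\beta(\xi)$, $h_{XYZ}=h_{\xi X\xi}=h_{\xi XY}=0$; $\overline{\mathbf T}_{11}$: $h_{XYZ}=h_{XY\xi}=h_{\xi XY}=0$; $\overline{\mathbf T}_{12}$: $h_{\xi XY}=-h_{\xi YX}=-h_{\xi\,FX\,FY}$, $h_{XYZ}=h_{XY\xi}=h_{\xi X\xi}=0$. *)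

(* Defs.v *)
From HB Require Import structures.
From mathcomp Require Import all_boot all_order all_algebra.
From mathcomp Require Import sesquilinear reals.

Set Implicit Arguments.
Unset Strict Implicit.
Unset Printing Implicit Defensive.

Import Order.TTheory GRing.Theory Num.Theory.
Local Open Scope ring_scope.

(* The space of trilinear forms on T, i.e. the third tensor power of the dual
   of T, curried so that the value of h at (X, Y, Z) is h X Y Z. *)
Notation tensor3 R T := 'Hom(T, 'Hom(T, 'Hom(T, R^o))).

Section AlmostContactMetric.

Variables (R : realType) (T : vectType R).
Variables (g : {dot T for idfun}) (xi : T) (F : 'End(T)).

Implicit Types (X Y Z U : T) (h : tensor3 R T) (a : 'End(T)).
Implicit Types (W : {vspace (tensor3 R T)}).

Definition contact_space : {vspace T} := orthov g <[xi]>%VS.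
Local Notation V := contact_space.

Definition almost_contact_metric : Prop :=
  [/\ g xi xi = 1,
      F xi = 0,
      (F @: V <= V)%VS,
      {in V, forall X, F (F X) = - X} &
      {in V &, forall X Y, g (F X) (F Y) = g X Y}].

Definition orthonormal_basis (e : seq T) : bool :=
  basis_of fullv e && orthonormal g e.

(* E = [:: E_1; ...; E_n] is completed to E_1, .., E_n, F E_1, .., F E_n, xi;
   being a basis of T forces the length of E. *)
Definition adapted_basis (E : seq T) : bool :=
  orthonormal_basis (E ++ [seq F X | X <- E] ++ [:: xi]).

Lemma orthonormal_consE v s :
  orthonormal g (v :: s) =
    [&& g v v == 1, all (fun X => g v X == 0) s & orthonormal g s].
Proof.
rewrite /orthonormal /= /ortho_rec /= !andbT -!andbA.
by case: (g v v == 1) => //=; rewrite andbCA.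
Qed.

Lemma orthonormalP s :
  reflect (uniq s /\ {in s &, forall X Y, g X Y = (X == Y)%:R})
          (orthonormal g s).
Proof.
have gC X Y : g X Y = g Y X by rewrite hermC expr0 mul1r.
elim: s => [|v s IHs]; first by apply: (iffP idP).
rewrite orthonormal_consE /=.
apply: (iffP and3P) => [[/eqP gvv /allP gv /IHs[us gs]]|[/andP[vs us] gs]].
  have vs : v \notin s.
    by apply/negP => /gv; rewrite gvv oner_eq0.
  rewrite vs; split=> // X Y; rewrite !inE.
  case/predU1P => [->|Xs]; case/predU1P => [->|Ys].
  - by rewrite gvv eqxx.
  - by rewrite (eqP (gv _ Ys)); case: eqP vs => [->|//]; rewrite Ys.
  - by rewrite gC (eqP (gv _ Xs)); case: eqP vs => [<-|//]; rewrite Xs.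
  - exact: gs.
split; first by rewrite gs ?mem_head ?eqxx.
- apply/allP => Y Ys /=; apply/eqP.
  rewrite gs ?mem_head // ?inE ?Ys ?orbT //.
  by case: eqP vs => [->|//]; rewrite Ys.
- by apply/IHs; split=> // X Y Xs Ys; apply: gs; rewrite inE ?Xs ?Ys orbT.
Qed.

Lemma orthonormal_lin_indep s : orthonormal g s -> free s.
Proof.
move=> /orthonormalP[us gs]; rewrite -[s]in_tupleE; apply/freeP => k k0 i.
have: g (\sum_(j < size s) k j *: (in_tuple s)`_j) s`_i = 0.
  by rewrite k0 linear0l.
rewrite linear_sumlz (bigD1 i) //= big1 => [|j ji].
  by rewrite addr0 linearZl_LR /= gs ?mem_nth // eqxx mulr1.
by rewrite linearZl_LR /= gs ?mem_nth // nth_uniq // (inj_eq val_inj) (negPf ji) mulr0.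
Qed.

Lemma ortho_vector s : (size s < \dim {:T})%N ->
  exists2 v, g v v = 1 & {in s, forall X, g v X = 0}.
Proof.
move=> ltsT.
have [U dU oU] : exists2 U : {vspace T}, (\dim {:T} <= \dim U + size s)%N &
    forall v X, v \in U -> X \in s -> g v X = 0.
  elim: s {ltsT} => [|X s [U dU oU]]; first by exists fullv; rewrite ?addn0.
  exists (U :&: orthov g <[X]>)%VS => [|v Y].
    rewrite (leq_trans dU) //= addnS -addSn leq_add2r.
    by have := leq_dim_orthov1 g X U; rewrite -ltnS; case: (\dim U).
  rewrite memv_cap mem_orthov1 => /andP[vU /eqP vX].
  by case/predU1P => [->|] //; apply: oU.
have U0 : vpick U != 0.
  rewrite vpick0 -dimv_eq0 -lt0n; have := leq_trans ltsT dU.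
  by rewrite -{1}[size s]add0n ltn_add2r.
have p0 : 0 < g (vpick U) (vpick U) by rewrite neq0_dnorm_gt0.
exists ((Num.sqrt (g (vpick U) (vpick U)))^-1 *: vpick U).
  rewrite linearZl_LR linearZr_LR /= mulrA -expr2 exprVn sqr_sqrtr ?ltW //.
  by rewrite mulVf // gt_eqF.
by move=> X Xs; rewrite linearZl_LR /= (oU _ _ (memv_pick U) Xs) mulr0.
Qed.

(* Hence quantifying over adapted (or orthonormal) bases is never vacuous. *)
Lemma adapted_basis_exists n :
  \dim {:T} = n.*2.+1 -> almost_contact_metric -> exists E, adapted_basis E.
Proof.
move=> dT [xi1 Fxi /subvP FV FF gF].
have gC X Y : g X Y = g Y X by rewrite hermC expr0 mul1r.
have VP X : (X \in V) = (g X xi == 0) by rewrite mem_orthov1.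
have FinV X : X \in V -> F X \in V by move=> XV; apply: FV; exact: memv_img.
have gFC X Y : X \in V -> Y \in V -> g (F X) Y = - g X (F Y).
  by move=> XV YV; rewrite -gF ?FinV // FF // linearNl.
pose ext E := E ++ [seq F X | X <- E] ++ [:: xi].
have size_ext E : size (ext E) = (size E).*2.+1.
  by rewrite !size_cat size_map /= addn1 addnS addnn.
suff [E [sE oE _]] : exists E,
    [/\ size E = n, orthonormal g (ext E) & {subset E <= V}].
  exists E; rewrite /adapted_basis /orthonormal_basis oE andbT basisEfree.
  by rewrite orthonormal_lin_indep // subvf dT size_ext sE leqnn.
move: {-2}n (leqnn n); elim=> [_|k IHk lt_kn].
  by exists [::]; split=> //; rewrite orthonormal_consE /= xi1 eqxx.
have [E [sE oE EV]] := IHk (ltnW lt_kn).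
have [|v v1 vE] := @ortho_vector (ext E).
  by rewrite size_ext sE dT ltnS ltn_double.
have vV : v \in V by rewrite VP vE // !mem_cat mem_head !orbT.
have vFv : g v (F v) = 0.
  have := gFC v v vV vV; rewrite gC => /eqP.
  by rewrite -addr_eq0 -mulr2n mulrn_eq0 /= => /eqP.
exists (v :: E); split=> [|| X]; first by rewrite /= sE.
- have: orthonormal g (v :: F v :: ext E).
    rewrite !orthonormal_consE v1 eqxx gF // v1 eqxx /= vFv eqxx oE andbT /=.
    apply/andP; split; apply/allP => X XE; first by rewrite vE.
    move: XE; rewrite !mem_cat mem_seq1 => /or3P[XE|/mapP[Y YE ->]|/eqP->].
    + by rewrite /= gFC ?(EV X) // vE ?oppr0 // !mem_cat map_f ?orbT.
    + by rewrite /= gF ?(EV Y) // vE // mem_cat YE.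
    + by rewrite -VP FinV.
  have p : perm_eq (ext (v :: E)) (v :: F v :: ext E).
    by rewrite /ext /= perm_cons -cat1s perm_catCA.
  case/orthonormalP => us gs; apply/orthonormalP.
  by rewrite (perm_uniq p); split=> // X Y; rewrite !(perm_mem p); apply: gs.
- by case/predU1P => [->|/EV].
Qed.

(* U(n) x 1 *)
Definition structure_group a : Prop :=
  [/\ isometry g g a,
      a xi = xi &
      (a \o F)%VF = (F \o a)%VF].

(* On the structure group a is injective, so a^-1%VF, in general only a partial
   inverse, is the genuine inverse. *)
Definition act a h : tensor3 R T :=
  linfun (fun X => linfun (fun Y => (h (a^-1%VF X) (a^-1%VF Y) \o a^-1)%VF)).

Lemma actE a h X Y Z :
  act a h X Y Z = h (a^-1%VF X) (a^-1%VF Y) (a^-1%VF Z).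
Proof.
set inner := fun X Y => (h (a^-1%VF X) (a^-1%VF Y) \o a^-1)%VF.
have innerP X' : linear (inner X').
  by move=> c y z; apply/lfunP => w; rewrite /inner !lfun_simp !linearP /= !lfun_simp.
pose innerL X' := GRing.isLinear.Build R T _ _ (inner X') (innerP X').
pose inL X' : {linear T -> 'Hom(T, R^o)} := HB.pack (inner X') (innerL X').
have outerP : linear (fun X => linfun (inner X)).
  move=> c y z; apply/lfunP => w.
  rewrite !lfun_simp (lfunE (inL _)) (lfunE (inL y)) (lfunE (inL z)) /=.
  by apply/lfunP => v; rewrite /inner !lfun_simp !linearP /= !lfun_simp.
pose outL : {linear T -> 'Hom(T, 'Hom(T, R^o))} :=
  HB.pack (fun X => linfun (inner X)) (GRing.isLinear.Build R T _ _ _ outerP).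
by rewrite /act (lfunE outL) /= (lfunE (inL X)) /= /inner lfun_simp.
Qed.

Definition H_invariant W : Prop :=
  forall a h, structure_group a -> h \in W -> act a h \in W.

Definition H_irreducible W : Prop :=
  W != 0%VS /\
  forall W', (W' <= W)%VS -> H_invariant W' -> W' = 0%VS \/ W' = W.

(* The inner product of tensors, computed in an orthonormal basis e. *)
Definition tensor_dot (e : seq T) (h h' : tensor3 R T) : R :=
  \sum_(X <- e) \sum_(Y <- e) \sum_(Z <- e) h X Y Z * h' X Y Z.

Definition Tbar h : Prop :=
  (forall X Y Z, h X Y Z = - h X Z Y) /\
  (forall X, {in V &, forall Y Z, h X Y Z = - h X (F Y) (F Z)}).

Section Components.

Variables (n : nat) (E : seq T).

Definition beta h U : R := \sum_(X <- E) (h X X U + h (F X) (F X) U).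

Definition beta_bar h U : R := \sum_(X <- E) (h X (F X) U - h (F X) X U).

(* Vanishing of the parts h_{XYZ}, h_{XY xi}, h_{xi X xi}, h_{xi XY}
   for X, Y, Z in V. *)
Definition zeroVVV h : Prop := {in V & V & V, forall X Y Z, h X Y Z = 0}.
Definition zeroVVx h : Prop := {in V &, forall X Y, h X Y xi = 0}.
Definition zeroxVx h : Prop := {in V, forall X, h xi X xi = 0}.
Definition zeroxVV h : Prop := {in V &, forall X Y, h xi X Y = 0}.

Definition T1 h : Prop :=
  [/\ {in V & V & V, forall X Y Z, h X Y Z = - h Y X Z},
      zeroVVx h, zeroxVx h & zeroxVV h].

Definition T2 h : Prop :=
  [/\ {in V & V & V, forall X Y Z, h X Y Z + h Y Z X + h Z X Y = 0},
      zeroVVx h, zeroxVx h & zeroxVV h].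

Definition T3 h : Prop :=
  [/\ {in V & V & V, forall X Y Z, h X Y Z - h (F X) (F Y) Z = 0},
      {in V, forall Z, beta h Z = 0},
      zeroVVx h, zeroxVx h & zeroxVV h].

Definition T4 h : Prop :=
  [/\ {in V & V & V, forall X Y Z,
         h X Y Z = (2 * (n%:R - 1))^-1 *
           (g X Y * beta h Z - g X Z * beta h Y
            - g X (F Y) * beta h (F Z) + g X (F Z) * beta h (F Y)) :> R},
      zeroVVx h, zeroxVx h & zeroxVV h].

Definition T5 h : Prop :=
  [/\ {in V &, forall X Y, h X Y xi = - h Y X xi},
      {in V &, forall X Y, h (F X) (F Y) xi = h X Y xi},
      beta_bar h xi = 0 &
      [/\ zeroVVV h, zeroxVx h & zeroxVV h]].

Definition T6 h : Prop :=
  [/\ {in V &, forall X Y, h X Y xi = - h Y X xi},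
      {in V &, forall X Y, h (F X) (F Y) xi = - h X Y xi} &
      [/\ zeroVVV h, zeroxVx h & zeroxVV h]].

Definition T7 h : Prop :=
  {in V &, forall X Y,
     h X Y xi = - (2 * n%:R)^-1 * g X (F Y) * beta_bar h xi :> R} /\
  [/\ zeroVVV h, zeroxVx h & zeroxVV h].

Definition T8 h : Prop :=
  [/\ {in V &, forall X Y, h X Y xi = h Y X xi},
      {in V &, forall X Y, h (F X) (F Y) xi = h X Y xi},
      beta h xi = 0 &
      [/\ zeroVVV h, zeroxVx h & zeroxVV h]].

Definition T9 h : Prop :=
  [/\ {in V &, forall X Y, h X Y xi = h Y X xi},
      {in V &, forall X Y, h (F X) (F Y) xi = - h X Y xi} &
      [/\ zeroVVV h, zeroxVx h & zeroxVV h]].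

Definition T10 h : Prop :=
  {in V &, forall X Y, h X Y xi = (2 * n%:R)^-1 * g X Y * beta h xi :> R} /\
  [/\ zeroVVV h, zeroxVx h & zeroxVV h].

Definition T11 h : Prop := [/\ zeroVVV h, zeroVVx h & zeroxVV h].

Definition T12 h : Prop :=
  [/\ {in V &, forall X Y, h xi X Y = - h xi Y X},
      {in V &, forall X Y, - h xi Y X = - h xi (F X) (F Y)},
      zeroVVV h, zeroVVx h & zeroxVx h].

(* Indices are shifted by one: Tbar_component i is the (i+1)-st subspace. *)
Definition Tbar_component (i : 'I_12) h : Prop :=
  Tbar h /\
  nth (fun=> False)
    [:: T1; T2; T3; T4; T5; T6; T7; T8; T9; T10; T11; T12] i h.

End Components.

End AlmostContactMetric.

Definition Tbar_dims (n : nat) : seq rat :=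
  let n := n%:R in
  [:: 1 / 3 * n * (n - 1) * (n - 2);
      2 / 3 * n * (n - 1) * (n + 1);
      n * (n + 1) * (n - 2);
      2 * n;
      n ^+ 2 - 1;
      n ^+ 2 - n;
      1;
      n ^+ 2 - 1;
      n ^+ 2 + n;
      1;
      2 * n;
      n ^+ 2 - n].

(* Main.v *)
From HB Require Import structures.
Require Import Defs.
From mathcomp Require Import all_boot all_order all_algebra.
From mathcomp Require Import sesquilinear boolp reals.
From mathcomp Require Import ring lra zify.

(** Why the theorem is true.

    A tensor of Tbar is determined by its parts on V * V * V, V * V * xi,
    xi * V * xi and xi * V * V, and these can be prescribed independently.
    Commuting involutions and traces split each part further.  On V * V * V,
    every tensor is a sum of two with h(FX, FY, Z) = delta h(X, Y, Z) for
    delta = -1 and delta = 1; in the first case the cyclic average is alternating,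
    which gives T1 and T2, and in the second the trace beta can be split off,
    which gives T3 and T4.  On V * V * xi, the signs under the exchange of X
    and Y and under (X, Y) -> (FX, FY) give four pieces, and the two pieces
    invariant under F contain the lines spanned by g(X, FY) and g(X, Y): these
    are T5 to T10.  The two parts that begin with xi are T11 and T12.  Hence
    the components span Tbar (Tbar_sum).  Two components are orthogonal because
    a permutation of the arguments, or their replacement by their images under
    F, permutes the terms of the inner product up to sign, or because the inner
    product contracts one tensor to a trace that vanishes (component_dot).

    The dimensions come from two estimates.  The coordinates that determine a
    tensor of each component bound the dimensions of the components from above,
    and the equations that cut Tbar out of all tensors bound the dimension of
    Tbar from below (dim_Tbar).  The components being independent and spanning,
    all the bounds are attained (component_dims).

    Irreducibility is elementary.  The orthogonal complement of an invariant
    subspace is invariant, so it is enough that any two nonzero invariant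
    subspaces of a component W meet (irreducible_of_meet).  Fix an adapted basis
    x, y, z, ... and a coordinate phi of tensors with respect to it, and let P
    be a polynomial in elements of the structure group such that P h depends
    only on phi(h) and on the coordinate obtained by replacing x by F x.  The
    group permutes adapted bases transitively and contains the rotation that
    takes x to F x and fixes y, z, ...; so if only the zero tensor of W has
    vanishing coordinate phi in all adapted bases, then every nonzero invariant
    subspace contains an h whose two coordinates are 1 and 0, and P h is the
    same nonzero vector for any two of them (irreducible_criterion).  P is a
    product of factors such as 1 - s, where s is -1 on the complex line of a
    basis vector: this factor kills the coordinates in which the index of that
    vector occurs an even number of times. *)

Set Implicit Arguments.
Unset Strict Implicit.
Unset Printing Implicit Defensive.

Import Order.TTheory GRing.Theory Num.Theory.
Local Open Scope ring_scope.

(** * Subspaces cut out by linear conditions *)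

Section Subspaces.

Variables (R : fieldType) (vT : vectType R).

(** A subspace of maximal dimension among those on which P holds is all of P:
    a further vector of P would enlarge it. *)
Lemma linear_pred_vspace (P : vT -> Prop) :
    P 0 -> (forall a u v, P u -> P v -> P (a *: u + v)) ->
  exists U : {vspace vT}, forall v, v \in U <-> P v.
Proof.
move=> P0 PD.
have [k [U [subU dU maxU]]] : exists k, exists U : {vspace vT},
   [/\ forall v, v \in U -> P v, \dim U = k &
       forall U' : {vspace vT}, (forall v, v \in U' -> P v) -> (\dim U' <= k)%N].
  pose Q k := `[< exists U : {vspace vT},
                    (forall v, v \in U -> P v) /\ \dim U = k >].
  have exQ : exists k, Q k.
    exists 0%N; apply/asboolP; exists 0%VS; split; last exact: dimv0.
    by move=> v; rewrite memv0 => /eqP->.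
  have ubQ k : Q k -> (k <= \dim {:vT})%N.
    by move=> /asboolP[U [_ <-]]; exact: dimvS (subvf U).
  case: (ex_maxnP exQ ubQ) => k /asboolP[U [sU dU]] maxk; exists k, U.
  by split=> // U' sU'; apply: maxk; apply/asboolP; exists U'.
exists U => v; split=> [/subU //|Pv]; apply: contrapT => /negP vU.
have /maxU : forall w, w \in (U + <[v]>)%VS -> P w.
  by move=> w /memv_addP[u uU [_ /vlineP[c ->] ->]]; rewrite addrC; apply/PD/subU.
rewrite leqNgt -dU.
by rewrite ltn_neqAle (dimv_leqif_sup (addvSl U <[v]>)).2 subv_add subvv -memvE vU
           (dimvS (addvSl _ _)).
Qed.

End Subspaces.

(** * Trilinear forms as functions of three vectors *)

Section Functionals.

Variables (R : fieldType) (vT : vectType R).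
Implicit Types (f : vT -> R) (U : {vspace vT}).

Lemma functional0 f : scalar f -> f 0 = 0.
Proof. by move=> fP; have := fP (-1) 0 0; rewrite scaler0 addr0 mulN1r addNr. Qed.

Lemma functionalD f : scalar f -> forall u v, f (u + v) = f u + f v.
Proof. by move=> fP u v; have := fP 1 u v; rewrite scale1r mul1r. Qed.

Lemma functionalZ f : scalar f -> forall a u, f (a *: u) = a * f u.
Proof. by move=> fP a u; rewrite -[a *: u]addr0 fP functional0 ?addr0. Qed.

Lemma functionalN f : scalar f -> forall u, f (- u) = - f u.
Proof. by move=> fP u; rewrite -scaleN1r functionalZ // mulN1r. Qed.

Lemma functional_sum f I (s : seq I) (c : I -> R) (v : I -> vT) : scalar f ->
  f (\sum_(i <- s) c i *: v i) = \sum_(i <- s) c i * f (v i).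
Proof.
move=> fP; elim: s => [|i s IHs]; first by rewrite !big_nil functional0.
by rewrite !big_cons fP IHs.
Qed.

Section Coordinates.

Variables (J : finType) (phi : J -> vT -> R).
Hypothesis phi_scalar : forall j, scalar (phi j).

Let coords v : {ffun J -> R^o} := [ffun j => phi j v].

Fact coords_linear : linear coords.
Proof. by move=> a u v; apply/ffunP => j; rewrite !ffunE phi_scalar. Qed.

Let coordsL := linfun (HB.pack coords (GRing.isLinear.Build _ _ _ _ _ coords_linear)
  : {linear vT -> {ffun J -> R^o}}).

Fact coordsLE v j : coordsL v j = phi j v.
Proof. by rewrite lfunE /= ffunE. Qed.

Fact dim_coords : \dim {: {ffun J -> R^o}} = #|J|.
Proof. by rewrite dimvf /dim /= muln1. Qed.

Lemma dim_le_coords U :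
  (forall v, v \in U -> (forall j, phi j v = 0) -> v = 0) -> (\dim U <= #|J|)%N.
Proof.
move=> inj; rewrite -(@limg_dim_eq _ _ _ coordsL).
  by rewrite -dim_coords dimvS // subvf.
apply/eqP; rewrite -subv0; apply/subvP => v; rewrite memv_cap memv_ker memv0.
case/andP=> vU /eqP v0; apply/eqP/inj => // j.
by rewrite -coordsLE v0 ffunE.
Qed.

Lemma dim_ge_coords U' U :
  (forall v, v \in U' -> (forall j, phi j v = 0) -> v \in U) ->
  (\dim U' <= \dim U + #|J|)%N.
Proof.
move=> sub; rewrite -(limg_ker_dim coordsL U') leq_add //.
  apply: dimvS; apply/subvP => v; rewrite memv_cap memv_ker => /andP[vU' /eqP v0].
  by apply: sub => // j; rewrite -coordsLE v0 ffunE.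
by rewrite -dim_coords dimvS // subvf.
Qed.

Lemma dim_ge_surj U :
  (forall c : J -> R, exists2 v, v \in U & forall j, phi j v = c j) ->
  (#|J| <= \dim U)%N.
Proof.
move=> surj; rewrite -(limg_ker_dim coordsL U) -dim_coords.
apply: leq_trans (leq_addl _ _); apply: dimvS; apply/subvP => c _.
have [v vU vc] := surj c; apply/memv_imgP; exists v => //.
by apply/ffunP => j; rewrite coordsLE vc.
Qed.

End Coordinates.

End Functionals.

Lemma linfun_linearE (R : fieldType) (aT rT : vectType R) (f : aT -> rT) (X : aT) :
  linear f -> linfun f X = f X.
Proof. by move=> fP; exact: (lfunE (HB.pack f (GRing.isLinear.Build _ _ _ _ f fP)) X). Qed.

(** The sort is the type of tensors itself, not the isomorphic term that
    inference would produce, so that conversion between the two is immediate. *)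
Definition tensor_space (R : realType) (T : vectType R) : vectType R :=
  @Vector.Pack _ (tensor3 R T) (Vector.class (tensor3 R T : vectType R)).

Section Trilinear.

Variables (R : realType) (T : vectType R).
Implicit Types (h : tensor_space T) (X Y Z : T).

(** With values in R, where the application of a tensor has values in the
    regular module. *)
Definition ev h X Y Z : R := (h : tensor3 R T) X Y Z.

Lemma ev_scalar1 h Y Z : scalar (fun X => ev h X Y Z).
Proof.
have lin (k : tensor3 R T) a X X' : k (a *: X + X') Y Z = a * k X Y Z + k X' Y Z.
  by rewrite linearP /= !lfun_simp.
by move=> a X X'; exact: lin.
Qed.

Lemma ev_scalar2 h X Z : scalar (fun Y => ev h X Y Z).
Proof.
have lin (k : 'Hom(T, 'Hom(T, R^o))) a Y Y' : k (a *: Y + Y') Z = a * k Y Z + k Y' Z.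
  by rewrite linearP /= !lfun_simp.
by move=> a Y Y'; exact: lin.
Qed.

Lemma ev_scalar3 h X Y : scalar (ev h X Y).
Proof.
have lin (k : 'Hom(T, R^o)) a Z Z' : k (a *: Z + Z') = a * k Z + k Z' by rewrite linearP.
by move=> a Z Z'; exact: lin.
Qed.

Lemma evP h h' : (forall X Y Z, ev h X Y Z = ev h' X Y Z) -> h = h'.
Proof.
move=> eh; apply/lfunP => X; apply/lfunP => Y; apply/lfunP => Z; exact: eh.
Qed.

Lemma ev0 X Y Z : ev 0 X Y Z = 0.
Proof. by rewrite /ev !zero_lfunE. Qed.

Lemma ev_linear a h h' X Y Z :
  ev (a *: h + h') X Y Z = a * ev h X Y Z + ev h' X Y Z.
Proof.
have lin (k k' : tensor3 R T) : (a *: k + k') X Y Z = a * k X Y Z + k' X Y Z.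
  by rewrite !lfun_simp.
exact: lin.
Qed.

Lemma ev_scalar X Y Z : scalar (fun h => ev h X Y Z).
Proof. by move=> a h h'; rewrite ev_linear. Qed.

Lemma evD h h' X Y Z : ev (h + h') X Y Z = ev h X Y Z + ev h' X Y Z.
Proof. exact: (functionalD (ev_scalar _ _ _)). Qed.

Lemma evPl h a X X' Y Z : ev h (a *: X + X') Y Z = a * ev h X Y Z + ev h X' Y Z.
Proof. exact: ev_scalar1. Qed.
Lemma evPm h a X Y Y' Z : ev h X (a *: Y + Y') Z = a * ev h X Y Z + ev h X Y' Z.
Proof. exact: ev_scalar2. Qed.
Lemma evPr h a X Y Z Z' : ev h X Y (a *: Z + Z') = a * ev h X Y Z + ev h X Y Z'.
Proof. exact: ev_scalar3. Qed.
Lemma evNl h X Y Z : ev h (- X) Y Z = - ev h X Y Z.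
Proof. exact: (functionalN (ev_scalar1 _ _ _)). Qed.
Lemma evNm h X Y Z : ev h X (- Y) Z = - ev h X Y Z.
Proof. exact: (functionalN (ev_scalar2 _ _ _)). Qed.
Lemma evNr h X Y Z : ev h X Y (- Z) = - ev h X Y Z.
Proof. exact: (functionalN (ev_scalar3 _ _ _)). Qed.
Lemma evZl h a X Y Z : ev h (a *: X) Y Z = a * ev h X Y Z.
Proof. exact: (functionalZ (ev_scalar1 _ _ _)). Qed.
Lemma evZm h a X Y Z : ev h X (a *: Y) Z = a * ev h X Y Z.
Proof. exact: (functionalZ (ev_scalar2 _ _ _)). Qed.
Lemma evZr h a X Y Z : ev h X Y (a *: Z) = a * ev h X Y Z.
Proof. exact: (functionalZ (ev_scalar3 _ _ _)). Qed.

Definition evN := (evNl, evNm, evNr).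

Lemma tensor_memD (W : {vspace (tensor_space T)}) h h' :
  h \in W -> h' \in W -> h + h' \in W.
Proof. exact: memvD. Qed.

Lemma tensor_memZ (W : {vspace (tensor_space T)}) a h : h \in W -> a *: h \in W.
Proof. exact: memvZ. Qed.

Lemma tensor_mem0 (W : {vspace (tensor_space T)}) : 0 \in W.
Proof. exact: mem0v. Qed.

Definition trilinear (f : T -> T -> T -> R) : Prop :=
  [/\ forall a X X' Y Z, f (a *: X + X') Y Z = a * f X Y Z + f X' Y Z,
      forall a X Y Y' Z, f X (a *: Y + Y') Z = a * f X Y Z + f X Y' Z &
      forall a X Y Z Z', f X Y (a *: Z + Z') = a * f X Y Z + f X Y Z'].

Lemma trilinear_ev h : trilinear (ev h).
Proof. by split=> *; rewrite (evPl, evPm, evPr). Qed.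

(** Locked, lest unification unfold it when a rewriting fails to match. *)
Definition tens (f : T -> T -> T -> R) : tensor_space T :=
  locked (linfun (fun X => linfun (fun Y => linfun (f X Y : T -> R^o)))).

Lemma tensE f X Y Z : trilinear f -> ev (tens f) X Y Z = f X Y Z.
Proof.
case=> fl fm fr.
have l3 X' Y' : linear (f X' Y' : T -> R^o) by move=> a z z'; exact: fr.
have l2 X' : linear (fun Y' => linfun (f X' Y' : T -> R^o)).
  move=> a y y'; apply/lfunP => z; rewrite add_lfunE scale_lfunE.
  by rewrite !linfun_linearE // fm.
have l1 : linear (fun X' => linfun (fun Y' => linfun (f X' Y' : T -> R^o))).
  move=> a x x'; apply/lfunP => y; rewrite add_lfunE scale_lfunE.
  apply/lfunP => z; rewrite !(linfun_linearE _ (l2 _)) add_lfunE scale_lfunE.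
  by rewrite !linfun_linearE // fl.
rewrite /ev /tens -lock (linfun_linearE _ l1) (linfun_linearE _ (l2 X)).
exact: linfun_linearE (l3 X Y).
Qed.

End Trilinear.

Section Orthonormal.

Variables (R : realType) (T : vectType R) (g : {dot T for idfun}).
Implicit Types (X Y Z : T) (e : seq T).

Lemma gC X Y : g X Y = g Y X.
Proof. by rewrite hermC expr0 mul1r. Qed.
Lemma gPl a X X' Y : g (a *: X + X') Y = a * g X Y + g X' Y.
Proof. by rewrite linearDl linearZl_LR. Qed.
Lemma gPr a X Y Y' : g X (a *: Y + Y') = a * g X Y + g X Y'.
Proof. by rewrite gC gPl !(gC _ X). Qed.
Lemma g_scalar Y : scalar (g ^~ Y).
Proof. by move=> a X X'; rewrite gPl. Qed.
Lemma g_scalar_r Y : scalar (g Y).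
Proof. by move=> a X X'; rewrite gPr. Qed.
Lemma gDl X X' Y : g (X + X') Y = g X Y + g X' Y.
Proof. exact: (functionalD (g_scalar _)). Qed.
Lemma gDr X Y Y' : g X (Y + Y') = g X Y + g X Y'.
Proof. exact: (functionalD (g_scalar_r _)). Qed.
Lemma gNl X Y : g (- X) Y = - g X Y.
Proof. exact: (functionalN (g_scalar _)). Qed.
Lemma gNr X Y : g X (- Y) = - g X Y.
Proof. exact: (functionalN (g_scalar_r _)). Qed.
Lemma gZl a X Y : g (a *: X) Y = a * g X Y.
Proof. exact: (functionalZ (g_scalar _)). Qed.
Lemma gZr a X Y : g X (a *: Y) = a * g X Y.
Proof. exact: (functionalZ (g_scalar_r _)). Qed.
Lemma g0l Y : g 0 Y = 0.
Proof. exact: (functional0 (g_scalar _)). Qed.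
Lemma g0r Y : g Y 0 = 0.
Proof. exact: (functional0 (g_scalar_r _)). Qed.
Definition gE := (gDl, gDr, gNl, gNr, gZl, gZr, g0l, g0r).

Lemma orthonormal_expand e X : orthonormal_basis g e ->
  X = \sum_(Y <- e) g X Y *: Y.
Proof.
case/andP=> be /Defs.orthonormalP[ue ge].
have Xe : X \in <<e>>%VS by rewrite (span_basis be) memvf.
have [k -> _] := free_span (basis_free be) Xe.
apply: eq_big_seq => Y Ye; congr (_ *: _).
rewrite (functional_sum _ _ _ (g_scalar Y)) (bigD1_seq Y) //= ge // eqxx mulr1.
rewrite big1_seq ?addr0 // => Z /andP[ZY Ze].
by rewrite ge // (negPf ZY) mulr0.
Qed.

Lemma scalar_expand e (f : T -> R) X : orthonormal_basis g e -> scalar f ->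
  f X = \sum_(Y <- e) g X Y * f Y.
Proof.
by move=> oe fP; rewrite {1}(orthonormal_expand X oe) (functional_sum _ _ _ fP).
Qed.

(** The trace of a bilinear form: expanding one argument in the first basis
    and folding the result back in the second exchanges the two bases. *)
Lemma trace_indep e e' (f : T -> T -> R) :
    orthonormal_basis g e -> orthonormal_basis g e' ->
    (forall Y, scalar (f ^~ Y)) -> (forall X, scalar (f X)) ->
  \sum_(X <- e) f X X = \sum_(X <- e') f X X.
Proof.
move=> oe oe' fl fr.
under eq_bigr => X _ do rewrite (scalar_expand X oe' (fr X)).
rewrite exchange_big; apply: eq_bigr => Y _ /=.
under eq_bigr => X _ do rewrite gC.
by rewrite -(scalar_expand Y oe (fl Y)).
Qed.

Lemma big_scalar (I : Type) (r : seq I) (f : I -> T -> R) :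
  (forall i, scalar (f i)) -> scalar (fun X => \sum_(i <- r) f i X).
Proof.
move=> fP a X Y; rewrite mulr_sumr -big_split.
by apply: eq_bigr => i _; rewrite fP.
Qed.

Lemma scalarM (f : T -> R) c : scalar f -> scalar (fun X => f X * c).
Proof. by move=> fP a X Y; rewrite fP mulrDl mulrA. Qed.

Lemma scalarMl (f : T -> R) c : scalar f -> scalar (fun X => c * f X).
Proof. by move=> fP a X Y; rewrite fP mulrDr mulrCA. Qed.

Lemma tensor_dot_indep e e' (h h' : tensor_space T) :
    orthonormal_basis g e -> orthonormal_basis g e' ->
  tensor_dot e h h' = tensor_dot e' h h'.
Proof.
move=> oe oe'; rewrite /tensor_dot.
pose t2 r X X' := \sum_(Y <- r) \sum_(Z <- r) ev h X Y Z * ev h' X' Y Z.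
rewrite (@trace_indep e e' (t2 e)) //; first last.
- move=> X; apply: big_scalar => ?; apply: big_scalar => ?; apply: scalarMl; exact: ev_scalar1.
- move=> X; apply: big_scalar => ?; apply: big_scalar => ?; apply: scalarM; exact: ev_scalar1.
apply: eq_bigr => X _.
pose t1 r Y Y' := \sum_(Z <- r) ev h X Y Z * ev h' X Y' Z.
rewrite /t2 (@trace_indep e e' (t1 e)) //; first last.
- move=> Y; apply: big_scalar => ?; apply: scalarMl; exact: ev_scalar2.
- move=> Y; apply: big_scalar => ?; apply: scalarM; exact: ev_scalar2.
apply: eq_bigr => Y _.
rewrite /t1 (@trace_indep e e' (fun Z Z' => ev h X Y Z * ev h' X Y Z')) //.
- move=> Z; apply: scalarM; exact: ev_scalar3.
- move=> Z; apply: scalarMl; exact: ev_scalar3.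
Qed.

End Orthonormal.

(** * Almost contact metric structures and adapted bases *)

Section Contact.

Variables (R : realType) (T : vectType R).
Variables (g : {dot T for idfun}) (xi : T) (F : 'End(T)).
Hypothesis hF : almost_contact_metric g xi F.
Local Notation V := (contact_space g xi).
Implicit Types (X Y Z x y z : T) (E s : seq T).

Lemma contactE X : (X \in V) = (g X xi == 0).
Proof. exact: mem_orthov1. Qed.

Lemma contactP X : reflect (g X xi = 0) (X \in V).
Proof. by rewrite contactE; exact: eqP. Qed.

Lemma g_xi : g xi xi = 1. Proof. by case: hF. Qed.
Lemma F_xi : F xi = 0. Proof. by case: hF. Qed.
Lemma FF X : X \in V -> F (F X) = - X. Proof. by case: hF => _ _ _ + _; apply. Qed.

Lemma xi_g X : X \in V -> g xi X = 0.
Proof. by move/contactP; rewrite gC. Qed.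

Definition proj X : T := X - g X xi *: xi.

Lemma projP a X Y : proj (a *: X + Y) = a *: proj X + proj Y.
Proof.
by rewrite /proj gPl scalerDl scalerBr scalerA opprD addrACA.
Qed.

Lemma projV X : proj X \in V.
Proof. by apply/contactP; rewrite /proj !gE g_xi mulr1 subrr. Qed.

Lemma proj_id X : X \in V -> proj X = X.
Proof. by move/contactP => X0; rewrite /proj X0 scale0r subr0. Qed.

Lemma proj_xi : proj xi = 0.
Proof. by rewrite /proj g_xi scale1r subrr. Qed.

Lemma proj_split X : X = g X xi *: xi + proj X.
Proof. by rewrite /proj addrC subrK. Qed.

Lemma F_proj X : F (proj X) = F X.
Proof. by rewrite /proj linearB linearZ /= F_xi scaler0 subr0. Qed.

Lemma FV X : F X \in V.
Proof.
rewrite -F_proj; case: hF => _ _ /subvP FVV _ _.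
by apply: FVV; rewrite memv_img // projV.
Qed.

Lemma g_proj X Y : Y \in V -> g (proj X) Y = g X Y.
Proof. by move=> YV; rewrite /proj !gE xi_g // mulr0 subr0. Qed.

Lemma gFF X Y : Y \in V -> g (F X) (F Y) = g X Y.
Proof.
move=> YV; rewrite -F_proj -(g_proj _ YV).
by case: hF => _ _ _ _; apply; rewrite ?projV.
Qed.

Lemma gFl X Y : g (F X) Y = - g X (F Y).
Proof.
rewrite gC -(g_proj _ (FV X)) gC -(gFF (F X) (projV Y)) F_proj.
by rewrite -{1}(F_proj X) FF ?projV // gNl g_proj ?FV.
Qed.

Lemma gXFX X : g X (F X) = 0.
Proof. by have := gFl X X; rewrite gC; lra. Qed.

Lemma perm_orthonormal s s' :
  perm_eq s s' -> orthonormal g s -> orthonormal g s'.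
Proof.
move=> p /Defs.orthonormalP[us gs]; apply/Defs.orthonormalP.
by rewrite -(perm_uniq p); split=> // X Y; rewrite -!(perm_mem p); apply: gs.
Qed.

Definition adapted_ext E : seq T := E ++ [seq F X | X <- E] ++ [:: xi].

Definition unitary_frame s : bool := orthonormal g (adapted_ext s).

Lemma big_adapted_ext E (f : T -> R) :
  \sum_(X <- adapted_ext E) f X = \sum_(X <- E) (f X + f (F X)) + f xi.
Proof. by rewrite !big_cat big_map big_seq1 big_split /= addrA. Qed.

Lemma perm_unitary_frame s s' :
  perm_eq s s' -> unitary_frame s -> unitary_frame s'.
Proof.
move=> ss'; apply: perm_orthonormal.
by apply: perm_cat => //; rewrite perm_cat2r perm_map.
Qed.

Lemma unitary_frame0 : unitary_frame [::].
Proof. by rewrite /unitary_frame orthonormal_consE /= g_xi eqxx. Qed.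

Lemma unitary_frameP s :
  reflect [/\ uniq s, {in s &, forall X Y, g X Y = (X == Y)%:R},
              {in s &, forall X Y, g X (F Y) = 0} & {in s, forall X, X \in V}]
          (unitary_frame s).
Proof.
apply: (iffP idP) => [/Defs.orthonormalP[us gs]|].
  have {}us : [&& uniq s, ~~ has (mem s) (map F s ++ [:: xi]) & uniq (map F s ++ [:: xi])].
    by rewrite -cat_uniq.
  have sub X : X \in s -> X \in adapted_ext s by rewrite mem_cat => ->.
  have subF X : X \in s -> F X \in adapted_ext s.
    by move=> Xs; rewrite !mem_cat map_f ?orbT.
  case/and3P: us => us /hasPn hs _; split=> // [X Y Xs Ys|X Y Xs Ys|X Xs].
  - by rewrite gs ?sub.
  - rewrite (gs _ _ (sub _ Xs) (subF _ Ys)); case: (X =P F Y) => // XFY.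
    by have := hs (F Y); rewrite mem_cat map_f //= -XFY Xs => /(_ isT).
  - have xi_s : xi \in adapted_ext s by rewrite !mem_cat mem_head !orbT.
    apply/contactP; rewrite (gs _ _ (sub _ Xs) xi_s).
    case: (X =P xi) => // Xxi; have := hs xi.
    by rewrite mem_cat mem_head orbT /= -Xxi Xs => /(_ isT).
elim: s => [|x s IHs]; first by rewrite unitary_frame0.
case=> /= /andP[xs us] gs gFs sV.
have xV : x \in V by rewrite sV ?mem_head.
have p : perm_eq (adapted_ext (x :: s)) (x :: F x :: adapted_ext s).
  by rewrite /adapted_ext /= perm_cons -cat1s perm_catCA.
have os : unitary_frame s.
  apply: IHs; split=> // [X Y Xs Ys|X Y Xs Ys|X Xs].
  - by apply: gs; rewrite inE ?Xs ?Ys orbT.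
  - by apply: gFs; rewrite inE ?Xs ?Ys orbT.
  - by apply: sV; rewrite inE Xs orbT.
have xY Y : Y \in s -> g x Y = 0.
  move=> Ys; rewrite gs ?mem_head // ?inE ?Ys ?orbT //.
  by case: eqP xs => // ->; rewrite Ys.
have xFY Y : Y \in s -> g x (F Y) = 0.
  by move=> Ys; rewrite gFs ?mem_head // inE Ys orbT.
rewrite perm_sym in p; apply: (perm_orthonormal p); rewrite !orthonormal_consE gFF //.
rewrite gs ?mem_head // eqxx /= gXFX eqxx /= -/(unitary_frame s) os andbT.
have inext Y : Y \in adapted_ext s -> [\/ Y \in s, exists2 Z, Z \in s & Y = F Z | Y = xi].
  rewrite !mem_cat mem_seq1 => /or3P[Ys|/mapP[Z Zs ->]|/eqP->].
  - by constructor 1.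
  - by constructor 2; exists Z.
  - by constructor 3.
rewrite eqxx /=; apply/andP; split; apply/allP => Y /inext.
- case=> [Ys|[Z Zs ->]|->].
  + by rewrite xY.
  + by rewrite xFY.
  + by rewrite (contactP _ xV).
- case=> [Ys|[Z Zs ->]|->].
  + by rewrite gFl xFY ?oppr0.
  + by rewrite gFF ?xY // sV // inE Zs orbT.
  + by rewrite (contactP _ (FV x)).
Qed.

Lemma unitary_frame_cons x s : x \in V -> g x x = 1 ->
    {in s, forall Y, g x Y = 0 /\ g x (F Y) = 0} ->
  unitary_frame s -> unitary_frame (x :: s).
Proof.
move=> xV xx xs /unitary_frameP[us gs gFs sV].
have xns : x \notin s.
  by apply/negP => /xs[+ _]; rewrite xx => /eqP; rewrite oner_eq0.
have neq Y : Y \in s -> (Y == x) = false.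
  by move=> Ys; apply: contraNF xns => /eqP<-.
apply/unitary_frameP; split=> [|X Y|X Y|X]; rewrite ?inE /= ?xns //.
- case/predU1P => [->|Xs]; case/predU1P => [->|Ys]; rewrite ?eqxx ?xx //.
  + by rewrite eq_sym neq // (xs _ Ys).1.
  + by rewrite neq // gC (xs _ Xs).1.
  + exact: gs.
- case/predU1P => [->|Xs]; case/predU1P => [->|Ys]; rewrite ?gXFX //.
  + exact: (xs _ Ys).2.
  + by rewrite gC gFl (xs _ Xs).2 oppr0.
  + exact: gFs.
- by case/predU1P => [->|/sV].
Qed.

Lemma size_adapted_ext E : size (adapted_ext E) = (size E).*2.+1.
Proof. by rewrite !size_cat size_map /= addn1 addnS addnn. Qed.

Section Dimension.

Variables (n : nat).
Hypothesis dimT : \dim {:T} = n.*2.+1.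

Lemma adapted_basisE E :
  adapted_basis g xi F E = unitary_frame E && (size E == n).
Proof.
rewrite /adapted_basis /orthonormal_basis -/(adapted_ext E) andbC.
apply: andb_id2l => oE; rewrite basisEfree (orthonormal_lin_indep oE) subvf.
rewrite /= dimT size_adapted_ext ltnS leq_double.
have : (size (adapted_ext E) <= n.*2.+1)%N.
  rewrite -dimT; have /eqP <- : free (adapted_ext E) by rewrite (orthonormal_lin_indep oE).
  exact: dimvS (subvf _).
by rewrite size_adapted_ext ltnS leq_double => En; rewrite eqn_leq En.
Qed.

(** Gram-Schmidt over the complex numbers: a unit vector orthogonal to the
    frame, to its image under F and to xi prolongs the frame. *)
Lemma unitary_frame_extend s : unitary_frame s -> (size s <= n)%N ->
  exists E, adapted_basis g xi F (s ++ E).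
Proof.
move=> us; have [k] := ubnP (n - size s); elim: k s us => // k IHk s us ks sn.
case: (ltngtP (size s) n) sn => // [lt_sn _|sn _]; last first.
  by exists [::]; rewrite adapted_basisE cats0 us sn eqxx.
have [|v v1 vs] := @ortho_vector _ _ g (adapted_ext s).
  by rewrite size_adapted_ext dimT ltnS ltn_double.
have vV : v \in V by apply/contactP; rewrite vs // !mem_cat mem_head !orbT.
have usv : unitary_frame (rcons s v).
  apply: (@perm_unitary_frame (v :: s)); first by rewrite perm_sym perm_rcons.
  apply: unitary_frame_cons => // Y Ys; split; apply: vs.
    by rewrite mem_cat Ys.
  by rewrite !mem_cat map_f ?orbT.
have [||E] := IHk _ usv; rewrite ?size_rcons //; first by lia.
by rewrite -cats1 -catA => aE; exists (v :: E).
Qed.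

End Dimension.

Section AdaptedBasis.

Variable E : seq T.
Hypothesis aE : adapted_basis g xi F E.

Lemma adapted_orthonormal : orthonormal_basis g (adapted_ext E).
Proof. exact: aE. Qed.

Lemma adapted_unitary : unitary_frame E.
Proof. by case/andP: aE. Qed.

Lemma adapted_contact : {in E, forall X, X \in V}.
Proof. by case/unitary_frameP: adapted_unitary. Qed.

Lemma adapted_g : {in E &, forall X Y, g X Y = (X == Y)%:R}.
Proof. by case/unitary_frameP: adapted_unitary. Qed.

Lemma adapted_gF : {in E &, forall X Y, g X (F Y) = 0}.
Proof. by case/unitary_frameP: adapted_unitary. Qed.

Lemma adapted_uniq : uniq E.
Proof. by case/unitary_frameP: adapted_unitary. Qed.

Lemma contact_expand (f : T -> R) X : scalar f -> X \in V ->
  f X = \sum_(Y <- E) (g X Y * f Y + g X (F Y) * f (F Y)).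
Proof.
move=> fP /contactP X0; rewrite (scalar_expand X adapted_orthonormal fP).
by rewrite big_adapted_ext X0 mul0r addr0.
Qed.

Lemma contact_scalar_eq0 (f : T -> R) : scalar f ->
    {in E, forall Y, f Y = 0 /\ f (F Y) = 0} ->
  {in V, forall X, f X = 0}.
Proof.
move=> fP fE X XV; rewrite (contact_expand fP XV) big1_seq // => Y /andP[_ YE].
by have [-> ->] := fE Y YE; rewrite !mulr0 addr0.
Qed.

End AdaptedBasis.

Section Traces.

Variables E E' : seq T.
Hypotheses (aE : adapted_basis g xi F E) (aE' : adapted_basis g xi F E').

(** Adding the term of xi gives the trace of f, which depends on no basis. *)
Lemma contact_trace_indep (f : T -> T -> R) :
    (forall Y, scalar (f ^~ Y)) -> (forall X, scalar (f X)) ->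
  \sum_(X <- E) (f X X + f (F X) (F X)) = \sum_(X <- E') (f X X + f (F X) (F X)).
Proof.
move=> fl fr; have := trace_indep (adapted_orthonormal aE) (adapted_orthonormal aE') fl fr.
by rewrite !big_adapted_ext => /addIr.
Qed.

Lemma beta_indep : beta F E = beta F E'.
Proof.
apply/funext => h; apply/funext => U; rewrite /beta.
apply: (@contact_trace_indep (fun X Y => ev h X Y U)) => ?.
  exact: ev_scalar1.
exact: ev_scalar2.
Qed.

Lemma beta_barE D h U : {in D, forall X, X \in V} ->
  beta_bar F D h U = \sum_(X <- D) (ev h X (F X) U + ev h (F X) (F (F X)) U).
Proof.
move=> DV; apply: eq_big_seq => X XD.
by rewrite FF ?DV // evNm.
Qed.

Lemma beta_bar_indep : beta_bar F E = beta_bar F E'.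
Proof.
apply/funext => h; apply/funext => U.
rewrite !beta_barE; [|exact: adapted_contact aE'|exact: adapted_contact aE].
apply: (@contact_trace_indep (fun X Y => ev h X (F Y) U)) => ?.
  exact: ev_scalar1.
by move=> a Y Y' /=; rewrite linearP evPm.
Qed.

End Traces.

End Contact.

(** * The structure group *)

Section StructureGroup.

Variables (R : realType) (T : vectType R).
Variables (g : {dot T for idfun}) (xi : T) (F : 'End(T)).
Hypothesis hF : almost_contact_metric g xi F.
Local Notation V := (contact_space g xi).
Local Notation H := (structure_group g xi F).
Implicit Types (X Y Z : T) (E s : seq T) (a b : 'End(T)).
Implicit Types (h : tensor_space T) (W : {vspace (tensor_space T)}).

Lemma g_eq0 X : g X X = 0 -> X = 0.
Proof.
move=> gX; apply/eqP/negPn/negP => X0.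
have : 0 < g X X by rewrite neq0_dnorm_gt0.
by rewrite gX ltxx.
Qed.

Section Element.

Variable a : 'End(T).
Hypothesis aH : H a.

Lemma H_g X Y : g (a X) (a Y) = g X Y. Proof. by case: aH => + _ _; apply. Qed.
Lemma H_xi : a xi = xi. Proof. by case: aH. Qed.
Lemma H_F X : a (F X) = F (a X).
Proof. by case: aH => _ _ /lfunP/(_ X); rewrite !comp_lfunE. Qed.
Lemma H_V X : (a X \in V) = (X \in V).
Proof. by rewrite !contactE -{1}H_xi H_g. Qed.

Lemma H_inj : injective a.
Proof.
move=> X Y aXY; apply/eqP; rewrite -subr_eq0; apply/eqP/g_eq0.
by rewrite -H_g linearB /= aXY subrr g0l.
Qed.

Lemma H_lker0 : lker a == 0%VS.
Proof. exact/lker0P/H_inj. Qed.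

Lemma H_K : cancel a a^-1%VF. Proof. exact: lker0_lfunK H_lker0. Qed.
Lemma H_VK : cancel a^-1%VF a. Proof. exact: lker0_lfunVK H_lker0. Qed.

Lemma H_inv : H a^-1%VF.
Proof.
split=> [X Y||]; first by have E := H_g (a^-1%VF X) (a^-1%VF Y); rewrite !H_VK in E; exact: esym E.
  by rewrite -{1}(H_xi) H_K.
by apply/lfunP => X; rewrite !comp_lfunE -{1}[X]H_VK -H_F H_K.
Qed.

Lemma orthonormal_map s : orthonormal g s -> orthonormal g (map a s).
Proof.
move=> /Defs.orthonormalP[us gs]; apply/Defs.orthonormalP.
rewrite map_inj_uniq //; last exact: H_inj.
split=> // _ _ /mapP[X Xs ->] /mapP[Y Ys ->].
by rewrite H_g gs // (inj_eq H_inj).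
Qed.

Lemma map_adapted_ext s : map a (adapted_ext xi F s) = adapted_ext xi F (map a s).
Proof.
rewrite /adapted_ext !map_cat /= H_xi -!map_comp.
by congr (_ ++ (_ ++ _)); apply: eq_map => X /=; rewrite H_F.
Qed.

End Element.

(** The action of the inverse of a; it spares inverses in formulas. *)
Definition pull a h : tensor_space T := tens (fun X Y Z => ev h (a X) (a Y) (a Z)).

Lemma pullE a h X Y Z : ev (pull a h) X Y Z = ev h (a X) (a Y) (a Z).
Proof.
by rewrite tensE //; split=> *; rewrite linearP (evPl, evPm, evPr).
Qed.

Lemma act_pull a h : act a h = pull a^-1%VF h.
Proof. by apply: evP => X Y Z; rewrite pullE; have := @actE R T a h X Y Z. Qed.

Lemma H_invariantP W :
  H_invariant g xi F W <-> (forall a h, H a -> h \in W -> pull a h \in W).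
Proof.
split=> invW a h aH hW; last by rewrite act_pull; apply: invW => //; apply: H_inv.
have bH := H_inv aH; have := invW _ h bH hW; rewrite act_pull.
suff -> : pull a h = pull (a^-1)^-1%VF h by [].
apply: evP => X Y Z; rewrite !pullE.
suff bK U : (a^-1)^-1%VF U = a U by rewrite !bK.
by rewrite -{1}[U](H_K aH) (H_K bH).
Qed.

Section Frames.

Variables (n : nat).
Hypothesis dimT : \dim {:T} = n.*2.+1.

Lemma adapted_size E : adapted_basis g xi F E -> size E = n.
Proof. by rewrite (adapted_basisE _ _ _ dimT) => /andP[_ /eqP]. Qed.

Lemma map_adapted a E : H a -> adapted_basis g xi F E -> adapted_basis g xi F (map a E).
Proof.
move=> aH; rewrite !(adapted_basisE _ _ _ dimT) size_map => /andP[uE ->]; rewrite andbT.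
by rewrite /unitary_frame -map_adapted_ext // orthonormal_map.
Qed.

(** The linear map between the two completed bases preserves g and commutes
    with F because it does so on the first basis. *)
Lemma adapted_transitive E E' :
  adapted_basis g xi F E -> adapted_basis g xi F E' -> exists2 a, H a & map a E = E'.
Proof.
move=> aE aE'; have [sE sE'] := (adapted_size aE, adapted_size aE').
have [oE oE'] := (adapted_orthonormal aE, adapted_orthonormal aE').
have [be /Defs.orthonormalP[ue ge]] := andP oE.
have [_ /Defs.orthonormalP[ue' ge']] := andP oE'.
have [f fP] := linear_of_free (adapted_ext xi F E) (adapted_ext xi F E').
have {fP} fe : map f (adapted_ext xi F E) = adapted_ext xi F E'.
  by apply: fP; rewrite ?(basis_free be) // !size_adapted_ext sE sE'.
have {f fe}[a ae] : exists a : 'End(T), map a (adapted_ext xi F E) = adapted_ext xi F E'.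
  by exists (linfun f); rewrite -fe; apply: eq_map => X; rewrite lfunE.
exists a; last first.
  move: ae => /eqP; rewrite /adapted_ext map_cat eqseq_cat ?size_map ?sE ?sE' //.
  by case/andP => /eqP.
have g_e : {in adapted_ext xi F E &, forall X Y, g (a X) (a Y) = g X Y}.
  move=> _ _ /(nthP 0)[i ie <-] /(nthP 0)[j je <-].
  have ae_nth k : (k < size (adapted_ext xi F E))%N ->
      a (adapted_ext xi F E)`_k = (adapted_ext xi F E')`_k.
    by move=> ke; rewrite -ae (nth_map 0).
  have es : size (adapted_ext xi F E) = size (adapted_ext xi F E').
    by rewrite !size_adapted_ext sE sE'.
  rewrite !ae_nth // ge' ?ge ?mem_nth -?es //.
  by rewrite !nth_uniq // -?es.
have aP X Y : g (a X) (a Y) = g X Y.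
  have l1 Z : scalar (fun X => g (a X) (a Z)) by move=> c U U' /=; rewrite linearP gPl.
  have l2 Z : scalar (fun X => g (a Z) (a X)) by move=> c U U' /=; rewrite linearP gPr.
  rewrite (scalar_expand X oE (l1 Y)) (scalar_expand X oE (g_scalar g Y)).
  apply: eq_big_seq => U Ue; congr (_ * _).
  rewrite (scalar_expand Y oE (l2 U)) (scalar_expand Y oE (g_scalar_r g U)).
  by apply: eq_big_seq => U' Ue'; rewrite g_e.
have: map a E = E' /\ (map a (map F E) = map F E' /\ a xi = xi).
  move: ae => /eqP; rewrite /adapted_ext !map_cat !eqseq_cat ?size_map ?sE ?sE' //.
  by case/and3P => /eqP-> /eqP-> /eqP[->].
case=> aE1 [aFE axi]; split=> //.
have aV X : X \in V -> a X \in V.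
  by move=> /contactP X0; apply/contactP; rewrite -axi aP.
have aF_E : {in E, forall X, a (F X) = F (a X)}.
  by apply/eq_in_map; rewrite map_comp aFE -aE1 -map_comp.
apply/(fullv_lfunP _ _ (span_basis be)) => X; rewrite !comp_lfunE.
rewrite !mem_cat mem_seq1 => /or3P[XE|/mapP[Y YE ->]|/eqP->].
- exact: aF_E.
- have YV := adapted_contact hF aE YE.
  by rewrite (FF hF YV) linearN (aF_E _ YE) (FF hF (aV _ YV)).
- by rewrite axi (F_xi hF) linear0.
Qed.

End Frames.

End StructureGroup.

(** * Linearity of the defining conditions *)

Ltac ord_cases i lti k :=
  lazymatch k with
  | O => discriminate lti
  | S ?k' => destruct i as [|i]; [clear lti | ord_cases i lti k']
  end.

Section LinearPredicates.

Variables (R : realType) (vT : vectType R).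
Implicit Types (P Q : vT -> Prop) (f : vT -> R).

Definition linear_pred P : Prop :=
  P 0 /\ forall a u v, P u -> P v -> P (a *: u + v).

Lemma linear_pred_and P Q :
  linear_pred P -> linear_pred Q -> linear_pred (fun u => P u /\ Q u).
Proof.
by move=> [P0 PD] [Q0 QD]; split=> // a u v [Pu Qu] [Pv Qv]; split; auto.
Qed.

End LinearPredicates.

Section Linearity.

Variables (R : realType) (T : vectType R).
Variables (F : 'End(T)) (E : seq T).
Implicit Types (X Y Z U : T) (h : tensor_space T).

Lemma app_linear a h h' X Y Z :
  ((a *: h + h' : tensor_space T) : tensor3 R T) X Y Z
    = a * (h : tensor3 R T) X Y Z + (h' : tensor3 R T) X Y Z :> R.
Proof. exact: ev_linear. Qed.

Lemma app0 X Y Z : ((0 : tensor_space T) : tensor3 R T) X Y Z = 0 :> R.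
Proof. exact: ev0. Qed.

Lemma beta_linear a h h' U :
  beta F E (a *: h + h') U = a * beta F E h U + beta F E h' U.
Proof.
rewrite /beta mulr_sumr -big_split; apply: eq_bigr => X _.
by rewrite !app_linear /=; ring.
Qed.

Lemma beta0 U : beta F E (0 : tensor_space T) U = 0.
Proof. by rewrite /beta big1 // => X _; rewrite !app0 addr0. Qed.

Lemma beta_bar_linear a h h' U :
  beta_bar F E (a *: h + h') U = a * beta_bar F E h U + beta_bar F E h' U.
Proof.
rewrite /beta_bar mulr_sumr -big_split; apply: eq_bigr => X _.
by rewrite !app_linear /=; ring.
Qed.

Lemma beta_bar0 U : beta_bar F E (0 : tensor_space T) U = 0.
Proof. by rewrite /beta_bar big1 // => X _; rewrite !app0 subrr. Qed.

End Linearity.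

Section ComponentSpaces.

Variables (R : realType) (T : vectType R).
Variables (g : {dot T for idfun}) (xi : T) (F : 'End(T)).
Variables (n : nat) (E : seq T).

Let combine (a x x' y y' l r : R) :
  x = x' -> y = y' -> l = a * x + y -> r = a * x' + y' -> l = r.
Proof. by move=> -> -> -> ->. Qed.

Ltac zero_eq := repeat intro; rewrite ?(app0, beta0, beta_bar0); ring.
Ltac combine_eq a e e' :=
  apply: (combine (a := a) e e'); rewrite ?(app_linear, beta_linear, beta_bar_linear); ring.

Lemma Tbar_linear : linear_pred (Tbar g xi F : tensor_space T -> Prop).
Proof.
split=> [|a u v [s f] [s' f']]; first by split; zero_eq.
split=> [X Y Z|X Y Z YV ZV]; first by combine_eq a (s X Y Z) (s' X Y Z).
by combine_eq a (f X Y Z YV ZV) (f' X Y Z YV ZV).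
Qed.

Lemma zeroVVV_linear : linear_pred (zeroVVV g xi : tensor_space T -> Prop).
Proof.
split=> [|a u v c c'] X Y Z XV YV ZV; first by zero_eq.
by combine_eq a (c X Y Z XV YV ZV) (c' X Y Z XV YV ZV).
Qed.

Lemma zeroVVx_linear : linear_pred (zeroVVx g xi : tensor_space T -> Prop).
Proof.
split=> [|a u v c c'] X Y XV YV; first by zero_eq.
by combine_eq a (c X Y XV YV) (c' X Y XV YV).
Qed.

Lemma zeroxVx_linear : linear_pred (zeroxVx g xi : tensor_space T -> Prop).
Proof.
split=> [|a u v c c'] X XV; first by zero_eq.
by combine_eq a (c X XV) (c' X XV).
Qed.

Lemma zeroxVV_linear : linear_pred (zeroxVV g xi : tensor_space T -> Prop).
Proof.
split=> [|a u v c c'] X Y XV YV; first by zero_eq.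
by combine_eq a (c X Y XV YV) (c' X Y XV YV).
Qed.

Let z1 := zeroVVV_linear.
Let z2 := zeroVVx_linear.
Let z3 := zeroxVx_linear.
Let z4 := zeroxVV_linear.

Lemma component_linear i :
  linear_pred (Tbar_component g xi F n E i : tensor_space T -> Prop).
Proof.
apply: linear_pred_and; first exact: Tbar_linear.
case: z1 z2 z3 z4 => [p1 q1] [p2 q2] [p3 q3] [p4 q4].
case: i => i lti; split=> [|a u v] /=; ord_cases i lti 12%N; simpl.
all: try by split=> //; (try by split); zero_eq.
- case=> c ? ? ? [c' ? ? ?]; split=> [X Y Z XV YV ZV|||]; auto.
  by combine_eq a (c X Y Z XV YV ZV) (c' X Y Z XV YV ZV).
- case=> c ? ? ? [c' ? ? ?]; split=> [X Y Z XV YV ZV|||]; auto.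
  by combine_eq a (c X Y Z XV YV ZV) (c' X Y Z XV YV ZV).
- case=> c b ? ? ? [c' b' ? ? ?]; split=> [X Y Z XV YV ZV|Z ZV|||]; auto.
    by combine_eq a (c X Y Z XV YV ZV) (c' X Y Z XV YV ZV).
  by combine_eq a (b Z ZV) (b' Z ZV).
- case=> c ? ? ? [c' ? ? ?]; split=> [X Y Z XV YV ZV|||]; auto.
  by combine_eq a (c X Y Z XV YV ZV) (c' X Y Z XV YV ZV).
- case=> s f b [? ? ?] [s' f' b' [? ? ?]]; split=> [X Y XV YV|X Y XV YV||].
  + by combine_eq a (s X Y XV YV) (s' X Y XV YV).
  + by combine_eq a (f X Y XV YV) (f' X Y XV YV).
  + by combine_eq a b b'.
  + by split; auto.
- case=> s f [? ? ?] [s' f' [? ? ?]]; split=> [X Y XV YV|X Y XV YV|].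
  + by combine_eq a (s X Y XV YV) (s' X Y XV YV).
  + by combine_eq a (f X Y XV YV) (f' X Y XV YV).
  + by split; auto.
- case=> c [? ? ?] [c' [? ? ?]]; split=> [X Y XV YV|].
  + by combine_eq a (c X Y XV YV) (c' X Y XV YV).
  + by split; auto.
- case=> s f b [? ? ?] [s' f' b' [? ? ?]]; split=> [X Y XV YV|X Y XV YV||].
  + by combine_eq a (s X Y XV YV) (s' X Y XV YV).
  + by combine_eq a (f X Y XV YV) (f' X Y XV YV).
  + by combine_eq a b b'.
  + by split; auto.
- case=> s f [? ? ?] [s' f' [? ? ?]]; split=> [X Y XV YV|X Y XV YV|].
  + by combine_eq a (s X Y XV YV) (s' X Y XV YV).
  + by combine_eq a (f X Y XV YV) (f' X Y XV YV).
  + by split; auto.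
- case=> c [? ? ?] [c' [? ? ?]]; split=> [X Y XV YV|].
  + by combine_eq a (c X Y XV YV) (c' X Y XV YV).
  + by split; auto.
- by case=> ? ? ? [? ? ?]; split; auto.
- case=> s f ? ? ? [s' f' ? ? ?]; split=> [X Y XV YV|X Y XV YV|||]; auto.
  + by combine_eq a (s X Y XV YV) (s' X Y XV YV).
  + by combine_eq a (f X Y XV YV) (f' X Y XV YV).
Qed.

End ComponentSpaces.

(** * Behaviour under F *)

Section TensorTypes.

Variables (R : realType) (T : vectType R).
Variables (g : {dot T for idfun}) (xi : T) (F : 'End(T)).
Hypothesis hF : almost_contact_metric g xi F.
Local Notation V := (contact_space g xi).
Implicit Types (X Y Z U : T) (h : tensor_space T) (a : 'End(T)).

(** The coordinates of Z in the complex lines of a frame are the products with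
    Fk c (e k): the real ones for c = false, the imaginary ones for c = true. *)
Definition Fk (c : bool) X : T := if c then F X else X.

Lemma Fk_linear c (a : R) X Y : Fk c (a *: X + Y) = a *: Fk c X + Fk c Y.
Proof. by case: c; rewrite //= linearP. Qed.

Lemma Fk_V c X : X \in V -> Fk c X \in V.
Proof. by case: c => // _; exact: FV. Qed.

Section Tbar.

Variable h : tensor_space T.
Hypothesis Bh : Tbar g xi F h.

Lemma Tbar_skew X Y Z : ev h X Y Z = - ev h X Z Y.
Proof. by case: Bh => s _; exact: s. Qed.

Lemma Tbar_xx X Y : ev h X Y Y = 0.
Proof. by have := Tbar_skew X Y Y; lra. Qed.

Lemma Tbar_FF X Y Z : Y \in V -> Z \in V -> ev h X (F Y) (F Z) = - ev h X Y Z.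
Proof.
move=> YV ZV; case: Bh => _ /(_ X Y Z YV ZV) e.
by rewrite /ev e opprK.
Qed.

Lemma Tbar_FC X Y Z : Y \in V -> Z \in V -> ev h X (F Y) Z = ev h X Y (F Z).
Proof.
move=> YV ZV; have := Tbar_FF X YV (FV hF Z).
by rewrite (FF hF ZV) evNr => /oppr_inj.
Qed.

End Tbar.

Lemma Tbar_skew_Fk h : Tbar g xi F h -> forall c X Y Z, Y \in V -> Z \in V ->
  ev h X Y (Fk c Z) = - ev h X Z (Fk c Y).
Proof.
move=> Bh [] X Y Z YV ZV; last exact: (Tbar_skew Bh).
by rewrite /= (Tbar_skew Bh) (Tbar_FC Bh).
Qed.

Section Types.

(** On the part of a tensor in V * V * V, the value delta = -1 singles out the
    tensors that are complex trilinear in the sense of F, and delta = 1 those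
    that are conjugate linear in the first argument. *)
Definition F_type (delta : R) h : Prop :=
  {in V & V & V, forall X Y Z, ev h (F X) (F Y) Z = delta * ev h X Y Z}.

Lemma F_type_FC delta h X Y Z : F_type delta h -> X \in V -> Y \in V -> Z \in V ->
  ev h (F X) Y Z = - delta * ev h X (F Y) Z.
Proof.
move=> dh XV YV ZV; have := dh X (F Y) Z XV (FV hF Y) ZV.
by rewrite (FF hF YV) evNm mulNr => <-; rewrite opprK.
Qed.

(** Alternation carries the two F to the last two arguments, where the
    condition on Tbar applies. *)
Lemma T1_F_type h : Tbar g xi F h -> T1 g xi h -> F_type (-1) h.
Proof.
move=> Bh [s _ _ _] X Y Z XV YV ZV.
have sw A B C : A \in V -> B \in V -> C \in V -> ev h A B C = - ev h B A C.
  by move=> AV BV CV; apply: s.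
have FXV := FV hF X; have FYV := FV hF Y.
rewrite (Tbar_skew Bh) (sw _ Z) // (Tbar_FF Bh) // (sw Z) // (Tbar_skew Bh X).
by ring.
Qed.

(** The cyclic identities at (X, Y, Z), (FX, FY, Z), (FX, Y, FZ) and
    (X, FY, FZ) form a linear system that forces the relation. *)
Lemma T2_F_type h : Tbar g xi F h -> T2 g xi h -> F_type (-1) h.
Proof.
move=> Bh [c _ _ _] X Y Z XV YV ZV.
have cyc A B C : A \in V -> B \in V -> C \in V ->
    ev h A B C + ev h B C A + ev h C A B = 0.
  by move=> AV BV CV; apply: c.
have [[FXV FYV] FZV] := (FV hF X, FV hF Y, FV hF Z).
have c0 := cyc _ _ _ XV YV ZV.
have := cyc _ _ _ FXV FYV ZV; rewrite (Tbar_FF Bh Z) //= -(Tbar_FC Bh (F Y)) //.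
have := cyc _ _ _ FXV YV FZV.
rewrite -(Tbar_FC Bh (F X)) // (Tbar_FF Bh Y) //.
have := cyc _ _ _ XV FYV FZV; rewrite (Tbar_FF Bh X) // -(Tbar_FC Bh (F Z)) //.
by move=> *; lra.
Qed.

Lemma T3_F_type E h : T3 g xi F E h -> F_type 1 h.
Proof.
move=> [c _ _ _ _] X Y Z XV YV ZV; apply/eqP.
by rewrite mul1r eq_sym -subr_eq0; apply/eqP/c.
Qed.

End Types.

End TensorTypes.

(** * The inner product in an adapted basis *)

Ltac nat_cases i k :=
  lazymatch k with
  | O => idtac
  | S ?k' => destruct i as [|i]; [| nat_cases i k']
  end.

Section Orthogonality.

Variables (R : realType) (T : vectType R).
Variables (g : {dot T for idfun}) (xi : T) (F : 'End(T)).
Hypothesis hF : almost_contact_metric g xi F.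
Local Notation V := (contact_space g xi).
Implicit Types (X Y Z U : T) (h : tensor_space T).

Variables (n : nat) (E : seq T).
Hypothesis aE : adapted_basis g xi F E.

Definition contact_basis : seq T := E ++ [seq F X | X <- E].
Local Notation D := contact_basis.

Lemma contact_basisV : {in D, forall X, X \in V}.
Proof.
move=> X; rewrite mem_cat => /orP[/(adapted_contact hF aE)//|/mapP[Y _ ->]].
exact: (FV hF).
Qed.

Lemma big_contact_basis (f : T -> R) :
  \sum_(X <- D) f X = \sum_(X <- E) (f X + f (F X)).
Proof. by rewrite big_cat big_map big_split. Qed.

Lemma eq_big_contact (f f' : T -> R) : {in V, forall X, f X = f' X} ->
  \sum_(X <- D) f X = \sum_(X <- D) f' X.
Proof. by move=> ff'; apply: eq_big_seq => X /contact_basisV; apply: ff'. Qed.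

Lemma big_contact0 (f : T -> R) : {in V, forall X, f X = 0} ->
  \sum_(X <- D) f X = 0.
Proof. by move=> f0; rewrite (eq_big_contact f0) big1_eq. Qed.

Lemma big_contact_F (f : T -> R) : (forall X, f (- X) = f X) ->
  \sum_(X <- D) f (F X) = \sum_(X <- D) f X.
Proof.
move=> fN; rewrite !big_contact_basis; apply: eq_big_seq => X XE.
by rewrite (FF hF) ?(adapted_contact hF aE) // fN addrC.
Qed.

Lemma big_contact_g (f : T -> R) X : scalar f -> X \in V ->
  \sum_(Y <- D) g X Y * f Y = f X.
Proof. by move=> fP XV; rewrite big_contact_basis -(contact_expand aE fP). Qed.

Lemma betaE h U : beta F E h U = \sum_(X <- D) ev h X X U.
Proof. by rewrite big_contact_basis. Qed.

Lemma beta_barE' h U : beta_bar F E h U = \sum_(X <- D) ev h X (F X) U.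
Proof.
rewrite (beta_barE hF) ?big_contact_basis //.
exact: (adapted_contact hF aE).
Qed.

Lemma beta_lin h a U U' : beta F E h (a *: U + U') = a * beta F E h U + beta F E h U'.
Proof.
rewrite !betaE mulr_sumr -big_split; apply: eq_bigr => X _.
by rewrite evPr.
Qed.

Lemma beta_N h U : beta F E h (- U) = - beta F E h U.
Proof. exact: (functionalN (fun a => beta_lin h a)). Qed.

(** Skew symmetry makes the terms with xi in the second place equal to those
    with xi in the third, whence the factors 2. *)
Lemma tensor_dot_adapted h h' : Tbar g xi F h -> Tbar g xi F h' ->
  tensor_dot (adapted_ext xi F E) h h' =
    \sum_(X <- D) \sum_(Y <- D) \sum_(Z <- D) ev h X Y Z * ev h' X Y Z
    + (\sum_(X <- D) \sum_(Y <- D) ev h X Y xi * ev h' X Y xi) *+ 2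
    + \sum_(X <- D) \sum_(Y <- D) ev h xi X Y * ev h' xi X Y
    + (\sum_(X <- D) ev h xi X xi * ev h' xi X xi) *+ 2.
Proof.
move=> Bh Bh'.
have split1 (f : T -> R) :
    \sum_(X <- adapted_ext xi F E) f X = \sum_(X <- D) f X + f xi.
  by rewrite big_adapted_ext big_contact_basis.
pose p X Y Z := ev h X Y Z * ev h' X Y Z.
have pC X Y Z : p X Y Z = p X Z Y.
  by rewrite /p (Tbar_skew Bh) (Tbar_skew Bh') mulrNN.
have p0 X Y : p X Y Y = 0 by rewrite /p (Tbar_xx Bh) mul0r.
have inner X : \sum_(Y <- adapted_ext xi F E) \sum_(Z <- adapted_ext xi F E) p X Y Z
    = \sum_(Y <- D) \sum_(Z <- D) p X Y Z + (\sum_(Y <- D) p X Y xi) *+ 2.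
  rewrite split1 (split1 (p X xi)) p0 addr0 mulr2n addrA.
  rewrite (eq_bigr _ (fun Y _ => split1 (p X Y))) big_split /=; congr (_ + _).
  by apply: eq_bigr => Y _; rewrite pC.
rewrite -[LHS]/(\sum_(X <- adapted_ext xi F E) \sum_(Y <- adapted_ext xi F E)
  \sum_(Z <- adapted_ext xi F E) p X Y Z).
rewrite (eq_bigr _ (fun X _ => inner X)) split1 big_split /= sumrMnl.
by rewrite addrA.
Qed.

Lemma tensor_dotC e h h' : tensor_dot e h h' = tensor_dot e h' h.
Proof. by apply: eq_bigr => X _; apply: eq_bigr => Y _; apply: eq_bigr => Z _; rewrite mulrC. Qed.

Definition concentrated_VVV h : Prop :=
  [/\ zeroVVx g xi h, zeroxVx g xi h & zeroxVV g xi h].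
Definition concentrated_VVxi h : Prop :=
  [/\ zeroVVV g xi h, zeroxVx g xi h & zeroxVV g xi h].

Lemma tensor_dot_VVV h h' : Tbar g xi F h -> Tbar g xi F h' ->
    concentrated_VVV h ->
  tensor_dot (adapted_ext xi F E) h h' =
    \sum_(X <- D) \sum_(Y <- D) \sum_(Z <- D) ev h X Y Z * ev h' X Y Z.
Proof.
move=> Bh Bh' [h1 h2 h3]; rewrite tensor_dot_adapted //.
rewrite [X in _ + X *+ 2 + _]big_contact0 => [|X XV]; last first.
  by apply: big_contact0 => Y YV; rewrite /ev h1 // mul0r.
rewrite [X in _ + X + _]big_contact0 => [|X XV]; last first.
  by apply: big_contact0 => Y YV; rewrite /ev h3 // mul0r.
rewrite [X in _ + X *+ 2]big_contact0 => [|X XV]; last first.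
  by rewrite /ev h2 // mul0r.
by rewrite mul0rn !addr0.
Qed.

Lemma tensor_dot_VVxi h h' : Tbar g xi F h -> Tbar g xi F h' ->
    concentrated_VVxi h ->
  tensor_dot (adapted_ext xi F E) h h' =
    (\sum_(X <- D) \sum_(Y <- D) ev h X Y xi * ev h' X Y xi) *+ 2.
Proof.
move=> Bh Bh' [h1 h2 h3]; rewrite tensor_dot_adapted //.
rewrite [X in X + _ + _ + _]big_contact0 => [|X XV]; last first.
  apply: big_contact0 => Y YV; apply: big_contact0 => Z ZV.
  by rewrite /ev h1 // mul0r.
rewrite [X in _ + X + _]big_contact0 => [|X XV]; last first.
  by apply: big_contact0 => Y YV; rewrite /ev h3 // mul0r.
rewrite [X in _ + X *+ 2]big_contact0 => [|X XV]; last first.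
  by rewrite /ev h2 // mul0r.
by rewrite mul0rn !addr0 add0r.
Qed.

(** * Orthogonality of the components *)

Local Notation dot := (tensor_dot (adapted_ext xi F E)).
Local Notation Tbar := (Tbar g xi F).
Local Notation comp i := (Tbar_component g xi F n E i).

Lemma opp_eq0 (x : R) : x = - x -> x = 0.
Proof. by move=> ?; lra. Qed.

(** Replacing X and Y by FX and FY permutes the basis of V up to sign, and
    changes the sign of the product of h and h'. *)
Lemma dot_F_type delta h h' : delta ^+ 2 = 1 -> Tbar h -> Tbar h' ->
    concentrated_VVV h -> F_type g xi F delta h ->
    F_type g xi F (- delta) h' ->
  dot h h' = 0.
Proof.
move=> d2 Bh Bh' ch dh dh'; rewrite tensor_dot_VVV //; apply: opp_eq0.
rewrite -{1}big_contact_F; last first.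
  by move=> X; apply: eq_bigr => Y _; apply: eq_bigr => Z _; rewrite !evN mulrNN.
rewrite -sumrN; apply: eq_big_contact => X XV.
rewrite -{1}big_contact_F; last first.
  by move=> Y; apply: eq_bigr => Z _; rewrite !evN mulrNN.
rewrite -sumrN; apply: eq_big_contact => Y YV.
rewrite -sumrN; apply: eq_big_contact => Z ZV.
by rewrite dh // dh' // mulrACA mulrN -expr2 d2 mulN1r.
Qed.

(** The alternating tensor does not change when its arguments rotate, so in
    the product h' may be replaced by its cyclic average. *)
Lemma dot_alternating_cyclic h h' : Tbar h -> Tbar h' ->
  T1 g xi h -> T2 g xi h' -> dot h h' = 0.
Proof.
move=> Bh Bh' [a1 a2 a3 a4] [c _ _ _]; rewrite tensor_dot_VVV //.
pose S r := \sum_(X <- D) \sum_(Y <- D) \sum_(Z <- D) ev h X Y Z * r X Y Z.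
have rot X Y Z : X \in V -> Y \in V -> Z \in V -> ev h X Y Z = ev h Y Z X.
  move=> XV YV ZV; have := a1 X Y Z XV YV ZV; have := a1 X Z Y XV ZV YV.
  have := a1 Y Z X YV ZV XV; rewrite -!/(ev h _ _ _) (Tbar_skew Bh X Z).
  rewrite (Tbar_skew Bh Y X) (Tbar_skew Bh Z Y); lra.
have Srot r : S r = S (fun X Y Z => r Z X Y).
  rewrite /S exchange_big /=; apply: eq_big_contact => X XV.
  rewrite exchange_big /=; apply: eq_big_contact => Y YV.
  by apply: eq_big_contact => Z ZV; rewrite (rot Z).
have S2 := Srot (ev h'); have S3 := Srot (fun X Y Z => ev h' Z X Y).
suff : S (ev h') + S (fun X Y Z => ev h' Y Z X) + S (fun X Y Z => ev h' Z X Y) = 0.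
  by rewrite -S3 -S2 -/(S (ev h')); lra.
rewrite /S -!big_split; apply: big_contact0 => X XV.
rewrite -!big_split; apply: big_contact0 => Y YV.
rewrite -!big_split; apply: big_contact0 => Z ZV.
by rewrite /= -!mulrDr /ev c // mulr0.
Qed.

Lemma T4_F_type h : T4 g xi F n E h -> F_type g xi F 1 h.
Proof.
move=> [c _ _ _] X Y Z XV YV ZV; rewrite /ev !c ?(FV hF) // (FF hF YV).
rewrite beta_N gNr (gFF hF X YV) (gFF hF X ZV) !(gFl hF); ring.
Qed.

(** Contracting a tensor of type h_{FX FY Z} = h_{XYZ} with the expression
    that defines the fourth component only involves its trace beta. *)
Lemma dot_trace_VVV h h' : Tbar h -> Tbar h' -> T3 g xi F E h -> T4 g xi F n E h' ->
  dot h h' = 0.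
Proof.
move=> Bh Bh' [d b c1 c2 c3] [e _ _ _]; rewrite tensor_dot_VVV //.
pose c := (2 * (n%:R - 1) : R)^-1; set th := beta F E h' in e.
have thP : forall a U U', th (a *: U + U') = a * th U + th U'.
  by move=> a U U'; exact: beta_lin.
have b0 Z : Z \in V -> \sum_(X <- D) ev h X X Z = 0.
  by move=> ZV; rewrite -betaE b.
have bF0 Z : Z \in V -> \sum_(X <- D) ev h X (F X) Z = 0.
  move=> ZV; apply: etrans (b0 _ (FV hF Z)); apply: eq_big_contact => X XV.
  exact: (Tbar_FC hF Bh).
have c1X X : X \in V -> \sum_(Y <- D) \sum_(Z <- D) ev h X Y Z * ev h' X Y Z
   = 2 * c * (\sum_(Z <- D) ev h X X Z * th Z + \sum_(Z <- D) ev h X (F X) Z * th (F Z)).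
  move=> XV; have FXV := FV hF X.
  transitivity (c * (\sum_(Z <- D) (\sum_(Y <- D) g X Y * ev h X Y Z) * th Z
     - \sum_(Y <- D) (\sum_(Z <- D) g X Z * ev h X Y Z) * th Y
     + \sum_(Z <- D) (\sum_(Y <- D) g (F X) Y * ev h X Y Z) * th (F Z)
     - \sum_(Y <- D) (\sum_(Z <- D) g (F X) Z * ev h X Y Z) * th (F Y))).
    have -> : \sum_(Z <- D) (\sum_(Y <- D) g X Y * ev h X Y Z) * th Z =
        \sum_(Y <- D) \sum_(Z <- D) g X Y * ev h X Y Z * th Z.
      by rewrite exchange_big; apply: eq_bigr => Z _; rewrite mulr_suml.
    have -> : \sum_(Z <- D) (\sum_(Y <- D) g (F X) Y * ev h X Y Z) * th (F Z) =
        \sum_(Y <- D) \sum_(Z <- D) g (F X) Y * ev h X Y Z * th (F Z).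
      by rewrite exchange_big; apply: eq_bigr => Z _; rewrite mulr_suml.
    rewrite -!sumrB -big_split -sumrB mulr_sumr.
    apply: eq_big_contact => Y YV.
    rewrite /= !mulr_suml -!sumrB -big_split -sumrB mulr_sumr.
    apply: eq_big_contact => Z ZV.
    by rewrite /= [ev h' X Y Z]e // !(gFl hF) -/c; ring.
  have l2 Z : scalar (fun Y => ev h X Y Z) := ev_scalar2 h X Z.
  have l3 Y : scalar (ev h X Y) := ev_scalar3 h X Y.
  have -> : \sum_(Z <- D) (\sum_(Y <- D) g X Y * ev h X Y Z) * th Z =
      \sum_(Z <- D) ev h X X Z * th Z.
    by apply: eq_bigr => Z _; rewrite (big_contact_g (l2 Z)).
  have -> : \sum_(Z <- D) (\sum_(Y <- D) g (F X) Y * ev h X Y Z) * th (F Z) =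
      \sum_(Z <- D) ev h X (F X) Z * th (F Z).
    by apply: eq_bigr => Z _; rewrite (big_contact_g (l2 Z)).
  have -> : \sum_(Y <- D) (\sum_(Z <- D) g X Z * ev h X Y Z) * th Y =
      - \sum_(Z <- D) ev h X X Z * th Z.
    rewrite -sumrN; apply: eq_bigr => Y _.
    by rewrite (big_contact_g (l3 Y)) // (Tbar_skew Bh) mulNr.
  have -> : \sum_(Y <- D) (\sum_(Z <- D) g (F X) Z * ev h X Y Z) * th (F Y) =
      - \sum_(Z <- D) ev h X (F X) Z * th (F Z).
    rewrite -sumrN; apply: eq_bigr => Y _.
    by rewrite (big_contact_g (l3 Y)) // (Tbar_skew Bh) mulNr.
  ring.
rewrite (eq_big_contact c1X) -mulr_sumr big_split /=.
rewrite exchange_big [X in _ + X]exchange_big /=.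
rewrite !big_contact0 ?addr0 ?mulr0 // => Z ZV.
  by rewrite -mulr_suml bF0 // mul0r.
by rewrite -mulr_suml b0 // mul0r.
Qed.

Section BilinearPart.

Variables h h' : tensor_space T.
Hypotheses (Bh : Tbar h) (Bh' : Tbar h') (ch : concentrated_VVxi h).

Lemma dot_swap eps : eps ^+ 2 = 1 ->
    {in V &, forall X Y, ev h X Y xi = eps * ev h Y X xi} ->
    {in V &, forall X Y, ev h' X Y xi = - eps * ev h' Y X xi} ->
  dot h h' = 0.
Proof.
move=> e2 e e'; rewrite tensor_dot_VVxi //.
suff -> : \sum_(X <- D) \sum_(Y <- D) ev h X Y xi * ev h' X Y xi = 0 by rewrite mul0rn.
apply: opp_eq0; rewrite {1}exchange_big -sumrN.
apply: eq_big_contact => X XV; rewrite -sumrN.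
apply: eq_big_contact => Y YV.
by rewrite e // e' // mulrACA mulrN -expr2 e2 mulN1r.
Qed.

Lemma dot_F_VVxi delta : delta ^+ 2 = 1 ->
    {in V &, forall X Y, ev h (F X) (F Y) xi = delta * ev h X Y xi} ->
    {in V &, forall X Y, ev h' (F X) (F Y) xi = - delta * ev h' X Y xi} ->
  dot h h' = 0.
Proof.
move=> d2 d d'; rewrite tensor_dot_VVxi //.
suff -> : \sum_(X <- D) \sum_(Y <- D) ev h X Y xi * ev h' X Y xi = 0 by rewrite mul0rn.
apply: opp_eq0; rewrite -{1}big_contact_F; last first.
  by move=> X; apply: eq_bigr => Y _; rewrite !evN mulrNN.
rewrite -sumrN; apply: eq_big_contact => X XV.
rewrite -{1}big_contact_F; last first.
  by move=> Y; rewrite !evN mulrNN.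
rewrite -sumrN; apply: eq_big_contact => Y YV.
by rewrite d // d' // mulrACA mulrN -expr2 d2 mulN1r.
Qed.

(** The contraction with g(X, FY) is a multiple of the trace beta_bar. *)
Lemma dot_beta_bar c :
    {in V &, forall X Y, ev h' X Y xi = c * g X (F Y)} ->
    beta_bar F E h xi = 0 -> dot h h' = 0.
Proof.
move=> e b; rewrite tensor_dot_VVxi //.
suff -> : \sum_(X <- D) \sum_(Y <- D) ev h X Y xi * ev h' X Y xi = 0 by rewrite mul0rn.
transitivity (- c * beta_bar F E h xi); last by rewrite b mulr0.
rewrite beta_barE' mulr_sumr; apply: eq_big_contact => X XV.
rewrite -(big_contact_g (ev_scalar2 h X xi) (FV hF X)) mulr_sumr.
apply: eq_big_contact => Y YV.
by rewrite e // (gFl hF); ring.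
Qed.

Lemma dot_beta c :
    {in V &, forall X Y, ev h' X Y xi = c * g X Y} ->
    beta F E h xi = 0 -> dot h h' = 0.
Proof.
move=> e b; rewrite tensor_dot_VVxi //.
suff -> : \sum_(X <- D) \sum_(Y <- D) ev h X Y xi * ev h' X Y xi = 0 by rewrite mul0rn.
transitivity (c * beta F E h xi); last by rewrite b mulr0.
rewrite betaE mulr_sumr; apply: eq_big_contact => X XV.
rewrite -(big_contact_g (ev_scalar2 h X xi) XV) mulr_sumr.
apply: eq_big_contact => Y YV.
by rewrite e //; ring.
Qed.

End BilinearPart.

Lemma dot_VVV_zero h h' : Tbar h -> Tbar h' ->
  concentrated_VVV h -> zeroVVV g xi h' -> dot h h' = 0.
Proof.
move=> Bh Bh' ch z; rewrite tensor_dot_VVV //.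
apply: big_contact0 => X XV; apply: big_contact0 => Y YV.
by apply: big_contact0 => Z ZV; rewrite /ev z // mulr0.
Qed.

Lemma dot_VVxi_zero h h' : Tbar h -> Tbar h' ->
  concentrated_VVxi h -> zeroVVx g xi h' -> dot h h' = 0.
Proof.
move=> Bh Bh' ch z; rewrite tensor_dot_VVxi //.
rewrite big_contact0 ?mul0rn // => X XV.
by apply: big_contact0 => Y YV; rewrite /ev z // mulr0.
Qed.

Lemma dot_T11_T12 h h' : Tbar h -> Tbar h' -> T11 g xi h -> T12 g xi F h' -> dot h h' = 0.
Proof.
move=> Bh Bh' [z1 z2 z3] [_ _ _ _ z4]; rewrite (tensor_dot_adapted Bh Bh').
rewrite [X in X + _ + _ + _]big_contact0 => [|X XV]; last first.
  apply: big_contact0 => Y YV; apply: big_contact0 => Z ZV.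
  by rewrite /ev z1 // mul0r.
rewrite [X in _ + X *+ 2 + _]big_contact0 => [|X XV]; last first.
  by apply: big_contact0 => Y YV; rewrite /ev z2 // mul0r.
rewrite [X in _ + X + _]big_contact0 => [|X XV]; last first.
  by apply: big_contact0 => Y YV; rewrite /ev z3 // mul0r.
rewrite [X in _ + X *+ 2]big_contact0 => [|X XV]; last first.
  by rewrite /ev z4 // mulr0.
by rewrite mul0rn !addr0.
Qed.

Lemma T7_scalar h : T7 g xi F n E h -> exists c : R,
  {in V &, forall X Y, ev h X Y xi = c * g X (F Y)}.
Proof.
case=> e _; exists (- (2 * n%:R)^-1 * beta_bar F E h xi) => X Y XV YV.
by rewrite /ev e // mulrAC.
Qed.

Lemma T10_scalar h : T10 g xi F n E h -> exists c : R,
  {in V &, forall X Y, ev h X Y xi = c * g X Y}.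
Proof.
case=> e _; exists ((2 * n%:R)^-1 * beta F E h xi) => X Y XV YV.
by rewrite /ev e // mulrAC.
Qed.

Definition xi_sym (eps : R) h : Prop :=
  {in V &, forall X Y, ev h X Y xi = eps * ev h Y X xi}.
Definition xi_F_type (delta : R) h : Prop :=
  {in V &, forall X Y, ev h (F X) (F Y) xi = delta * ev h X Y xi}.

Lemma T7_types h : T7 g xi F n E h -> xi_sym (-1) h /\ xi_F_type 1 h.
Proof.
case/T7_scalar => c e; split=> X Y XV YV.
  by rewrite !e // gC (gFl hF); ring.
by rewrite !e ?(FV hF) // (gFF hF X (FV hF Y)) mul1r.
Qed.

Lemma T10_types h : T10 g xi F n E h -> xi_sym 1 h /\ xi_F_type 1 h.
Proof.
case/T10_scalar => c e; split=> X Y XV YV.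
  by rewrite !e // gC; ring.
by rewrite !e ?(FV hF) // (gFF hF X YV) mul1r.
Qed.

Lemma T5_types h : T5 g xi F E h -> xi_sym (-1) h /\ xi_F_type 1 h.
Proof. by case=> s f _ _; split=> X Y XV YV; rewrite /ev ?mulN1r ?mul1r; auto. Qed.

Lemma T6_types h : T6 g xi F h -> xi_sym (-1) h /\ xi_F_type (-1) h.
Proof. by case=> s f _; split=> X Y XV YV; rewrite /ev mulN1r; auto. Qed.

Lemma T8_types h : T8 g xi F E h -> xi_sym 1 h /\ xi_F_type 1 h.
Proof. by case=> s f _ _; split=> X Y XV YV; rewrite /ev mul1r; auto. Qed.

Lemma T9_types h : T9 g xi F h -> xi_sym 1 h /\ xi_F_type (-1) h.
Proof. by case=> s f _; split=> X Y XV YV; rewrite /ev ?mulN1r ?mul1r; auto. Qed.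

Lemma component_VVV (i : 'I_12) h : (i < 4)%N -> comp i h -> concentrated_VVV h.
Proof.
by case: i => i lti /= li4 [_] /=; move: li4; ord_cases i lti 12%N => //= _; case.
Qed.

Lemma component_zeroVVV (i : 'I_12) h : (4 <= i)%N -> comp i h -> zeroVVV g xi h.
Proof.
by case: i => i lti /= li4 [_] /=; move: li4; ord_cases i lti 12%N => //= _;
  first [case=> _ _ _ [] | case=> _ _ [] | case=> _ [] | case].
Qed.

Lemma component_VVxi (i : 'I_12) h : (4 <= i < 10)%N -> comp i h -> concentrated_VVxi h.
Proof.
by case: i => i lti /= li [_] /=; move: li; ord_cases i lti 12%N => //= _;
  first [case=> _ _ _ [] | case=> _ _ [] | case=> _ []].
Qed.

Lemma component_zeroVVxi (i : 'I_12) h : (10 <= i)%N -> comp i h -> zeroVVx g xi h.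
Proof.
by case: i => i lti /= li [_] /=; move: li; ord_cases i lti 12%N => //= _; case.
Qed.

Lemma component_dot_lt (i j : 'I_12) h h' : (i < j)%N -> comp i h -> comp j h' ->
  dot h h' = 0.
Proof.
move=> ltij ci cj; have [Bh Bh'] : Tbar h /\ Tbar h' by case: ci; case: cj.
have [i4|i4] := ltnP i 4.
  have cVVV := component_VVV i4 ci; have [j4|j4] := ltnP j 4; last first.
    exact: (dot_VVV_zero Bh Bh' cVVV (component_zeroVVV j4 cj)).
  have nF d : F_type g xi F d h -> F_type g xi F (- d) h' -> d ^+ 2 = 1 -> dot h h' = 0.
    by move=> dh dh' d2; exact: (dot_F_type d2).
  case: ci cj => [_ +] [_ +]; clear cVVV.
  case: i j ltij i4 j4 => [i lti] [j ltj] /=.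
  nat_cases i 4%N; nat_cases j 4%N => //= _ _ _.
  - exact: dot_alternating_cyclic.
  - move=> t t'; apply: (@nF (-1)); rewrite ?opprK ?sqrrN ?expr1n //.
      exact: (T1_F_type hF).
    exact: (T3_F_type t').
  - move=> t t'; apply: (@nF (-1)); rewrite ?opprK ?sqrrN ?expr1n //.
      exact: (T1_F_type hF).
    exact: (T4_F_type t').
  - move=> t t'; apply: (@nF (-1)); rewrite ?opprK ?sqrrN ?expr1n //.
      exact: (T2_F_type hF).
    exact: (T3_F_type t').
  - move=> t t'; apply: (@nF (-1)); rewrite ?opprK ?sqrrN ?expr1n //.
      exact: (T2_F_type hF).
    exact: (T4_F_type t').
  - exact: dot_trace_VVV.
have [i10|i10] := ltnP i 10; last first.
  have [ei ej] : i = 10%N :> nat /\ j = 11%N :> nat by have := ltn_ord j; lia.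
  case: ci cj => [_ +] [_ +]; rewrite ei ej /=; exact: dot_T11_T12.
have cVVx := @component_VVxi i h (introT andP (conj i4 i10)) ci.
have [j10|j10] := ltnP j 10; last first.
  exact: (dot_VVxi_zero Bh Bh' cVVx (component_zeroVVxi j10 cj)).
have sq1 : (-1) ^+ 2 = 1 :> R by rewrite sqrrN expr1n.
have sq2 : 1 ^+ 2 = 1 :> R by rewrite expr1n.
have sw1 : xi_sym (-1) h -> xi_sym 1 h' -> dot h h' = 0.
  by move=> e; rewrite -[1]opprK => e'; exact: (dot_swap Bh Bh' cVVx sq1 e e').
have sw2 : xi_sym 1 h -> xi_sym (-1) h' -> dot h h' = 0.
  by move=> e e'; exact: (dot_swap Bh Bh' cVVx sq2 e e').
have sF1 : xi_F_type (-1) h -> xi_F_type 1 h' -> dot h h' = 0.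
  by move=> d; rewrite -[1]opprK => d'; exact: (dot_F_VVxi Bh Bh' cVVx sq1 d d').
have sF2 : xi_F_type 1 h -> xi_F_type (-1) h' -> dot h h' = 0.
  by move=> d d'; exact: (dot_F_VVxi Bh Bh' cVVx sq2 d d').
case: ci cj => [_ +] [_ +].
case: i j ltij i4 i10 j10 => [i lti] [j ltj] /=.
nat_cases i 10%N => //; nat_cases j 10%N => //= _ _ _ _.
- by case/T5_types => _ d /T6_types[_]; apply: sF2.
- case=> _ _ b _ /T7_scalar[c e]; exact: (dot_beta_bar Bh Bh' cVVx e b).
- by case/T5_types => e _ /T8_types[+ _]; apply: sw1.
- by case/T5_types => e _ /T9_types[+ _]; apply: sw1.
- by case/T5_types => e _ /T10_types[+ _]; apply: sw1.
- by case/T6_types => _ d /T7_types[_]; apply: sF1.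
- by case/T6_types => e _ /T8_types[+ _]; apply: sw1.
- by case/T6_types => e _ /T9_types[+ _]; apply: sw1.
- by case/T6_types => e _ /T10_types[+ _]; apply: sw1.
- by case/T7_types => e _ /T8_types[+ _]; apply: sw1.
- by case/T7_types => e _ /T9_types[+ _]; apply: sw1.
- by case/T7_types => e _ /T10_types[+ _]; apply: sw1.
- by case/T8_types => _ d /T9_types[_]; apply: sF2.
- case=> _ _ b _ /T10_scalar[c e]; exact: (dot_beta Bh Bh' cVVx e b).
- by case/T9_types => _ d /T10_types[_]; apply: sF1.
Qed.

Lemma component_dot (i j : 'I_12) h h' : i != j -> comp i h -> comp j h' ->
  dot h h' = 0.
Proof.
rewrite -val_eqE neq_ltn => /orP[ltij|ltji] ci cj; first exact: component_dot_lt ltij ci cj.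
by rewrite tensor_dotC; exact: component_dot_lt ltji cj ci.
Qed.

End Orthogonality.

(** * Tensors built from forms on the contact space *)

Section Construction.

Variables (R : realType) (T : vectType R).
Variables (g : {dot T for idfun}) (xi : T) (F : 'End(T)).
Hypothesis hF : almost_contact_metric g xi F.
Local Notation V := (contact_space g xi).
Local Notation p := (proj g xi).
Local Notation Tbar := (Tbar g xi F).
Implicit Types (X Y Z U : T) (h : tensor_space T).

Definition bilinear_form (b : T -> T -> R) : Prop :=
  (forall a X X' Y, b (a *: X + X') Y = a * b X Y + b X' Y) /\
  (forall a X Y Y', b X (a *: Y + Y') = a * b X Y + b X Y').

Definition tensV (f : T -> T -> T -> R) : tensor_space T :=
  tens (fun X Y Z => f (p X) (p Y) (p Z)).

Definition tensVVxi (b : T -> T -> R) : tensor_space T :=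
  tens (fun X Y Z => b (p X) (p Y) * g Z xi - b (p X) (p Z) * g Y xi).

Definition tensxiVV (b : T -> T -> R) : tensor_space T :=
  tens (fun X Y Z => g X xi * b (p Y) (p Z)).

Definition tensxiVxi (t : T -> R) : tensor_space T :=
  tens (fun X Y Z => g X xi * (t (p Y) * g Z xi - t (p Z) * g Y xi)).

Lemma trilinear0 f : trilinear f ->
  [/\ forall Y Z, f 0 Y Z = 0, forall X Z, f X 0 Z = 0 & forall X Y, f X Y 0 = 0 :> R].
Proof.
case=> fl fm fr; split=> U U'.
- by apply: (@functional0 _ _ (fun X => f X U U')) => a X Y; rewrite fl.
- by apply: (@functional0 _ _ (fun X => f U X U')) => a X Y; rewrite fm.
- by apply: (@functional0 _ _ (f U U')) => a X Y; rewrite fr.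
Qed.

Lemma tensVE f X Y Z : trilinear f -> ev (tensV f) X Y Z = f (p X) (p Y) (p Z).
Proof.
by move=> [fl fm fr]; rewrite tensE //; split=> *; rewrite projP ?fl ?fm ?fr.
Qed.

Lemma tensV_in f : trilinear f ->
  {in V & V & V, forall X Y Z, ev (tensV f) X Y Z = f X Y Z}.
Proof. by move=> fP X Y Z XV YV ZV; rewrite tensVE // !proj_id. Qed.

Lemma tensVVxiE b X Y Z : bilinear_form b ->
  ev (tensVVxi b) X Y Z = b (p X) (p Y) * g Z xi - b (p X) (p Z) * g Y xi.
Proof.
by move=> [bl br]; rewrite tensE //; split=> *; rewrite !projP ?bl ?br ?gPl; ring.
Qed.

Lemma tensxiVVE b X Y Z : bilinear_form b ->
  ev (tensxiVV b) X Y Z = g X xi * b (p Y) (p Z).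
Proof.
by move=> [bl br]; rewrite tensE //; split=> *; rewrite ?projP ?bl ?br ?gPl; ring.
Qed.

Lemma tensxiVxiE t X Y Z : scalar t ->
  ev (tensxiVxi t) X Y Z = g X xi * (t (p Y) * g Z xi - t (p Z) * g Y xi).
Proof.
by move=> tP; rewrite tensE //; split=> *; rewrite ?projP ?tP ?gPl; ring.
Qed.

Lemma scalar_proj0 t : scalar t -> t (p xi) = 0.
Proof. by move=> tP; rewrite (proj_xi hF) functional0. Qed.

Lemma bilinear0 b : bilinear_form b -> (forall Y, b 0 Y = 0) /\ (forall X, b X 0 = 0).
Proof.
case=> bl br; split=> U.
  by apply: (@functional0 _ _ (fun X => b X U)) => a X Y; rewrite bl.
by apply: (@functional0 _ _ (b U)) => a X Y; rewrite br.
Qed.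

Lemma tensV_Tbar f : trilinear f ->
    {in V & V & V, forall X Y Z, f X Y Z = - f X Z Y} ->
    {in V & V & V, forall X Y Z, f X Y Z = - f X (F Y) (F Z)} ->
  Tbar (tensV f) /\ concentrated_VVV g xi (tensV f).
Proof.
move=> fP fs fF; have [f0l f0m f0r] := trilinear0 fP.
have pV X := projV hF X; split; [split=> [X Y Z|X Y Z YV ZV] |
  split=> [X Y XV YV|X XV|X Y XV YV]]; rewrite -!/(ev _ _ _ _).
- by rewrite !tensVE // fs.
- rewrite !tensVE // !(proj_id (FV hF _)) (proj_id YV) (proj_id ZV).
  exact: fF.
- by rewrite tensVE // (proj_xi hF) f0r.
- by rewrite tensVE // (proj_xi hF) f0r.
- by rewrite tensVE // (proj_xi hF) f0l.
Qed.

Lemma tensVVxi_Tbar b : bilinear_form b ->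
  [/\ Tbar (tensVVxi b), concentrated_VVxi g xi (tensVVxi b) &
      {in V &, forall X Y, ev (tensVVxi b) X Y xi = b X Y}].
Proof.
move=> bP; have [b0l b0r] := bilinear0 bP; have g0 X : X \in V -> g X xi = 0 by move/contactP.
split; first split=> [X Y Z|X Y Z YV ZV].
- by rewrite -!/(ev _ _ _ _) !tensVVxiE //; ring.
- rewrite -!/(ev _ _ _ _) !tensVVxiE // (g0 _ YV) (g0 _ ZV).
  by rewrite !(g0 _ (FV hF _)); ring.
- split=> [X Y Z XV YV ZV|X XV|X Y XV YV]; rewrite -!/(ev _ _ _ _) tensVVxiE //.
  + by rewrite !g0 // !mulr0 subr0.
  + by rewrite (proj_xi hF) !b0l !mul0r subr0.
  + by rewrite (proj_xi hF) !b0l !mul0r subr0.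
- move=> X Y XV YV; rewrite tensVVxiE // (proj_id XV) (proj_id YV) (g_xi hF) g0 //.
  by rewrite mulr1 mulr0 subr0.
Qed.

Lemma tensxiVV_Tbar b : bilinear_form b ->
    {in V &, forall X Y, b X Y = - b Y X} ->
    {in V &, forall X Y, b X Y = - b (F X) (F Y)} ->
  [/\ Tbar (tensxiVV b), zeroVVV g xi (tensxiVV b), zeroVVx g xi (tensxiVV b),
      zeroxVx g xi (tensxiVV b) &
      {in V &, forall X Y, ev (tensxiVV b) xi X Y = b X Y}].
Proof.
move=> bP bs bF; have [b0l b0r] := bilinear0 bP.
have g0 X : X \in V -> g X xi = 0 by move/contactP.
have pV X := projV hF X.
split; first split=> [X Y Z|X Y Z YV ZV].
- by rewrite -!/(ev _ _ _ _) !tensxiVVE // bs // mulrN.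
- rewrite -!/(ev _ _ _ _) !tensxiVVE // !(proj_id (FV hF _)) !proj_id //.
  by rewrite bF // mulrN.
- by move=> X Y Z XV YV ZV; rewrite -!/(ev _ _ _ _) tensxiVVE // g0 // mul0r.
- by move=> X Y XV YV; rewrite -!/(ev _ _ _ _) tensxiVVE // g0 // mul0r.
- by move=> X XV; rewrite -!/(ev _ _ _ _) tensxiVVE // (proj_xi hF) b0r mulr0.
- by move=> X Y XV YV; rewrite tensxiVVE // (proj_id XV) (proj_id YV) (g_xi hF) mul1r.
Qed.

Lemma tensxiVxi_Tbar t : scalar t ->
  [/\ Tbar (tensxiVxi t), T11 g xi (tensxiVxi t) &
      {in V, forall X, ev (tensxiVxi t) xi X xi = t X}].
Proof.
move=> tP; have g0 X : X \in V -> g X xi = 0 by move/contactP.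
split; first split=> [X Y Z|X Y Z YV ZV].
- by rewrite -!/(ev _ _ _ _) !tensxiVxiE //; ring.
- rewrite -!/(ev _ _ _ _) !tensxiVxiE // (g0 _ YV) (g0 _ ZV).
  by rewrite !(g0 _ (FV hF _)); ring.
- split=> [X Y Z XV YV ZV|X Y XV YV|X Y XV YV]; rewrite -!/(ev _ _ _ _) tensxiVxiE //.
  + by rewrite g0 // mul0r.
  + by rewrite g0 // mul0r.
  + by rewrite (g0 _ XV) (g0 _ YV) !mulr0 subr0 mulr0.
- move=> X XV; rewrite tensxiVxiE // scalar_proj0 // (proj_id XV) (g_xi hF).
  by rewrite !mulr1 mul1r mul0r subr0.
Qed.

(** Decomposing each argument along xi and V expresses h by its four parts;
    by skew symmetry no term has xi in both the second and the third place. *)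
Lemma Tbar_ext h h' : Tbar h -> Tbar h' ->
    {in V & V & V, forall X Y Z, ev h X Y Z = ev h' X Y Z} ->
    {in V &, forall X Y, ev h X Y xi = ev h' X Y xi} ->
    {in V, forall X, ev h xi X xi = ev h' xi X xi} ->
    {in V &, forall X Y, ev h xi X Y = ev h' xi X Y} ->
  h = h'.
Proof.
move=> Bh Bh' e1 e2 e3 e4; apply: evP => X Y Z.
have ex k : Tbar k -> ev k X Y Z =
    ev k (p X) (p Y) (p Z) + g Z xi * ev k (p X) (p Y) xi - g Y xi * ev k (p X) (p Z) xi
  + g X xi * (ev k xi (p Y) (p Z) + g Z xi * ev k xi (p Y) xi - g Y xi * ev k xi (p Z) xi).
  move=> Bk; rewrite {1}(proj_split g xi X) {1}(proj_split g xi Y) {1}(proj_split g xi Z).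
  rewrite !(evPl, evPm, evPr) !(Tbar_xx Bk) (Tbar_skew Bk _ xi (p Z)) (Tbar_skew Bk _ xi (p Z)).
  by ring.
have pV U := projV hF U.
by rewrite !ex // e1 // !e3 // !e2 // e4.
Qed.

Section Vanishing.

Variables (n : nat) (E : seq T).

Let eq0 h : Tbar h -> zeroVVV g xi h -> zeroVVx g xi h -> zeroxVx g xi h ->
  zeroxVV g xi h -> h = 0.
Proof.
move=> Bh z1 z2 z3 z4; apply: (Tbar_ext Bh (Tbar_linear g xi F).1).
- by move=> X Y Z XV YV ZV; rewrite ev0; exact: z1.
- by move=> X Y XV YV; rewrite ev0; exact: z2.
- by move=> X XV; rewrite ev0; exact: z3.
- by move=> X Y XV YV; rewrite ev0; exact: z4.
Qed.

Lemma T4_eq0 h : Tbar h -> T4 g xi F n E h -> {in V, forall X, beta F E h X = 0} -> h = 0.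
Proof.
move=> Bh [t z2 z3 z4] b0; apply: eq0 => // X Y Z XV YV ZV.
by rewrite t // !b0 ?(FV hF) // !mulr0 !addr0 !subr0 mulr0.
Qed.

Lemma VVxi_eq0 h : Tbar h -> concentrated_VVxi g xi h ->
  {in V &, forall X Y, ev h X Y xi = 0} -> h = 0.
Proof. by move=> Bh [z1 z3 z4] z2; exact: eq0. Qed.

Lemma T11_eq0 h : Tbar h -> T11 g xi h -> {in V, forall X, ev h xi X xi = 0} -> h = 0.
Proof. by move=> Bh [z1 z2 z4] z3; exact: eq0. Qed.

Lemma T12_eq0 h : Tbar h -> T12 g xi F h -> {in V &, forall X Y, ev h xi X Y = 0} -> h = 0.
Proof. by move=> Bh [_ _ z1 z2 z3] z4; exact: eq0. Qed.

End Vanishing.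

End Construction.

(** * The components span *)

Section Decomposition.

Variables (R : realType) (T : vectType R).
Variables (g : {dot T for idfun}) (xi : T) (F : 'End(T)).
Hypothesis hF : almost_contact_metric g xi F.
Local Notation V := (contact_space g xi).
Local Notation Tbar := (Tbar g xi F).
Implicit Types (X Y Z U : T) (h : tensor_space T).

Variables (n : nat) (E : seq T).
Hypotheses (n_gt1 : (1 < n)%N) (dimT : \dim {:T} = n.*2.+1).
Hypothesis aE : adapted_basis g xi F E.
Local Notation D := (contact_basis F E).

Variable S : {vspace (tensor_space T)}.
Hypothesis compS : forall i h, Tbar_component g xi F n E i h -> h \in S.

Lemma sum_contact_g : \sum_(X <- D) g X X = 2 * n%:R.
Proof.
rewrite big_contact_basis -(adapted_size dimT aE) -sum1_size natr_sum mulr_sumr.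
apply: eq_big_seq => X XE; rewrite (gFF hF) ?(adapted_contact hF aE) //.
by rewrite (adapted_g hF aE) // eqxx mulr1.
Qed.

Let c4 : R := (2 * (n%:R - 1))^-1.

Let c4K : c4 * (2 * (n%:R - 1)) = 1.
Proof.
by rewrite mulVf // mulf_neq0 ?pnatr_eq0 // subr_eq0 pnatr_eq1; case: n n_gt1 => [|[]].
Qed.

(** The formula that defines the fourth component, with an arbitrary one-form
    th in place of beta; the constant in it is the one for which the trace of
    the resulting tensor is th again. *)
Lemma trace_tensor (th : T -> R) : scalar th -> exists k,
  [/\ trilinear k, {in V & V & V, forall X Y Z, k X Y Z = - k X Z Y},
      {in V & V & V, forall X Y Z, k X Y Z = - k X (F Y) (F Z)},
      {in V & V & V, forall X Y Z, k (F X) (F Y) Z = k X Y Z} &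
      {in V, forall Z, beta F E (tensV g xi k) Z = th Z} /\
      Tbar_component g xi F n E (@Ordinal 12 3 isT) (tensV g xi k)].
Proof.
move=> thP.
have thN U : th (- U) = - th U := functionalN thP U.
pose k X Y Z := c4 * (g X Y * th Z - g X Z * th Y - g X (F Y) * th (F Z)
                     + g X (F Z) * th (F Y)).
exists k; have kP : trilinear k.
  have FP a U U' : F (a *: U + U') = a *: F U + F U' by rewrite linearP.
  by split=> *; rewrite /k !(FP, gPl, gPr, thP); ring.
have ks : {in V & V & V, forall X Y Z, k X Y Z = - k X Z Y}.
  by move=> X Y Z XV YV ZV; rewrite /k; ring.
have kF : {in V & V & V, forall X Y Z, k X Y Z = - k X (F Y) (F Z)}.
  by move=> X Y Z XV YV ZV; rewrite /k !(FF hF) // !gNr !thN; ring.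
have kd : {in V & V & V, forall X Y Z, k (F X) (F Y) Z = k X Y Z}.
  move=> X Y Z XV YV ZV; rewrite /k (FF hF YV) (gFF hF X YV) (gFF hF X ZV).
  by rewrite gNr !thN !(gFl hF); ring.
have bk : {in V, forall Z, beta F E (tensV g xi k) Z = th Z}.
  move=> Z ZV; rewrite betaE.
  have e X : X \in V -> ev (tensV g xi k) X X Z = c4 * (g X X * th Z)
      + - c4 * (g Z X * th X) + c4 * (g (F Z) X * th (F X)).
    by move=> XV; rewrite tensV_in // /k (gXFX hF) (gC g X Z) (gC g X (F Z)); ring.
  rewrite (eq_big_contact hF aE e) !big_split -!mulr_sumr -mulr_suml /= sum_contact_g.
  have thF : scalar (fun X => th (F X)) by move=> a X Y /=; rewrite linearP thP.
  rewrite (big_contact_g aE thP ZV) (big_contact_g aE thF (FV hF Z)) (FF hF ZV) thN.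
  transitivity (c4 * (2 * (n%:R - 1)) * th Z); first by ring.
  by rewrite c4K mul1r.
have [Bk [c1 c2 c3]] := tensV_Tbar hF kP ks kF.
split=> //; split=> //; split=> //; split=> //= X Y Z XV YV ZV.
by rewrite -!/(ev _ _ _ _) tensV_in // !bk ?(FV hF).
Qed.

Section VVVPart.

Variable f : T -> T -> T -> R.
Hypotheses (fP : trilinear f)
  (fs : {in V & V & V, forall X Y Z, f X Y Z = - f X Z Y})
  (fF : {in V & V & V, forall X Y Z, f X Y Z = - f X (F Y) (F Z)}).

Let fN U U' : [/\ forall X, f (- X) U U' = - f X U U', forall X, f U (- X) U' = - f U X U'
  & forall X, f U U' (- X) = - f U U' X].
Proof.
case: fP => fl fm fr; split=> X.
- by apply: (@functionalN _ _ (fun X => f X U U')) => a Y Z; rewrite fl.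
- by apply: (@functionalN _ _ (fun X => f U X U')) => a Y Z; rewrite fm.
- by apply: (@functionalN _ _ (f U U')) => a Y Z; rewrite fr.
Qed.

Let fFC X Y Z : X \in V -> Y \in V -> Z \in V -> f X (F Y) Z = f X Y (F Z).
Proof.
move=> XV YV ZV; rewrite fF // ?(FV hF) // (FF hF YV).
by case: (fN X (F Z)) => _ -> _; rewrite opprK.
Qed.

Let fFF X Y Z : X \in V -> Y \in V -> Z \in V -> f X (F Y) (F Z) = - f X Y Z.
Proof. by move=> XV YV ZV; rewrite [in RHS]fF // opprK. Qed.

(** One third of the cyclic sum is alternating, and the cyclic sum of the
    difference vanishes. *)
Lemma tensV_antitype :
    {in V & V & V, forall X Y Z, f (F X) (F Y) Z = - f X Y Z} ->
  tensV g xi f \in S.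
Proof.
move=> d; have VF := FV hF.
pose alt c X Y Z := c * (f X Y Z + f Y Z X + f Z X Y).
have altP c : trilinear (alt c).
  by case: fP => fl fm fr; split=> *; rewrite /alt !fl !fm !fr; ring.
have altF c : {in V & V & V, forall X Y Z, alt c X Y Z = - alt c X (F Y) (F Z)}.
  move=> X Y Z XV YV ZV; rewrite /alt fFF // (d Y) //.
  by rewrite -(fFC (VF Z) XV YV) (d Z) //; ring.
have alts c : {in V & V & V, forall X Y Z, alt c X Y Z = - alt c X Z Y}.
  move=> X Y Z XV YV ZV; rewrite /alt (fs XV ZV YV) (fs ZV YV XV) (fs YV XV ZV).
  by ring.
pose c : R := 3^-1; have c3 : 3 * c = 1 by rewrite mulfV // pnatr_eq0.
pose f' X Y Z := f X Y Z - alt c X Y Z.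
have f'P : trilinear f'.
  case: fP => fl fm fr; case: (altP c) => al am ar.
  by split=> *; rewrite /f' ?fl ?fm ?fr ?al ?am ?ar; ring.
have f'F : {in V & V & V, forall X Y Z, f' X Y Z = - f' X (F Y) (F Z)}.
  by move=> X Y Z XV YV ZV; rewrite /f' (fF XV YV ZV) (altF c _ _ _ XV YV ZV); ring.
have f's : {in V & V & V, forall X Y Z, f' X Y Z = - f' X Z Y}.
  by move=> X Y Z XV YV ZV; rewrite /f' (fs XV YV ZV) (alts c _ _ _ XV YV ZV); ring.
have -> : tensV g xi f = tensV g xi (alt c) + tensV g xi f'.
  by apply: evP => X Y Z; rewrite evD !tensVE // /f'; ring.
apply: tensor_memD.
  have [B [c1 c2 c3']] := tensV_Tbar hF (altP c) (alts c) (altF c).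
  apply: (@compS (@Ordinal 12 0 isT)); split=> //; split=> //= X Y Z XV YV ZV.
  rewrite -!/(ev _ _ _ _) !tensV_in // /alt.
  by rewrite (fs YV XV ZV) (fs XV ZV YV) (fs ZV YV XV); ring.
have [B [c1 c2 c3']] := tensV_Tbar hF f'P f's f'F.
apply: (@compS (@Ordinal 12 1 isT)); split=> //; split=> //= X Y Z XV YV ZV.
rewrite -!/(ev _ _ _ _) !tensV_in // /f' /alt.
transitivity ((1 - 3 * c) * (f X Y Z + f Y Z X + f Z X Y)); first by ring.
by rewrite c3 subrr mul0r.
Qed.

(** Subtracting the trace tensor of the one-form beta leaves a trace-free one. *)
Lemma tensV_type :
    {in V & V & V, forall X Y Z, f (F X) (F Y) Z = f X Y Z} ->
  tensV g xi f \in S.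
Proof.
move=> d; have VF := FV hF; case: (fP) => fl fm fr.
have [Bf cf] := tensV_Tbar hF fP fs fF.
pose th := beta F E (tensV g xi f).
have thP : scalar th by move=> a U U'; apply: beta_lin.
have [k [kP ks kF kd [bk k4]]] := trace_tensor thP.
pose f' X Y Z := f X Y Z - k X Y Z.
have f'P : trilinear f'.
  by case: kP => kl km kr; split=> *; rewrite /f' ?fl ?fm ?fr ?kl ?km ?kr; ring.
have f'F : {in V & V & V, forall X Y Z, f' X Y Z = - f' X (F Y) (F Z)}.
  by move=> X Y Z XV YV ZV; rewrite /f' (fF XV YV ZV) (kF _ _ _ XV YV ZV); ring.
have f's : {in V & V & V, forall X Y Z, f' X Y Z = - f' X Z Y}.
  by move=> X Y Z XV YV ZV; rewrite /f' (fs XV YV ZV) (ks _ _ _ XV YV ZV); ring.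
have split_f : tensV g xi f = tensV g xi f' + tensV g xi k.
  by apply: evP => X Y Z; rewrite evD !tensVE // /f'; ring.
have bf' : {in V, forall Z, beta F E (tensV g xi f') Z = 0}.
  move=> Z ZV; have : th Z = beta F E (tensV g xi f') Z + beta F E (tensV g xi k) Z.
    by rewrite /th split_f !betaE -big_split; apply: eq_bigr => X _; rewrite evD.
  by rewrite bk // => /esym/(canRL (addrK _)) ->; rewrite subrr.
rewrite split_f; apply: tensor_memD.
  have [B [c1 c2 c3]] := tensV_Tbar hF f'P f's f'F.
  apply: (@compS (@Ordinal 12 2 isT)); split=> //; split=> //= X Y Z XV YV ZV.
  rewrite -!/(ev _ _ _ _) !tensV_in ?(FV hF) // /f' d // kd //.
  by ring.
exact: compS k4.
Qed.

End VVVPart.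

(** The involution that maps f to f(FX, FY, Z) splits f in its two types. *)
Lemma VVV_part f : trilinear f ->
    {in V & V & V, forall X Y Z, f X Y Z = - f X Z Y} ->
    {in V & V & V, forall X Y Z, f X Y Z = - f X (F Y) (F Z)} ->
  tensV g xi f \in S.
Proof.
move=> fP fs fF; case: (fP) => fl fm fr; have VF := FV hF.
have FP a U U' : F (a *: U + U') = a *: F U + F U' by rewrite linearP.
have fN X Y Z : [/\ f (- X) Y Z = - f X Y Z & f X (- Y) Z = - f X Y Z].
  split.
    by apply: (@functionalN _ _ (fun X => f X Y Z)) => a U U'; rewrite fl.
  by apply: (@functionalN _ _ (fun Y => f X Y Z)) => a U U'; rewrite fm.
have fFC X Y Z : X \in V -> Y \in V -> Z \in V -> f X (F Y) Z = f X Y (F Z).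
  move=> XV YV ZV; rewrite fF // (FF hF YV).
  by have [_ ->] := fN X Y (F Z); rewrite opprK.
pose k c X Y Z := 2^-1 * (f X Y Z + c * f (F X) (F Y) Z).
have kP c : trilinear (k c).
  by split=> *; rewrite /k ?FP ?fl ?fm ?fr; ring.
have ks c : {in V & V & V, forall X Y Z, k c X Y Z = - k c X Z Y}.
  move=> X Y Z XV YV ZV; rewrite /k (fs _ _ _ XV YV ZV) (fFC _ _ _ (VF X) YV ZV).
  by rewrite (fs _ _ _ (VF X) YV (VF Z)); ring.
have kF c : {in V & V & V, forall X Y Z, k c X Y Z = - k c X (F Y) (F Z)}.
  move=> X Y Z XV YV ZV; rewrite /k (fF _ _ _ XV YV ZV).
  by rewrite (fF _ _ _ (VF X) (VF Y) ZV); ring.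
have kd c : c ^+ 2 = 1 -> {in V & V & V, forall X Y Z, k c (F X) (F Y) Z = c * k c X Y Z}.
  move=> c2 X Y Z XV YV ZV; rewrite /k (FF hF XV) (FF hF YV).
  have [-> _] := fN X (- Y) Z; have [_ ->] := fN X Y Z; rewrite opprK.
  transitivity (2^-1 * (c * f X Y Z + c ^+ 2 * f (F X) (F Y) Z)); last by ring.
  by rewrite c2 mul1r addrC.
have -> : tensV g xi f = tensV g xi (k (-1)) + tensV g xi (k 1).
  apply: evP => X Y Z; rewrite evD !tensVE // /k mul1r mulN1r; field.
  by rewrite ?pnatr_eq0.
have sq1 : (-1) ^+ 2 = 1 :> R by rewrite sqrrN expr1n.
have sq2 : 1 ^+ 2 = 1 :> R by rewrite expr1n.
apply: tensor_memD.
  apply: (tensV_antitype (kP _) (ks _) (kF _)) => X Y Z XV YV ZV.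
  by rewrite kd // mulN1r.
apply: (tensV_type (kP _) (ks _) (kF _)) => X Y Z XV YV ZV.
by rewrite kd // mul1r.
Qed.

Let two_n : 2 * n%:R != 0 :> R.
Proof. by rewrite mulf_neq0 ?pnatr_eq0 //; case: n n_gt1. Qed.

Lemma beta_tensVVxi q : bilinear_form q ->
  beta F E (tensVVxi g xi q) xi = \sum_(X <- D) q X X.
Proof.
move=> qP; have [_ _ eq] := tensVVxi_Tbar hF qP; rewrite betaE.
by apply: (eq_big_contact hF aE) => X XV; rewrite eq.
Qed.

Lemma beta_bar_tensVVxi q : bilinear_form q ->
  beta_bar F E (tensVVxi g xi q) xi = \sum_(X <- D) q X (F X).
Proof.
move=> qP; have [_ _ eq] := tensVVxi_Tbar hF qP; rewrite (beta_barE' hF aE).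
by apply: (eq_big_contact hF aE) => X XV; rewrite eq ?(FV hF).
Qed.

Lemma fundamental_form_tensor c (q := fun X Y => c * g X (F Y)) :
  [/\ bilinear_form q, \sum_(X <- D) q X (F X) = - (2 * n%:R) * c &
      Tbar_component g xi F n E (@Ordinal 12 6 isT) (tensVVxi g xi q)].
Proof.
have FP a U U' : F (a *: U + U') = a *: F U + F U' by rewrite linearP.
have qP : bilinear_form q by split=> *; rewrite /q ?FP ?gPl ?gPr; ring.
have sq : \sum_(X <- D) q X (F X) = - (2 * n%:R) * c.
  rewrite (eq_big_contact hF aE (f' := fun X => - c * g X X)); last first.
    by move=> X XV; rewrite /q (FF hF XV) gNr mulrN mulNr.
  by rewrite -mulr_sumr sum_contact_g; ring.
split=> //; have [B cc e] := tensVVxi_Tbar hF qP; split=> //; split=> //.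
move=> X Y XV YV; rewrite -!/(ev _ _ _ _) !e // beta_bar_tensVVxi // sq /q.
transitivity ((2 * n%:R)^-1 * (2 * n%:R) * (c * g X (F Y))); last by ring.
by rewrite mulVf // mul1r.
Qed.

Lemma metric_tensor c (q := fun X Y => c * g X Y) :
  [/\ bilinear_form q, \sum_(X <- D) q X X = 2 * n%:R * c &
      Tbar_component g xi F n E (@Ordinal 12 9 isT) (tensVVxi g xi q)].
Proof.
have qP : bilinear_form q by split=> *; rewrite /q ?gPl ?gPr; ring.
have sq : \sum_(X <- D) q X X = 2 * n%:R * c by rewrite -mulr_sumr sum_contact_g mulrC.
split=> //; have [B cc e] := tensVVxi_Tbar hF qP; split=> //; split=> //.
move=> X Y XV YV; rewrite -!/(ev _ _ _ _) !e // beta_tensVVxi // sq /q.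
transitivity ((2 * n%:R)^-1 * (2 * n%:R) * (c * g X Y)); last by ring.
by rewrite mulVf // mul1r.
Qed.

(** The exchange of X and Y and the substitution of FX, FY for X, Y generate a
    group of order four; k e d is the projection of b on the part with signs
    e and d. The parts with d = 1 contain a multiple of the metric or of the
    fundamental form, fixed by the trace. *)
Lemma VVxi_part b : bilinear_form b -> tensVVxi g xi b \in S.
Proof.
move=> bP; case: (bP) => bl br; have VF := FV hF.
have FP a U U' : F (a *: U + U') = a *: F U + F U' by rewrite linearP.
have bNl X Y : b (- X) Y = - b X Y.
  by apply: (@functionalN _ _ (fun X => b X Y)) => a U U'; rewrite bl.
have bNr X Y : b X (- Y) = - b X Y.
  by apply: (@functionalN _ _ (b X)) => a U U'; rewrite br.
pose k e d X Y := 4^-1 * (b X Y + e * b Y X + d * b (F X) (F Y) + e * d * b (F Y) (F X)).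
have kP e d : bilinear_form (k e d) by split=> *; rewrite /k !FP !bl !br; ring.
have ks e d : e ^+ 2 = 1 -> {in V &, forall X Y, k e d X Y = e * k e d Y X}.
  move=> e2 X Y XV YV; transitivity (4^-1 * (e * b Y X + e ^+ 2 * b X Y
      + e * d * b (F Y) (F X) + e ^+ 2 * (d * b (F X) (F Y)))); last by rewrite /k; ring.
  by rewrite e2 /k; ring.
have kd e d : d ^+ 2 = 1 -> {in V &, forall X Y, k e d (F X) (F Y) = d * k e d X Y}.
  move=> d2 X Y XV YV; rewrite /k (FF hF XV) (FF hF YV).
  rewrite !bNl !bNr !opprK.
  transitivity (4^-1 * (d * b X Y + d * e * b Y X + d ^+ 2 * b (F X) (F Y)
      + e * (d ^+ 2 * b (F Y) (F X)))); last by ring.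
  by rewrite d2; ring.
have sq1 : (-1) ^+ 2 = 1 :> R by rewrite sqrrN expr1n.
have sq2 : 1 ^+ 2 = 1 :> R by rewrite expr1n.
have part (q : T -> T -> R) := @tensVVxi_Tbar _ _ _ _ _ hF q.
pose c10 := (2 * n%:R)^-1 * \sum_(X <- D) k 1 1 X X.
pose q10 X Y : R := c10 * g X Y.
pose c7 := - (2 * n%:R)^-1 * \sum_(X <- D) k (-1) 1 X (F X).
pose q7 X Y : R := c7 * g X (F Y).
have [q10P s10 t10] := metric_tensor c10; have [q7P s7 t7] := fundamental_form_tensor c7.
pose q8 X Y := k 1 1 X Y - q10 X Y.
pose q5 X Y := k (-1) 1 X Y - q7 X Y.
have sub q q' : bilinear_form q -> bilinear_form q' -> bilinear_form (fun X Y => q X Y - q' X Y).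
  by move=> [ql qr] [ql' qr']; split=> *; rewrite ?ql ?ql' ?qr ?qr'; ring.
have q8P : bilinear_form q8 by apply: sub.
have q5P : bilinear_form q5 by apply: sub.
have sum10 : \sum_(X <- D) q10 X X = \sum_(X <- D) k 1 1 X X.
  by rewrite s10 /c10 mulrA mulfV // mul1r.
have sum7 : \sum_(X <- D) q7 X (F X) = \sum_(X <- D) k (-1) 1 X (F X).
  by rewrite s7 /c7 mulrA mulrNN mulfV // mul1r.
have q7s : {in V &, forall X Y, q7 X Y = - q7 Y X}.
  by move=> X Y XV YV; rewrite /q7 (gC g Y) (gFl hF); ring.
have q7d : {in V &, forall X Y, q7 (F X) (F Y) = q7 X Y}.
  by move=> X Y XV YV; rewrite /q7 (gFF hF).
have q10d : {in V &, forall X Y, q10 (F X) (F Y) = q10 X Y}.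
  by move=> X Y XV YV; rewrite /q10 (gFF hF).
have -> : tensVVxi g xi b = tensVVxi g xi q5 + tensVVxi g xi (k (-1) (-1)) + tensVVxi g xi q7
   + tensVVxi g xi q8 + tensVVxi g xi (k 1 (-1)) + tensVVxi g xi q10.
  apply: evP => X Y Z; rewrite 5!evD !tensVVxiE // /q5 /q8 /k.
  by field; rewrite ?pnatr_eq0.
have in_S (i : 'I_12) q : bilinear_form q ->
    (concentrated_VVxi g xi (tensVVxi g xi q) ->
     {in V &, forall X Y, ev (tensVVxi g xi q) X Y xi = q X Y} ->
     Tbar (tensVVxi g xi q) -> Tbar_component g xi F n E i (tensVVxi g xi q)) ->
  tensVVxi g xi q \in S.
  by move=> qP C; have [B cc e] := part q qP; apply: compS (C cc e B).
apply: tensor_memD; [apply: tensor_memD; [apply: tensor_memD; [apply: tensor_memD; [apply: tensor_memD|]|]|]|].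
- apply: (@in_S (@Ordinal 12 4 isT)) => // cc e B; split=> //; split=> //.
  + move=> X Y XV YV; rewrite -!/(ev _ _ _ _) !e // /q5.
    by rewrite (ks _ _ sq1 _ _ XV YV) q7s //; ring.
  + move=> X Y XV YV; rewrite -!/(ev _ _ _ _) !e ?VF // /q5.
    by rewrite (kd _ _ sq2 _ _ XV YV) q7d //; ring.
  + by rewrite beta_bar_tensVVxi // sumrB sum7 subrr.
- apply: (@in_S (@Ordinal 12 5 isT)) => // cc e B; split=> //; split=> //.
  + by move=> X Y XV YV; rewrite -!/(ev _ _ _ _) !e // (ks _ _ sq1 _ _ XV YV); ring.
  + move=> X Y XV YV; rewrite -!/(ev _ _ _ _) !e ?VF //.
    by rewrite (kd _ _ sq1 _ _ XV YV); ring.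
- exact: compS t7.
- apply: (@in_S (@Ordinal 12 7 isT)) => // cc e B; split=> //; split=> //.
  + move=> X Y XV YV; rewrite -!/(ev _ _ _ _) !e // /q8.
    by rewrite (ks _ _ sq2 _ _ XV YV) /q10 (gC g X); ring.
  + move=> X Y XV YV; rewrite -!/(ev _ _ _ _) !e ?VF // /q8.
    by rewrite (kd _ _ sq2 _ _ XV YV) q10d //; ring.
  + by rewrite beta_tensVVxi // sumrB sum10 subrr.
- apply: (@in_S (@Ordinal 12 8 isT)) => // cc e B; split=> //; split=> //.
  + by move=> X Y XV YV; rewrite -!/(ev _ _ _ _) !e // (ks _ _ sq2 _ _ XV YV); ring.
  + move=> X Y XV YV; rewrite -!/(ev _ _ _ _) !e ?VF //.
    by rewrite (kd _ _ sq1 _ _ XV YV); ring.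
- exact: compS t10.
Qed.

Lemma Tbar_sum h : Tbar h -> h \in S.
Proof.
move=> Bh.
have sk X Y Z := Tbar_skew Bh X Y Z.
have hb : bilinear_form (fun X Y => ev h X Y xi) by split=> *; rewrite (evPl, evPm).
have hb' : bilinear_form (ev h xi) by split=> *; rewrite (evPm, evPr).
have ht : scalar (fun X => ev h xi X xi) by move=> a X Y; rewrite evPm.
have hV : trilinear (ev h) := trilinear_ev h.
have hVs : {in V & V & V, forall X Y Z, ev h X Y Z = - ev h X Z Y} by move=> *; apply: sk.
have hVF : {in V & V & V, forall X Y Z, ev h X Y Z = - ev h X (F Y) (F Z)}.
  by move=> X Y Z XV YV ZV; rewrite (Tbar_FF Bh) // opprK.
have h's : {in V &, forall X Y, ev h xi X Y = - ev h xi Y X} by move=> *; apply: sk.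
have h'F : {in V &, forall X Y, ev h xi X Y = - ev h xi (F X) (F Y)}.
  by move=> X Y XV YV; rewrite (Tbar_FF Bh) // opprK.
have [B1 [z11 z12 z13]] := tensV_Tbar hF hV hVs hVF.
have [B2 [z21 z22 z23] e2] := tensVVxi_Tbar hF hb.
have [B3 [z31 z32 z33] e3] := tensxiVxi_Tbar hF ht.
have [B4 z41 z42 z43 e4] := tensxiVV_Tbar hF hb' h's h'F.
have BD := (Tbar_linear g xi F).2.
have Badd u v : Tbar u -> Tbar v -> Tbar (u + v).
  by move=> Bu Bv; have := BD 1 u v Bu Bv; rewrite scale1r.
have -> : h = tensV g xi (ev h) + tensVVxi g xi (fun X Y => ev h X Y xi)
    + tensxiVxi g xi (fun X => ev h xi X xi) + tensxiVV g xi (ev h xi).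
  apply: (Tbar_ext hF) => //; first exact: (Badd _ _ (Badd _ _ (Badd _ _ B1 B2) B3) B4).
  - move=> X Y Z XV YV ZV; rewrite 3!evD tensV_in //.
    by rewrite /ev z21 // z31 // z41 // !addr0.
  - move=> X Y XV YV; rewrite 3!evD e2 //.
    by rewrite /ev z11 // z32 // z42 // !addr0 add0r.
  - move=> X XV; rewrite 3!evD e3 //.
    by rewrite /ev z12 // z22 // z43 // !addr0 add0r.
  - move=> X Y XV YV; rewrite 3!evD e4 //.
    by rewrite /ev z13 // z23 // z33 // !add0r.
apply: tensor_memD; [apply: tensor_memD; [apply: tensor_memD|]|].
- exact: VVV_part.
- exact: VVxi_part.
- by apply: (@compS (@Ordinal 12 10 isT)); split.
- apply: (@compS (@Ordinal 12 11 isT)); split=> //; split=> // X Y XV YV.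
    by rewrite -!/(ev _ _ _ _) !e4.
  by rewrite -!/(ev _ _ _ _) !e4 ?(FV hF) // -h'F // (h's Y X) // opprK.
Qed.

End Decomposition.

(** * Counting index tuples *)

Section IndexCounting.

Variable n : nat.

Definition ltn_pair := {p : 'I_n * 'I_n | (p.1 < p.2)%N}.
Definition neq_pair := {p : 'I_n * 'I_n | p.1 != p.2}.
Definition leq_pair := {p : 'I_n * 'I_n | (p.1 <= p.2)%N}.
Definition ltn_triple := {t : 'I_n * 'I_n * 'I_n | (t.1.1 < t.1.2 < t.2)%N}.

Let swap (p : 'I_n * 'I_n) := (p.2, p.1).
Let swapK : involutive swap. Proof. by case. Qed.

Let lt := [pred p : 'I_n * 'I_n | (p.1 < p.2)%N].
Let gt := [pred p : 'I_n * 'I_n | (p.2 < p.1)%N].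
Let le := [pred p : 'I_n * 'I_n | (p.1 <= p.2)%N].

Let card_gt : #|gt| = #|lt|.
Proof.
rewrite -[RHS](card_image (inv_inj swapK)).
apply: eq_card => p; apply/idP/imageP => [pp|[q qq ->] //].
by exists (swap p); rewrite ?swapK.
Qed.

Let card_ltE : #|{: ltn_pair}| = #|lt|. Proof. exact: card_sig. Qed.
Let card_leE : #|{: leq_pair}| = #|le|. Proof. exact: card_sig. Qed.

Lemma card_neq_pair : #|{: neq_pair}| = (n * n - n)%N.
Proof.
rewrite card_sig.
have := cardC [pred p : 'I_n * 'I_n | p.1 != p.2].
have -> : #|[predC [pred p : 'I_n * 'I_n | p.1 != p.2]]| = n.
  rewrite -[RHS]card_ord -[RHS](@card_image _ _ (fun i => (i, i))) => [|i j [] //].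
  apply: eq_card => -[i j]; rewrite !inE /= negbK; apply/eqP/imageP => [->|[k _ [-> ->]] //].
  by exists j.
by rewrite card_prod card_ord => <-; rewrite addnK.
Qed.

Lemma card_ltn_pair : (#|{: ltn_pair}| * 2 = n * n - n)%N.
Proof.
rewrite -card_neq_pair card_ltE muln2 -addnn -{1}card_gt card_sig.
rewrite -cardUI addnC -[RHS]add0n; congr (_ + _)%N.
  by apply: eq_card0 => p; rewrite !inE; case: ltngtP.
by apply: eq_card => p; rewrite !inE -val_eqE /=; case: ltngtP.
Qed.

Lemma card_leq_pair : (#|{: leq_pair}| * 2 = n * n + n)%N.
Proof.
have e : (#|le| + #|gt| = n * n)%N.
  rewrite -cardUI.
  have -> : #|[predI le & gt]| = 0%N.
    by apply: eq_card0 => p; rewrite !inE; case: ltngtP.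
  rewrite addn0; transitivity #|{: 'I_n * 'I_n}|; last by rewrite card_prod card_ord.
  by apply: eq_card => p; rewrite !inE; case: ltngtP.
have := card_ltn_pair; have : (n <= n * n)%N by rewrite -{1}[n]mul1n leq_mul2r; case: (n).
by move: e; rewrite card_gt card_ltE card_leE; lia.
Qed.

Lemma card_ltn_triple : #|{: ltn_triple}| = 'C(n, 3).
Proof.
rewrite card_sig -card_ltn_sorted_tuples cardsE.
pose f (t : 'I_n * 'I_n * 'I_n) : 3.-tuple 'I_n := [tuple t.1.1; t.1.2; t.2].
rewrite -(@card_image _ _ f) => [|[[i j] k] [[i' j'] k'] [-> -> ->] //].
apply: eq_card => t; apply/imageP/idP => [[[[i j] k]]|].
  by rewrite !inE /= => ijk ->; rewrite unfold_in /= andbT.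
case/tupleP: t => i t; case/tupleP: t => j t; case/tupleP: t => k t; rewrite tuple0.
rewrite unfold_in /= andbT => ijk; exists (i, j, k); first by rewrite inE.
exact: val_inj.
Qed.

End IndexCounting.

(** * Coordinates and inner products of tensors *)

Section TensorCoordinates.

Variables (R : realType) (T : vectType R).
Variables (J : finType) (phi : J -> tensor_space T -> R).
Hypothesis phi_linear : forall j a (h h' : tensor_space T),
  phi j (a *: h + h') = a * phi j h + phi j h'.
Implicit Types (h : tensor_space T) (W : {vspace (tensor_space T)}).

Let phi_scalar j : scalar (phi j).
Proof. by move=> a h h'; exact: phi_linear. Qed.

Lemma tensor_dim_le W :
  (forall h, h \in W -> (forall j, phi j h = 0) -> h = 0) -> (\dim W <= #|J|)%N.
Proof. exact: dim_le_coords phi_scalar W. Qed.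

Lemma tensor_dim_ge W' W :
  (forall h, h \in W' -> (forall j, phi j h = 0) -> h \in W) ->
  (\dim W' <= \dim W + #|J|)%N.
Proof. exact: (dim_ge_coords phi_scalar (U' := W') (U := W)). Qed.

Lemma tensor_dim_surj W :
  (forall c : J -> R, exists2 h, h \in W & forall j, phi j h = c j) ->
  (#|J| <= \dim W)%N.
Proof. exact: dim_ge_surj phi_scalar W. Qed.

End TensorCoordinates.

Section InnerProduct.

Variables (R : realType) (T : vectType R).
Variables (g : {dot T for idfun}) (e : seq T).
Hypothesis oe : orthonormal_basis g e.
Implicit Types (X Y Z : T) (h : tensor_space T) (W : {vspace (tensor_space T)}).
Local Notation dot := (tensor_dot e).

Lemma tensor_dot_linear h a h1 h2 : dot h (a *: h1 + h2) = a * dot h h1 + dot h h2.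
Proof.
rewrite /tensor_dot mulr_sumr -big_split; apply: eq_bigr => X _ /=.
rewrite mulr_sumr -big_split; apply: eq_bigr => Y _ /=.
rewrite mulr_sumr -big_split; apply: eq_bigr => Z _ /=.
by rewrite app_linear; ring.
Qed.

Lemma tensor_dotDr h h1 h2 : dot h (h1 + h2) = dot h h1 + dot h h2.
Proof. by have := tensor_dot_linear h 1 h1 h2; rewrite scale1r mul1r. Qed.

Lemma tensor_dot0r h : dot h 0 = 0.
Proof. by have := tensor_dotDr h 0 0; rewrite addr0; lra. Qed.

Lemma tensor_dotZr h a h' : dot h (a *: h') = a * dot h h'.
Proof. by have := tensor_dot_linear h a h' 0; rewrite addr0 tensor_dot0r addr0. Qed.

Lemma basis_tensor_eq0 h : {in e & e & e, forall X Y Z, ev h X Y Z = 0} -> h = 0.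
Proof.
move=> h0; apply: evP => X Y Z; rewrite ev0.
rewrite (scalar_expand X oe (ev_scalar1 h Y Z)) big1_seq // => X' /andP[_ Xe].
rewrite (scalar_expand Y oe (ev_scalar2 h X' Z)) big1_seq ?mulr0 // => Y' /andP[_ Ye].
rewrite (scalar_expand Z oe (ev_scalar3 h X' Y')) big1_seq ?mulr0 // => Z' /andP[_ Ze].
by rewrite h0 // mulr0.
Qed.

Lemma tensor_dot_eq0 h : dot h h = 0 -> h = 0.
Proof.
have sq X Y Z : 0 <= ev h X Y Z * ev h X Y Z by rewrite -expr2 sqr_ge0.
move/eqP; rewrite psumr_eq0 => [/allP h0|X _]; last first.
  by apply: sumr_ge0 => Y _; apply: sumr_ge0 => Z _; apply: sq.
apply: basis_tensor_eq0 => X Y Z Xe Ye Ze.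
have := h0 X Xe; rewrite /= psumr_eq0 => [/allP/(_ Y Ye)|Y' _]; last first.
  by apply: sumr_ge0 => Z' _; apply: sq.
rewrite /= psumr_eq0 => [/allP/(_ Z Ze)|Z' _]; last exact: sq.
by rewrite /= mulf_eq0 orbb => /eqP.
Qed.

Section Family.

Variables (m : nat) (W : 'I_m -> {vspace (tensor_space T)}).
Hypothesis ortho : forall i j, i != j -> forall h h', h \in W i -> h' \in W j ->
  dot h h' = 0.

Lemma orthogonal_capv i j : i != j -> (W i :&: W j = 0)%VS.
Proof.
move=> ij; apply/eqP; rewrite -subv0; apply/subvP => h.
rewrite memv_cap => /andP[hi hj]; rewrite memv0; apply/eqP/tensor_dot_eq0.
exact: ortho ij _ _ hi hj.
Qed.

Lemma orthogonal_directv : directv (\sum_i W i).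
Proof.
apply/directv_sum_independent => us usW sum0 i _; apply: tensor_dot_eq0.
transitivity (dot (us i) (\sum_j us j)); last by rewrite sum0 tensor_dot0r.
rewrite (big_morph (dot (us i)) (tensor_dotDr _) (tensor_dot0r _)) (bigD1 i) //=.
rewrite big1 ?addr0 // => j ji.
by apply: ortho (usW i isT) (usW j isT); rewrite eq_sym.
Qed.

End Family.

End InnerProduct.

(** * Bounds for dimensions *)

Ltac ord_cases_keep i lti k :=
  lazymatch k with
  | O => discriminate lti
  | S ?k' => destruct i as [|i]; [| ord_cases_keep i lti k']
  end.

Section Dimensions.

Variables (R : realType) (T : vectType R).
Variables (g : {dot T for idfun}) (xi : T) (F : 'End(T)).
Hypothesis hF : almost_contact_metric g xi F.
Local Notation V := (contact_space g xi).
Local Notation Tbar := (Tbar g xi F).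
Implicit Types (X Y Z U : T) (h : tensor_space T).
Implicit Types (W : {vspace (tensor_space T)}).

Variables (n : nat) (E : seq T).
Hypotheses (n_gt1 : (1 < n)%N) (dimT : \dim {:T} = n.*2.+1).
Hypothesis aE : adapted_basis g xi F E.
Local Notation comp i := (Tbar_component g xi F n E i).
Local Notation "# k" := (@Ordinal 12 k isT) (at level 8, format "# k").

Let e (i : 'I_n) : T := E`_i.

Let size_E : size E = n := adapted_size dimT aE.

Let eV i : e i \in V.
Proof. by apply: (adapted_contact hF aE); rewrite mem_nth // size_E. Qed.

Let FeV i : F (e i) \in V.
Proof. exact: FV hF _. Qed.

Lemma scalar_frame_eq0 (f : T -> R) : scalar f ->
    (forall i, f (e i) = 0 /\ f (F (e i)) = 0) ->
  {in V, forall X, f X = 0}.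
Proof.
move=> fP f0; apply: (contact_scalar_eq0 aE fP) => _ /(nthP 0)[i iE <-].
by rewrite size_E in iE; exact: f0 (Ordinal iE).
Qed.

Local Notation Fk := (Fk F).

Let FkV c i : Fk c (e i) \in V.
Proof. exact: Fk_V. Qed.

(** The type of h moves every F to the last argument. *)
Lemma VVV_eq0 delta h : Tbar h -> concentrated_VVV g xi h -> F_type g xi F delta h ->
    (forall c i j k, ev h (e i) (e j) (Fk c (e k)) = 0) ->
  h = 0.
Proof.
move=> Bh [z1 z2 z3] dh h0.
have h1 i j : {in V, forall Z, ev h (e i) (e j) Z = 0}.
  apply: (scalar_frame_eq0 (ev_scalar3 _ _ _)) => k.
  by split; [exact: (h0 false) | exact: (h0 true)].
have h2 i Z : Z \in V -> {in V, forall Y, ev h (e i) Y Z = 0}.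
  move=> ZV; apply: (scalar_frame_eq0 (ev_scalar2 _ _ _)) => j.
  by split; rewrite ?(Tbar_FC hF Bh) ?h1 // (FV hF).
apply: (Tbar_ext hF Bh (Tbar_linear g xi F).1) => [X Y Z XV YV ZV|X Y XV YV|X XV|X Y XV YV];
  rewrite ev0 /ev; [|exact: z1|exact: z2|exact: z3].
move: X XV; apply: (scalar_frame_eq0 (ev_scalar1 h Y Z)) => i; split; first exact: h2.
by rewrite (F_type_FC hF dh) // h2 ?mulr0 // (FV hF).
Qed.

Lemma bilinear_eq0 delta (b : T -> T -> R) : bilinear_form b ->
    {in V &, forall X Y, b (F X) (F Y) = delta * b X Y} ->
    (forall c i j, b (e i) (Fk c (e j)) = 0) ->
  {in V &, forall X Y, b X Y = 0}.
Proof.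
move=> [bl br] bd b0.
have b1 i : {in V, forall Y, b (e i) Y = 0}.
  apply: scalar_frame_eq0 => [a X Y|j]; first by rewrite br.
  by split; [exact: (b0 false) | exact: (b0 true)].
move=> X Y XV YV; move: X XV; apply: scalar_frame_eq0 => [a X X'|i]; first by rewrite bl.
split; first exact: b1.
have bN : b (F (e i)) (F (F Y)) = - b (F (e i)) Y.
  rewrite (FF hF YV); apply: (@functionalN _ _ (b (F (e i)))) => a U U'; exact: br.
by apply: oppr_inj; rewrite oppr0 -bN bd ?(FV hF) // b1 ?mulr0 // (FV hF).
Qed.

(** An alternating tensor is determined by its coordinates with increasing
    indices, real and imaginary. *)
Lemma dim_T1 W : (forall h, h \in W -> comp #0 h) -> (\dim W <= 2 * 'C(n, 3))%N.
Proof.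
move=> WP; pose phi (q : bool * ltn_triple n) h :=
  let t := val q.2 in ev h (e t.1.1) (e t.1.2) (Fk q.1 (e t.2)).
have -> : (2 * 'C(n, 3) = #|{: bool * ltn_triple n}|)%N.
  by rewrite card_prod card_bool card_ltn_triple.
apply: (tensor_dim_le (phi := phi)) => [q a u v|h /WP[Bh t1] h0]; first exact: ev_linear.
case: (t1) => a z1 z2 z3.
apply: (VVV_eq0 Bh (And3 z1 z2 z3) (T1_F_type hF Bh t1)) => c i j k.
pose A i j k := ev h (e i) (e j) (Fk c (e k)).
have A12 i' j' k' : A i' j' k' = - A j' i' k' by exact: (a _ _ _ (eV _) (eV _) (FkV _ _)).
have A23 i' j' k' : A i' j' k' = - A i' k' j'.
  rewrite /A; case: (c) => /=; first by rewrite (Tbar_skew Bh) (Tbar_FC hF Bh) //; exact: eV.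
  exact: (Tbar_skew Bh).
have A0 (i' j' k' : 'I_n) : (i' < j' < k')%N -> A i' j' k' = 0.
  by move=> ijk; exact: (h0 (c, exist _ (i', j', k') ijk)).
have Alt (i' j' k' : 'I_n) : (i' < j')%N -> A i' j' k' = 0.
  move=> ij; have [jk|kj|/val_inj <-] := ltngtP j' k'; last by have := A23 i' j' j'; lra.
    by apply: A0; rewrite ij.
  rewrite A23; have [ik|ki|/val_inj <-] := ltngtP i' k'; last by have := A12 i' i' j'; lra.
    by rewrite A0 ?oppr0 // ik.
  by rewrite A12 opprK A0 // ki.
have [ij|ji|/val_inj <-] := ltngtP i j; first exact: Alt.
  by rewrite -/(A i j k) A12 Alt ?oppr0.
by have := A12 i i k; rewrite /A; lra.
Qed.

(** With three distinct indices, skew symmetry and the cyclic identity leave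
    two of the six coordinates free; with a repeated one, h(e_i, e_i, e_j) is
    the only one. *)
Lemma dim_T2 W : (forall h, h \in W -> comp #1 h) ->
  (\dim W <= 4 * 'C(n, 3) + 2 * (n * n - n))%N.
Proof.
move=> WP; pose phi (q : bool * (bool * ltn_triple n + neq_pair n)) h :=
  match q.2 with
  | inl (r, t) => let: (i, j, k) := val t in
      if r then ev h (e j) (e k) (Fk q.1 (e i)) else ev h (e i) (e j) (Fk q.1 (e k))
  | inr p => ev h (e (val p).1) (e (val p).1) (Fk q.1 (e (val p).2))
  end.
have -> : (4 * 'C(n, 3) + 2 * (n * n - n) =
           #|{: bool * (bool * ltn_triple n + neq_pair n)}|)%N.
  by rewrite !(card_prod, card_sum) card_bool card_ltn_triple card_neq_pair; lia.
apply: (tensor_dim_le (phi := phi)) => [[c [[r [[[i j] k] ?]]|p]] a u v|h /WP[Bh t2] h0].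
- by rewrite /phi /=; case: r; exact: ev_linear.
- exact: ev_linear.
case: (t2) => cy z1 z2 z3; have d := T2_F_type hF Bh t2.
apply: (VVV_eq0 Bh (And3 z1 z2 z3) d) => c i j k.
pose A i j k := ev h (e i) (e j) (Fk c (e k)).
have A23 i' j' k' : A i' j' k' = - A i' k' j' by exact: (Tbar_skew_Fk hF Bh).
have Acyc i' j' k' : A i' j' k' + A j' k' i' + A k' i' j' = 0.
  rewrite /A; case: (c) => /=; last exact: cy.
  rewrite -[X in _ + X + _](Tbar_FC hF Bh) // -[X in _ + X](Tbar_FC hF Bh) //.
  have := cy (e i') (e j') (F (e k')) (eV _) (eV _) (FeV _); rewrite -!/(ev _ _ _ _).
  by rewrite (F_type_FC hF d) // opprK mul1r.
have Aij (i' j' : 'I_n) : A i' i' j' = 0.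
  have [<-|ij] := eqVneq i' j'; first by have := A23 i' i' i'; lra.
  exact: (h0 (c, inr (exist _ (i', j') ij))).
have A0 (i' j' k' : 'I_n) : (i' < j' < k')%N ->
   [/\ A i' j' k' = 0, A j' k' i' = 0, A k' i' j' = 0, A i' k' j' = 0 &
       A j' i' k' = 0 /\ A k' j' i' = 0].
  move=> ijk; have := h0 (c, inl (false, exist _ (i', j', k') ijk)).
  have := h0 (c, inl (true, exist _ (i', j', k') ijk)); rewrite /phi /= -!/(A _ _ _).
  have := Acyc i' j' k'; have := A23 i' j' k'; have := A23 j' k' i'; have := A23 k' i' j'.
  by move=> *; split; [..|split]; lra.
rewrite -/(A i j k).
have [<-|/eqP ij] := eqVneq i j; first exact: Aij.
have [<-|/eqP jk] := eqVneq j k; first by have := A23 i j j; lra.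
have [<-|/eqP ik] := eqVneq i k; first by rewrite A23 Aij oppr0.
have lt3 : [\/ (i < j < k)%N, (i < k < j)%N, (j < i < k)%N | [\/ (j < k < i)%N, (k < i < j)%N | (k < j < i)%N]].
  have [/eqP ij' /eqP jk' /eqP ik'] : [/\ i != j :> nat, j != k :> nat & i != k :> nat].
    by split; apply/eqP => /val_inj.
  case: (ltngtP i j) => // lij; case: (ltngtP j k) => // ljk; case: (ltngtP i k) => // lik;
    try lia; by [constructor 1 | constructor 2 | constructor 3 | constructor 4; constructor 1
      | constructor 4; constructor 2 | constructor 4; constructor 3].
by case: lt3 => [/A0[]|/A0[]|/A0[]|[/A0[]|/A0[]|/A0[]]] // _ _ _ _ [].
Qed.

Lemma dim_F_type1 W :
    (forall h, h \in W -> [/\ Tbar h, concentrated_VVV g xi h & F_type g xi F 1 h]) ->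
  (\dim W <= n * (n * n - n))%N.
Proof.
move=> WP; pose phi (q : bool * ('I_n * ltn_pair n)) h :=
  ev h (e q.2.1) (e (val q.2.2).1) (Fk q.1 (e (val q.2.2).2)).
have -> : (n * (n * n - n) = #|{: bool * ('I_n * ltn_pair n)}|)%N.
  by rewrite !card_prod card_bool card_ord mulnCA [(2 * _)%N]mulnC card_ltn_pair.
apply: (tensor_dim_le (phi := phi)) => [q a u v|h /WP[Bh ch d] h0]; first exact: ev_linear.
apply: (VVV_eq0 Bh ch d) => c i j k.
have [jk|kj|/val_inj <-] := ltngtP j k.
- exact: (h0 (c, (i, exist _ (j, k) jk))).
- rewrite (Tbar_skew_Fk hF Bh) //; apply/eqP; rewrite oppr_eq0; apply/eqP.
  exact: (h0 (c, (i, exist _ (k, j) kj))).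
- by apply: opp_eq0; exact: (Tbar_skew_Fk hF Bh).
Qed.

Section BilinearPart.

Variables (b : tensor_space T -> T -> T -> R) (W : {vspace (tensor_space T)}).
Hypothesis b_linear : forall a h h' X Y, b (a *: h + h') X Y = a * b h X Y + b h' X Y.
Hypothesis bP : forall h, bilinear_form (b h).
Hypothesis b_inj : forall h, h \in W -> {in V &, forall X Y, b h X Y = 0} -> h = 0.

Variables eps delta : R.
Hypothesis b_sym : forall h, h \in W -> {in V &, forall X Y, b h X Y = eps * b h Y X}.
Hypothesis b_F : forall h, h \in W -> {in V &, forall X Y, b h (F X) (F Y) = delta * b h X Y}.

Let A h (c : bool) (i j : 'I_n) := b h (e i) (Fk c (e j)).

Let A_eq0 h : h \in W -> (forall c i j, A h c i j = 0) -> h = 0.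
Proof. by move=> hW h0; apply: (b_inj hW); apply: (bilinear_eq0 (bP h) (b_F hW)). Qed.

Let A_sym h c i j : h \in W -> A h c j i = (if c then - (eps * delta) else eps) * A h c i j.
Proof.
move=> hW; case: c; last exact: (b_sym hW).
rewrite /A /= (b_sym hW) //; have [_ br] := bP h.
have bN X : b h (F (e i)) (- X) = - b h (F (e i)) X.
  by apply: (@functionalN _ _ (b h (F (e i)))) => a U U'; rewrite br.
have := b_F hW (eV i) (FeV j); rewrite (FF hF (eV j)) bN => /eqP.
by rewrite eqr_oppLR => /eqP ->; ring.
Qed.

Let A_lin c i j a h h' : A (a *: h + h') c i j = a * A h c i j + A h' c i j.
Proof. exact: b_linear. Qed.

Let A_diag h c i : h \in W -> (if c then - (eps * delta) else eps) = -1 ->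
  A h c i i = 0.
Proof. by move=> hW s; apply: opp_eq0; rewrite {1}A_sym // s mulN1r. Qed.

Lemma dim_skew_anti : eps = -1 -> delta = -1 -> (\dim W <= n * n - n)%N.
Proof.
move=> eps1 delta1; rewrite -(card_neq_pair n).
(* All coordinates are skew: i < j indexes the real ones, j < i the imaginary. *)
pose phi (p : neq_pair n) h := A h ((val p).2 < (val p).1)%N (val p).1 (val p).2.
have sgn c : (if c then - (eps * delta) else eps) = -1.
  by case: c; rewrite ?eps1 ?delta1 //; ring.
apply: (tensor_dim_le (phi := phi)) => [[[i j] ij] a u v|h hW h0]; first exact: A_lin.
apply: A_eq0 => // c i j.
wlog ij : i j / (if c then j < i else i < j)%N => [wl|].
  have [lt|gt|/val_inj <-] := ltngtP i j; last exact: A_diag.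
    by case: c wl => wl; [rewrite A_sym // wl ?mulr0 | exact: wl].
  by case: c wl => wl; [exact: wl | rewrite A_sym // wl ?mulr0].
have nij : i != j by apply: contraTneq ij => ->; case: (c); rewrite ltnn.
have := h0 (exist _ (i, j) nij); rewrite /phi /=; congr (A h _ i j = 0).
by case: (c) ij => [->|/ltnW]; rewrite // leqNgt => /negPf.
Qed.

Lemma dim_skew_type1 : eps = -1 -> delta = 1 -> (\dim W <= n * n)%N.
Proof.
move=> eps1 delta1.
have -> : (n * n = #|{: 'I_n * 'I_n}|)%N by rewrite card_prod card_ord.
(* The real coordinates are skew, the imaginary ones symmetric. *)
pose phi (p : 'I_n * 'I_n) h := A h (p.2 <= p.1)%N p.1 p.2.
apply: (tensor_dim_le (phi := phi)) => [[i j] a u v|h hW h0]; first exact: A_lin.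
apply: A_eq0 => // c i j.
wlog ij : i j / (if c then j <= i else i < j)%N => [wl|].
  have [lt|gt|/val_inj <-] := ltngtP i j.
  - by case: c wl => wl; [rewrite A_sym // wl ?mulr0 // ltnW | exact: wl].
  - by case: c wl => wl; [apply: wl; rewrite ltnW | rewrite A_sym // wl ?mulr0].
  - by case: c wl => wl; [apply: wl | apply: A_diag].
have := h0 (i, j); rewrite /phi /=; congr (A h _ i j = 0).
by case: (c) ij => [->|]; rewrite // ltnNge => /negPf.
Qed.

Lemma dim_sym_type1 : eps = 1 -> delta = 1 -> (\dim W <= n * n)%N.
Proof.
move=> eps1 delta1.
have -> : (n * n = #|{: 'I_n * 'I_n}|)%N by rewrite card_prod card_ord.
(* The real coordinates are symmetric, the imaginary ones skew. *)
pose phi (p : 'I_n * 'I_n) h := A h (p.1 < p.2)%N p.1 p.2.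
apply: (tensor_dim_le (phi := phi)) => [[i j] a u v|h hW h0]; first exact: A_lin.
apply: A_eq0 => // c i j.
wlog ij : i j / (if c then i < j else j <= i)%N => [wl|].
  have [lt|gt|/val_inj <-] := ltngtP i j.
  - by case: c wl => wl; [exact: wl | rewrite A_sym // wl ?mulr0 // ltnW].
  - by case: c wl => wl; [rewrite A_sym // wl ?mulr0 | apply: wl; rewrite ltnW].
  - case: c wl => wl; [apply: A_diag => //|exact: wl].
    by rewrite eps1 delta1 mulr1.
have := h0 (i, j); rewrite /phi /=; congr (A h _ i j = 0).
by case: (c) ij => [->|]; rewrite // leqNgt => /negPf.
Qed.

Lemma dim_sym_anti : eps = 1 -> delta = -1 -> (\dim W <= n * n + n)%N.
Proof.
move=> eps1 delta1.
have -> : (n * n + n = #|{: 'I_n * 'I_n + 'I_n}|)%N by rewrite card_sum card_prod card_ord.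
(* All coordinates are symmetric; the second summand indexes the diagonal of
   the imaginary ones. *)
pose phi (q : 'I_n * 'I_n + 'I_n) h :=
  match q with inl p => A h (p.1 < p.2)%N p.1 p.2 | inr i => A h true i i end.
apply: (tensor_dim_le (phi := phi)) => [[[i j]|i] a u v|h hW h0]; [exact: A_lin..|].
apply: A_eq0 => // c i j.
wlog ij : i j / (if c then i < j else j <= i)%N => [wl|].
  have [lt|gt|/val_inj <-] := ltngtP i j.
  - by case: c wl => wl; [exact: wl | rewrite A_sym // wl ?mulr0 // ltnW].
  - by case: c wl => wl; [rewrite A_sym // wl ?mulr0 | apply: wl; rewrite ltnW].
  - by case: c wl => wl; [exact: (h0 (inr i)) | exact: wl].
have := h0 (inl (i, j)); rewrite /phi /=; congr (A h _ i j = 0).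
by case: (c) ij => [->|]; rewrite // leqNgt => /negPf.
Qed.

End BilinearPart.

Local Notation N := n.*2.+1.

Lemma dim_tensor3 : \dim {: tensor_space T} = (N * (N * N))%N.
Proof.
rewrite -dimT !dimvf.
transitivity (dim T * (dim T * (dim T * 1)))%N; first reflexivity.
by rewrite muln1.
Qed.

(** The equations phi h = 0 cut Tbar out of the space of all tensors, so that
    their number bounds its codimension. *)
Lemma dim_Tbar (TT : {vspace (tensor_space T)}) : (forall h, Tbar h -> h \in TT) ->
  ((2 * n + 1) * (n * n + n) <= \dim TT)%N.
Proof.
move=> TTP; pose X_ (i : 'I_N) := (adapted_ext xi F E)`_i.
have oe := adapted_orthonormal aE.
have size_ext : size (adapted_ext xi F E) = N by rewrite size_adapted_ext size_E.
pose phi (q : 'I_N * (leq_pair N + 'I_n * 'I_n)) h :=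
  let X := X_ q.1 in
  match q.2 with
  | inl p => ev h X (X_ (val p).1) (X_ (val p).2) + ev h X (X_ (val p).2) (X_ (val p).1)
  | inr (i, j) =>
     if (i < j)%N then ev h X (e i) (e j) + ev h X (F (e i)) (F (e j))
     else if (j < i)%N then ev h X (e i) (F (e j)) - ev h X (F (e i)) (e j)
     else ev h X (e i) (F (e i))
  end.
have phi_lin q a u v : phi q (a *: u + v) = a * phi q u + phi q v.
  case: q => x [p|[i j]]; rewrite /phi /=; first by rewrite !ev_linear; ring.
  by case: ltngtP => _; rewrite !ev_linear; ring.
suff sub h : (forall q, phi q h = 0) -> h \in TT.
  have := @tensor_dim_ge _ _ _ phi phi_lin fullv TT (fun h _ => sub h).
  rewrite dim_tensor3 !(card_prod, card_sum, card_ord).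
  have := card_leq_pair N; set l := #|_|; set d := \dim _; rewrite -addnn => l2 le1.
  have : (2 * ((n + n).+1 * ((n + n).+1 * (n + n).+1)) <=
       2 * d + (n + n).+1 * (l * 2 + 2 * (n * n)))%N by nia.
  by rewrite l2; nia.
move=> h0; apply: TTP.
have sk X Y Z : ev h X Y Z = - ev h X Z Y.
  apply/eqP; rewrite -addr_eq0; apply/eqP.
  pose q X Y Z := ev h X Y Z + ev h X Z Y.
  have qP : trilinear q by split=> *; rewrite /q !(evPl, evPm, evPr); ring.
  rewrite -/(q X Y Z) -(tensE _ _ _ qP); suff -> : tens q = 0 by rewrite ev0.
  apply: (basis_tensor_eq0 oe) => {}X {}Y {}Z.
  move=> /(nthP 0)[x + <-] /(nthP 0)[y + <-] /(nthP 0)[z + <-]; rewrite size_ext => hx hy hz.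
  rewrite tensE // /q; have [yz|/ltnW yz] := leqP y z.
    exact: (h0 (Ordinal hx, inl (exist _ (Ordinal hy, Ordinal hz) yz))).
  rewrite addrC; exact: (h0 (Ordinal hx, inl (exist _ (Ordinal hz, Ordinal hy) yz))).
split=> [X Y Z|X Y Z YV ZV]; first exact: sk.
pose r X Y Z := ev h X Y Z + ev h X (F Y) (F Z).
have FP a U U' : F (a *: U + U') = a *: F U + F U' by rewrite linearP.
suff r0 : r X Y Z = 0 by apply/eqP; rewrite -addr_eq0; apply/eqP.
have rl Y' Z' : scalar (fun X => r X Y' Z') by move=> a U U'; rewrite /r !evPl; ring.
have rm X' Z' : scalar (fun Y => r X' Y Z') by move=> a U U'; rewrite /r FP !evPm; ring.
have rr X' Y' : scalar (r X' Y') by move=> a U U'; rewrite /r FP !evPr; ring.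
rewrite (scalar_expand X oe (rl Y Z)) big1_seq // => _ /andP[_ /(nthP 0)[m + <-]].
rewrite size_ext => hm; rewrite -[_`_m]/(X_ (Ordinal hm)); move: (Ordinal hm) => x.
suff -> : r (X_ x) Y Z = 0 by rewrite mulr0.
have c1 i j : ev h (X_ x) (e i) (e j) + ev h (X_ x) (F (e i)) (F (e j)) = 0.
  have [ij|ji|/val_inj <-] := ltngtP i j.
  - by have := h0 (x, inr (i, j)); rewrite /phi /= ij.
  - have := h0 (x, inr (j, i)); rewrite /phi /= ji.
    by have := sk (X_ x) (e i) (e j); have := sk (X_ x) (F (e i)) (F (e j)); lra.
  - by have := sk (X_ x) (e i) (e i); have := sk (X_ x) (F (e i)) (F (e i)); lra.
have c2 i j : ev h (X_ x) (e i) (F (e j)) - ev h (X_ x) (F (e i)) (e j) = 0.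
  have [ij|ji|/val_inj <-] := ltngtP i j.
  - have := h0 (x, inr (j, i)); rewrite /phi /= ij ltnNge (ltnW ij) /=.
    by have := sk (X_ x) (e i) (F (e j)); have := sk (X_ x) (F (e i)) (e j); lra.
  - by have := h0 (x, inr (i, j)); rewrite /phi /= ji ltnNge (ltnW ji).
  - have := h0 (x, inr (i, i)); rewrite /phi /= ltnn.
    by have := sk (X_ x) (F (e i)) (e i); lra.
move: Y YV; apply: (scalar_frame_eq0 (rm _ _)) => i; split;
  move: Z ZV; apply: (scalar_frame_eq0 (rr _ _)) => j; rewrite /r !(FF hF (eV _)) ?evN.
- by split; [exact: c1 | exact: c2].
- by split; [have := c2 i j | have := c1 i j]; lra.
Qed.

(** * The dimensions of the components *)

Section Components.

Variables (W : 'I_12 -> {vspace (tensor_space T)}).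
Hypothesis hW : forall i h, h \in W i <-> comp i h.

Local Notation d k := (\dim (W #k)).

Lemma component_inter i j : i != j -> (W i :&: W j = 0)%VS.
Proof.
move=> ij; apply: (orthogonal_capv (adapted_orthonormal aE)) ij => {}i {}j ij h h' /hW hi /hW hj.
by have := component_dot hF aE ij hi hj.
Qed.

Lemma dim_component_add i j (P : tensor_space T -> Prop) m : i != j ->
    (forall h, h \in W i -> P h) -> (forall h, h \in W j -> P h) ->
    (forall h h', P h -> P h' -> P (h + h')) ->
    (forall U : {vspace (tensor_space T)}, (forall h, h \in U -> P h) -> (\dim U <= m)%N) ->
  (\dim (W i) + \dim (W j) <= m)%N.
Proof.
move=> ij Pi Pj PD Pm; rewrite -dimv_disjoint_sum ?component_inter //.
by apply: Pm => h /memv_addP[u ui [v vj ->]]; apply: PD; [exact: Pi | exact: Pj].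
Qed.

Lemma in_Tbar i h : h \in W i -> Tbar h.
Proof. by case/hW. Qed.

Let TbarD h h' : Tbar h -> Tbar h' -> Tbar (h + h').
Proof. by move=> Bh Bh'; rewrite -[h]scale1r; apply: (Tbar_linear g xi F).2. Qed.

Definition VVxi_class (eps delta : R) h : Prop :=
  [/\ Tbar h, concentrated_VVxi g xi h, xi_sym g xi eps h & xi_F_type g xi F delta h].

Lemma VVxi_classD eps delta h h' :
  VVxi_class eps delta h -> VVxi_class eps delta h' -> VVxi_class eps delta (h + h').
Proof.
move=> [B [c1 c2 c3] s t] [B' [c1' c2' c3'] s' t']; split; first exact: TbarD.
- split=> [X Y Z XV YV ZV|X XV|X Y XV YV]; rewrite -!/(ev _ _ _ _) evD /ev.
  + by rewrite c1 // c1' // addr0.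
  + by rewrite c2 // c2' // addr0.
  + by rewrite c3 // c3' // addr0.
- by move=> X Y XV YV; rewrite !evD s // s' // mulrDr.
- by move=> X Y XV YV; rewrite !evD t // t' // mulrDr.
Qed.

Lemma dim_VVxi_class (U : {vspace (tensor_space T)}) eps delta m :
  (forall (b : tensor_space T -> T -> T -> R) (W : {vspace (tensor_space T)}),
    (forall a h h' X Y, b (a *: h + h') X Y = a * b h X Y + b h' X Y) ->
    (forall h, bilinear_form (b h)) ->
    (forall h, h \in W -> {in V &, forall X Y, b h X Y = 0} -> h = 0) ->
    (forall h, h \in W -> {in V &, forall X Y, b h X Y = eps * b h Y X}) ->
    (forall h, h \in W -> {in V &, forall X Y, b h (F X) (F Y) = delta * b h X Y}) ->
    (\dim W <= m)%N) ->
  (forall h, h \in U -> VVxi_class eps delta h) -> (\dim U <= m)%N.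
Proof.
move=> H UP; apply: (H (fun h X Y => ev h X Y xi)) => [a h h' X Y|h|h /UP[]|h /UP[]|h /UP[]] //.
- exact: ev_linear.
- by split=> *; rewrite (evPl, evPm).
- by move=> B c _ _; apply: (VVxi_eq0 hF).
Qed.

Lemma component_VVxi_class (i : 'I_12) eps delta h : (4 <= i < 10)%N ->
    (comp i h -> xi_sym g xi eps h /\ xi_F_type g xi F delta h) ->
  h \in W i -> VVxi_class eps delta h.
Proof.
move=> i4 st hi; have ci := (hW i h).1 hi; have [s t] := st ci.
by split=> //; [exact: in_Tbar hi | exact: component_VVxi i4 ci].
Qed.

Lemma dim_W5 : (d 5 + n <= n * n)%N.
Proof.
have nn : (n <= n * n)%N by nia.
suff : (d 5 <= n * n - n)%N by lia.
apply: (dim_VVxi_class (eps := -1) (delta := -1)) => [b W' *|h].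
  by apply: (dim_skew_anti (b := b)) => //.
by apply: component_VVxi_class => // -[_]; apply: T6_types.
Qed.

Lemma dim_W8 : (d 8 <= n * n + n)%N.
Proof.
apply: (dim_VVxi_class (eps := 1) (delta := -1)) => [b W' *|h].
  by apply: (dim_sym_anti (b := b)) => //.
by apply: component_VVxi_class => // -[_]; apply: T9_types.
Qed.

Lemma dim_W46 : (d 4 + d 6 <= n * n)%N.
Proof.
apply: (dim_component_add (P := VVxi_class (-1) 1)) => //.
- by move=> h; apply: component_VVxi_class => // -[_]; apply: T5_types.
- by move=> h; apply: component_VVxi_class => // -[_]; apply: (T7_types hF).
- exact: VVxi_classD.
move=> U; apply: dim_VVxi_class => b W' *.
by apply: (dim_skew_type1 (b := b)) => //.
Qed.

Lemma dim_W79 : (d 7 + d 9 <= n * n)%N.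
Proof.
apply: (dim_component_add (P := VVxi_class 1 1)) => //.
- by move=> h; apply: component_VVxi_class => // -[_]; apply: T8_types.
- by move=> h; apply: component_VVxi_class => // -[_]; apply: (T10_types hF).
- exact: VVxi_classD.
move=> U; apply: dim_VVxi_class => b W' *.
by apply: (dim_sym_type1 (b := b)) => //.
Qed.

Lemma dim_W23 : (d 2 + d 3 + n * n <= n * n * n)%N.
Proof.
have nn : (n <= n * n)%N by nia.
suff : (d 2 + d 3 <= n * (n * n - n))%N by rewrite mulnBr; nia.
apply: (dim_component_add (P := fun h =>
  [/\ Tbar h, concentrated_VVV g xi h & F_type g xi F 1 h])) => //.
- move=> h /hW ch; split; [by case: ch | exact: component_VVV ch | ].
  by case: ch => _ /T3_F_type.
- move=> h /hW ch; split; [by case: ch | exact: component_VVV ch | ].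
  by case: ch => _ /(T4_F_type hF).
- move=> h h' [B [c1 c2 c3] t] [B' [c1' c2' c3'] t']; split; first exact: TbarD.
    split=> [X Y XV YV|X XV|X Y XV YV]; rewrite -!/(ev _ _ _ _) evD /ev.
    + by rewrite c1 // c1' // addr0.
    + by rewrite c2 // c2' // addr0.
    + by rewrite c3 // c3' // addr0.
  by move=> X Y Z XV YV ZV; rewrite !evD t // t' // mulrDr.
by move=> U; apply: dim_F_type1.
Qed.

Lemma dim_W0 : (3 * d 0 + 3 * (n * n) <= n * n * n + 2 * n)%N.
Proof.
have := dim_T1 (fun h hw => (hW #0 h).1 hw).
have := bin_ffact n 3; rewrite !ffactnS ffactn0 muln1 -[3`!]/6%N.
by case: n n_gt1 => [|[|k]] // _ /=; nia.
Qed.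

Lemma dim_W1 : (3 * d 1 + 2 * n <= 2 * (n * n * n))%N.
Proof.
have := dim_T2 (fun h hw => (hW #1 h).1 hw).
have := bin_ffact n 3; rewrite !ffactnS ffactn0 muln1 -[3`!]/6%N.
by case: n n_gt1 => [|[|k]] // _ /=; nia.
Qed.

Let g_ee i j : g (e i) (e j) = (i == j)%:R.
Proof.
rewrite (adapted_g hF aE) ?mem_nth ?size_E // nth_uniq ?size_E //.
exact: (adapted_uniq hF aE).
Qed.

Let g_eF i j : g (e i) (F (e j)) = 0.
Proof. by rewrite (adapted_gF hF aE) ?mem_nth ?size_E. Qed.

Lemma dim_W3 : d 3 = (2 * n)%N.
Proof.
have card2n : (2 * n = #|{: bool * 'I_n}|)%N by rewrite card_prod card_bool card_ord.
pose phi (q : bool * 'I_n) h := beta F E h (Fk q.1 (e q.2)).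
have phi_lin q a h h' : phi q (a *: h + h') = a * phi q h + phi q h'.
  exact: beta_linear.
apply/eqP; rewrite eqn_leq card2n; apply/andP; split.
  apply: (tensor_dim_le phi_lin) => h /hW[Bh t4] h0; apply: (T4_eq0 hF Bh t4).
  apply: scalar_frame_eq0 => [a X Y|i]; first exact: beta_lin.
  by split; [exact: (h0 (false, i)) | exact: (h0 (true, i))].
apply: (tensor_dim_surj phi_lin) => c.
pose th U := \sum_i (c (false, i) * g U (e i) + c (true, i) * g U (F (e i))).
have thP : scalar th.
  move=> a X Y; rewrite /th mulr_sumr -big_split; apply: eq_bigr => i _ /=.
  by rewrite !gPl; ring.
have [k [kP _ _ _ [bk ck]]] := trace_tensor hF n_gt1 dimT aE thP.
exists (tensV g xi k) => [|[r j]]; first by apply/hW; exact: ck.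
rewrite /phi /= bk; last by case: r; [exact: FeV | exact: eV].
have g_Fe i : g (F (e j)) (e i) = 0 by rewrite (gFl hF) g_eF oppr0.
have g_FF i : g (F (e j)) (F (e i)) = (j == i)%:R by rewrite (gFF hF) // g_ee.
rewrite /th (bigD1 j) //= big1 => [|i ij].
  by case: r; rewrite /= ?g_FF ?g_Fe ?g_eF ?g_ee eqxx mulr1n; ring.
have ji : (j == i) = false by rewrite eq_sym (negPf ij).
by case: r; rewrite /= ?g_FF ?g_Fe ?g_eF ?g_ee ji mulr0n; ring.
Qed.

Lemma dim_W6 : d 6 = 1%N.
Proof.
have two_n : 2 * n%:R != 0 :> R by rewrite mulf_neq0 ?pnatr_eq0 //; case: n n_gt1.
apply/eqP; rewrite eqn_leq; apply/andP; split.
  apply: (@leq_trans #|{: unit}|); last by rewrite card_unit.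
  pose phi (_ : unit) h := beta_bar F E h xi.
  have phi_lin q a h h' : phi q (a *: h + h') = a * phi q h + phi q h'.
    exact: beta_bar_linear.
  apply: (tensor_dim_le phi_lin) => h hw h0; have [Bh [t z]] := (hW _ _).1 hw.
  apply: (VVxi_eq0 hF) => // X Y XV YV.
  by rewrite /ev t // [beta_bar _ _ _ _](h0 tt) mulr0.
have [qP sq tq] := fundamental_form_tensor hF n_gt1 dimT aE 1.
rewrite lt0n dimv_eq0; apply: contra_neq two_n => W0.
have := beta_bar_tensVVxi hF aE qP; rewrite sq mulr1.
suff -> : tensVVxi g xi (fun X Y => 1 * g X (F Y)) = 0.
  by rewrite beta_bar0 => /esym/eqP; rewrite oppr_eq0 => /eqP.
by apply/eqP; rewrite -memv0 -W0; apply/hW.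
Qed.

Lemma dim_W9 : d 9 = 1%N.
Proof.
have two_n : 2 * n%:R != 0 :> R by rewrite mulf_neq0 ?pnatr_eq0 //; case: n n_gt1.
apply/eqP; rewrite eqn_leq; apply/andP; split.
  apply: (@leq_trans #|{: unit}|); last by rewrite card_unit.
  pose phi (_ : unit) h := beta F E h xi.
  have phi_lin q a h h' : phi q (a *: h + h') = a * phi q h + phi q h'.
    exact: beta_linear.
  apply: (tensor_dim_le phi_lin) => h hw h0; have [Bh [t z]] := (hW _ _).1 hw.
  apply: (VVxi_eq0 hF) => // X Y XV YV.
  by rewrite /ev t // [beta _ _ _ _](h0 tt) mulr0.
have [qP sq tq] := metric_tensor hF n_gt1 dimT aE 1.
rewrite lt0n dimv_eq0; apply: contra_neq two_n => W0.
have := beta_tensVVxi hF aE qP; rewrite sq mulr1.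
suff -> : tensVVxi g xi (fun X Y => 1 * g X Y) = 0.
  by rewrite beta0 => /esym.
by apply/eqP; rewrite -memv0 -W0; apply/hW.
Qed.

Lemma dim_W10 : (d 10 <= 2 * n)%N.
Proof.
have -> : (2 * n = #|{: bool * 'I_n}|)%N by rewrite card_prod card_bool card_ord.
pose phi (q : bool * 'I_n) h := ev h xi (Fk q.1 (e q.2)) xi.
apply: (tensor_dim_le (phi := phi)) => [q a h h'|h /hW[Bh t11] h0]; first exact: ev_linear.
apply: (T11_eq0 hF Bh t11); apply: scalar_frame_eq0 => [|i]; first exact: ev_scalar2.
by split; [exact: (h0 (false, i)) | exact: (h0 (true, i))].
Qed.

Lemma dim_W11 : (d 11 + n <= n * n)%N.
Proof.
have nn : (n <= n * n)%N by nia.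
suff : (d 11 <= n * n - n)%N by lia.
pose b h X Y := ev h xi X Y.
have bL a h h' X Y : b (a *: h + h') X Y = a * b h X Y + b h' X Y by exact: ev_linear.
have bP h : bilinear_form (b h) by split=> *; rewrite /b (evPm, evPr).
have b_inj h : h \in W #11 -> {in V &, forall X Y, b h X Y = 0} -> h = 0.
  by case/hW => Bh t12; exact: (T12_eq0 hF Bh t12).
have bs h : h \in W #11 -> {in V &, forall X Y, b h X Y = -1 * b h Y X}.
  by move=> hw X Y XV YV; rewrite mulN1r /b (Tbar_skew (in_Tbar hw)).
have bF h : h \in W #11 -> {in V &, forall X Y, b h (F X) (F Y) = -1 * b h X Y}.
  by move=> hw X Y XV YV; rewrite mulN1r /b (Tbar_FF (in_Tbar hw)).
exact: (dim_skew_anti bL bP b_inj bs bF erefl erefl).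
Qed.

Hypothesis sumW : forall h, Tbar h -> h \in (\sum_i W i)%VS.

(** The upper bounds add up to the lower bound for Tbar, hence all of them are
    equalities. *)
Lemma component_dims i : (\dim (W i))%:R = (Tbar_dims n)`_i :> rat.
Proof.
have oW := fun i j => @component_dot _ _ _ _ _ hF n _ aE i j.
have dirW : directv (\sum_i W i).
  apply: (orthogonal_directv (adapted_orthonormal aE)) => {}i j ij h h' /hW hi /hW hj.
  exact: (oW i j h h' ij hi hj).
have tot := dim_Tbar sumW.
have {dirW} dimW : \dim (\sum_i W i) = (\sum_i \dim (W i))%N := directvP dirW.
have sumd : (\sum_i \dim (W i) = d 0 + (d 1 + (d 2 + (d 3 + (d 4 + (d 5 + (d 6 + (d 7 + (d 8 +
    (d 9 + (d 10 + d 11)))))))))))%N.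
  rewrite !big_ord_recl big_ord0 addn0.
  by do ![congr (_ + _)%N]; congr (\dim (W _)); exact: val_inj.
rewrite {}dimW {}sumd in tot.
have := dim_W0; have := dim_W1; have := dim_W23; have := dim_W3; have := dim_W46.
have := dim_W5; have := dim_W6; have := dim_W79; have := dim_W8; have := dim_W9.
have := dim_W10; have := dim_W11.
move=> b11 b10 b9 b8 b79 b6 b5 b46 b3 b23 b1 b0.
have {tot} : [/\ 3 * d 0 + 3 * (n * n) = n * n * n + 2 * n,
    3 * d 1 + 2 * n = 2 * (n * n * n), d 2 + 2 * n + n * n = n * n * n,
    d 4 + 1 = n * n & [/\ d 5 + n = n * n, d 7 + 1 = n * n, d 8 = n * n + n,
    d 10 = 2 * n & d 11 + n = n * n]]%N.
  have {}tot : (2 * (n * n * n) + 3 * (n * n) + n <= d 0 + (d 1 + (d 2 + (d 3 + (d 4 + (d 5 + (d 6 + (d 7 + (d 8 +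
    (d 9 + (d 10 + d 11)))))))))))%N.
    by apply: leq_trans tot; rewrite leq_eqVlt; apply/orP; left; apply/eqP; ring.
  move: b0 b1 b23 b3 b46 b5 b6 b79 b8 b9 b10 b11 tot.
  move: (n * n * n)%N (n * n)%N => n3 n2.
  by split; [lia..|split; lia].
move: b3 b6 b9 => {b0 b1 b23 b46 b5 b79 b8 b10 b11} e3 e6 e9 [e0 e1 e2 e4 [e5 e7 e8 e10 e11]].
have Q (a b : nat) : a = b -> a%:R = b%:R :> rat by move=> ->.
move: e0 e1 e2 e3 e4 e5 e6 e7 e8 e9 e10 e11.
do 12 (move=> /Q; rewrite ?(natrD, natrM); move=> ?).
have -> : \dim (W i) = nth 0%N [:: d 0; d 1; d 2; d 3; d 4; d 5; d 6; d 7; d 8; d 9; d 10; d 11] i.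
  by case: i => i lti; ord_cases_keep i lti 12%N; rewrite /= (bool_irrelevance lti isT).
by case: i => i lti /=; ord_cases i lti 12%N; rewrite /Tbar_dims /=; lra.
Qed.

End Components.

End Dimensions.

(** * Invariance under the structure group *)

Section Invariance.

Variables (R : realType) (T : vectType R).
Variables (g : {dot T for idfun}) (xi : T) (F : 'End(T)).
Hypothesis hF : almost_contact_metric g xi F.
Local Notation V := (contact_space g xi).
Local Notation H := (structure_group g xi F).
Local Notation Tbar := (Tbar g xi F).
Implicit Types (X Y Z U : T) (h : tensor_space T).

Variables (n : nat) (E : seq T).
Hypothesis dimT : \dim {:T} = n.*2.+1.
Hypothesis aE : adapted_basis g xi F E.

Variable a : 'End(T).
Hypothesis aH : H a.

Lemma pull_app h X Y Z : pull a h X Y Z = h (a X) (a Y) (a Z) :> R.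
Proof. exact: pullE. Qed.

Let aV X : X \in V -> a X \in V. Proof. by rewrite (H_V aH). Qed.

Lemma beta_pull h U : beta F E (pull a h) U = beta F E h (a U).
Proof.
rewrite [in RHS](beta_indep aE (map_adapted dimT aH aE)) /beta big_map.
by apply: eq_bigr => X _; rewrite !pull_app !(H_F aH).
Qed.

Lemma beta_bar_pull h U : beta_bar F E (pull a h) U = beta_bar F E h (a U).
Proof.
rewrite [in RHS](beta_bar_indep hF aE (map_adapted dimT aH aE)) /beta_bar big_map.
by apply: eq_bigr => X _; rewrite !pull_app !(H_F aH).
Qed.

Lemma pull_Tbar h : Tbar h -> Tbar (pull a h).
Proof.
move=> [s f]; split=> [X Y Z|X Y Z YV ZV]; rewrite !pull_app; first exact: s.
by rewrite !(H_F aH); apply: f; exact: aV.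
Qed.

Lemma pull_zeroVVV h : zeroVVV g xi h -> zeroVVV g xi (pull a h).
Proof. by move=> z X Y Z XV YV ZV; rewrite pull_app z ?aV. Qed.

Lemma pull_zeroVVx h : zeroVVx g xi h -> zeroVVx g xi (pull a h).
Proof. by move=> z X Y XV YV; rewrite pull_app (H_xi aH) z ?aV. Qed.

Lemma pull_zeroxVx h : zeroxVx g xi h -> zeroxVx g xi (pull a h).
Proof. by move=> z X XV; rewrite pull_app (H_xi aH) z ?aV. Qed.

Lemma pull_zeroxVV h : zeroxVV g xi h -> zeroxVV g xi (pull a h).
Proof. by move=> z X Y XV YV; rewrite pull_app (H_xi aH) z ?aV. Qed.

Lemma pull_component i h : Tbar_component g xi F n E i h ->
  Tbar_component g xi F n E i (pull a h).
Proof.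
move=> [Bh]; case: i => i lti /= ch; split; first exact: pull_Tbar.
have zVVV := @pull_zeroVVV h; have zVVx := @pull_zeroVVx h.
have zxVx := @pull_zeroxVx h; have zxVV := @pull_zeroxVV h.
have axi := H_xi aH; have aF := H_F aH; have ag := H_g aH.
move=> /=; ord_cases i lti 12%N; rewrite /= in ch *.
- case: ch => c z1 z2 z3; split=> [X Y Z XV YV ZV|||]; auto.
  by rewrite !pull_app; apply: c; exact: aV.
- case: ch => c z1 z2 z3; split=> [X Y Z XV YV ZV|||]; auto.
  by rewrite !pull_app; apply: c; exact: aV.
- case: ch => c b z1 z2 z3; split=> [X Y Z XV YV ZV|Z ZV|||]; auto.
    by rewrite !pull_app !aF; apply: c; exact: aV.
  by rewrite beta_pull; apply: b; exact: aV.
- case: ch => c z1 z2 z3; split=> [X Y Z XV YV ZV|||]; auto.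
  by rewrite pull_app (c _ _ _ (aV XV) (aV YV) (aV ZV)) !beta_pull -!aF !ag.
- case: ch => s f b [z1 z2 z3]; split=> [X Y XV YV|X Y XV YV||].
  + by rewrite !pull_app axi; apply: s; exact: aV.
  + by rewrite !pull_app !aF axi; apply: f; exact: aV.
  + by rewrite beta_bar_pull axi.
  + by split; auto.
- case: ch => s f [z1 z2 z3]; split=> [X Y XV YV|X Y XV YV|].
  + by rewrite !pull_app axi; apply: s; exact: aV.
  + by rewrite !pull_app !aF axi; apply: f; exact: aV.
  + by split; auto.
- case: ch => c [z1 z2 z3]; split; [move=> X Y XV YV | by split; auto].
  by rewrite pull_app axi (c _ _ (aV XV) (aV YV)) beta_bar_pull axi -aF ag.
- case: ch => s f b [z1 z2 z3]; split=> [X Y XV YV|X Y XV YV||].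
  + by rewrite !pull_app axi; apply: s; exact: aV.
  + by rewrite !pull_app !aF axi; apply: f; exact: aV.
  + by rewrite beta_pull axi.
  + by split; auto.
- case: ch => s f [z1 z2 z3]; split=> [X Y XV YV|X Y XV YV|].
  + by rewrite !pull_app axi; apply: s; exact: aV.
  + by rewrite !pull_app !aF axi; apply: f; exact: aV.
  + by split; auto.
- case: ch => c [z1 z2 z3]; split; [move=> X Y XV YV | by split; auto].
  by rewrite pull_app axi (c _ _ (aV XV) (aV YV)) beta_pull axi ag.
- by case: ch => z1 z2 z3; split; auto.
- case: ch => s t z1 z2 z3; split=> [X Y XV YV|X Y XV YV|||]; auto; rewrite !pull_app axi.
    by apply: s; exact: aV.
  by rewrite !aF; apply: t; exact: aV.
Qed.

End Invariance.

Section StructureGroupElements.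

Variables (R : realType) (T : vectType R).
Variables (g : {dot T for idfun}) (xi : T) (F : 'End(T)).
Hypothesis hF : almost_contact_metric g xi F.
Local Notation V := (contact_space g xi).
Local Notation H := (structure_group g xi F).
Implicit Types (X Y Z U : T).

Lemma linear_structure_group (r : T -> T) :
    (forall a X Y, r (a *: X + Y) = a *: r X + r Y) ->
    (forall X Y, g (r X) (r Y) = g X Y) -> r xi = xi ->
    (forall X, r (F X) = F (r X)) ->
  exists2 a, H a & forall X, a X = r X.
Proof.
move=> rP rg rxi rF.
pose rL : {linear T -> T} := HB.pack r (GRing.isLinear.Build _ _ _ _ r rP).
have aE X : linfun rL X = r X by rewrite lfunE.
exists (linfun rL) => //; split=> [X Y||]; first by rewrite !aE; exact: rg.
  by rewrite aE.
by apply/lfunP => X; rewrite !comp_lfunE !aE rF.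
Qed.

(** Multiplication by c + s i on the complex line of the unit vector y, with
    F in the role of i. *)
Lemma complex_line_rotation y (c s : R) : y \in V -> g y y = 1 -> c ^+ 2 + s ^+ 2 = 1 ->
  exists2 a, H a & forall X, a X = X + ((c - 1) * g X y - s * g X (F y)) *: y
                                   + ((c - 1) * g X (F y) + s * g X y) *: F y.
Proof.
move=> yV yy cs.
pose A X := (c - 1) * g X y - s * g X (F y).
pose B X := (c - 1) * g X (F y) + s * g X y.
have yFy : g y (F y) = 0 := gXFX hF y.
have Fyy : g (F y) y = 0 by rewrite gC.
have FyFy : g (F y) (F y) = 1 by rewrite (gFF hF).
apply: (@linear_structure_group (fun X => X + A X *: y + B X *: F y)) => [a X Y|X Y||X].
- have -> : A (a *: X + Y) = a * A X + A Y by rewrite /A !gPl; ring.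
  have -> : B (a *: X + Y) = a * B X + B Y by rewrite /B !gPl; ring.
  move: (A X) (A Y) (B X) (B Y) => p q p' q'.
  by rewrite !scalerDr !scalerDl !scalerA [X in X + _ = _]addrACA [LHS]addrACA.
- rewrite !gE (gC g y Y) (gC g (F y) Y) yy yFy Fyy FyFy.
  apply/eqP; rewrite -subr_eq0; apply/eqP.
  transitivity ((c ^+ 2 + s ^+ 2 - 1) * (g X y * g Y y + g X (F y) * g Y (F y))).
    by rewrite /A /B; ring.
  by rewrite cs subrr mul0r.
- by rewrite /A /B !(xi_g yV) !(xi_g (FV hF y)) !mulr0 subr0 addr0 !scale0r !addr0.
- have -> : A (F X) = - B X by rewrite /A /B (gFF hF X yV) (gFl hF); ring.
  have -> : B (F X) = A X by rewrite /A /B (gFF hF X yV) (gFl hF); ring.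
  by rewrite !linearD !linearZ /= (FF hF yV) scalerN scaleNr addrAC.
Qed.

Lemma complex_line_flip y : y \in V -> g y y = 1 ->
  exists2 a, H a & (forall X, g X y = 0 -> g X (F y) = 0 -> a X = X) /\ a y = - y.
Proof.
move=> yV yy; have [|a aH aE] := @complex_line_rotation y (-1) 0 yV yy.
  by rewrite sqrrN expr1n expr0n addr0.
exists a => //; split=> [X Xy XFy|]; rewrite aE ?Xy ?XFy ?yy ?(gXFX hF).
  by rewrite !mulr0 subr0 addr0 !scale0r !addr0.
rewrite mulr1 mulr0 subr0 !mul0r mulr0 !addr0 scale0r addr0.
by rewrite -{1}[y]scale1r -scalerDl -scaleN1r; congr (_ *: _); ring.
Qed.

Lemma complex_line_J y : y \in V -> g y y = 1 ->
  exists2 a, H a & (forall X, g X y = 0 -> g X (F y) = 0 -> a X = X) /\ a y = F y.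
Proof.
move=> yV yy; have [|a aH aE] := @complex_line_rotation y 0 1 yV yy.
  by rewrite expr0n expr1n add0r.
exists a => //; split=> [X Xy XFy|]; rewrite aE ?Xy ?XFy ?yy ?(gXFX hF).
  by rewrite !mulr0 subr0 addr0 !scale0r !addr0.
rewrite !mulr0 !mulr1 !subr0 add0r add0r scale1r scaleN1r subrr.
by rewrite add0r.
Qed.

(** F itself is not in the group, as it kills xi; F + g(-, xi) xi is. *)
Lemma complex_unit : exists2 a, H a & {in V, forall X, a X = F X}.
Proof.
have [a aH aE] : exists2 a, H a & forall X, a X = F X + g X xi *: xi.
  apply: linear_structure_group => [a X Y|X Y||X].
  - by rewrite linearP gPl scalerDl scalerDr scalerA addrACA.
  - rewrite !gE (g_xi hF) (elimT (contactP g xi _) (FV hF X)) (xi_g (FV hF Y)).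
    rewrite -(F_proj hF Y) (gFF hF X (projV hF Y)) /proj !gE.
    by ring.
  - by rewrite (F_xi hF) (g_xi hF) scale1r add0r.
  - by rewrite linearD linearZ /= (F_xi hF) scaler0 (elimT (contactP g xi _) (FV hF X)) scale0r.
by exists a => // X /contactP X0; rewrite aE X0 scale0r addr0.
Qed.

End StructureGroupElements.

Section InvariantSpaces.

Variables (R : realType) (T : vectType R).
Variables (g : {dot T for idfun}) (xi : T) (F : 'End(T)).
Implicit Types (h : tensor_space T) (W : {vspace (tensor_space T)}).

Lemma tensor_mem_linear W a h h' : h \in W -> h' \in W -> a *: h + h' \in W.
Proof. by move=> hW h'W; apply: tensor_memD => //; apply: tensor_memZ. Qed.

Lemma invariant_pull W a h : H_invariant g xi F W -> structure_group g xi F a ->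
  h \in W -> pull a h \in W.
Proof. by move=> iW aH; exact: ((H_invariantP g xi F W).1 iW). Qed.

Lemma linear_pred_space (P : tensor_space T -> Prop) : linear_pred P ->
  exists U : {vspace (tensor_space T)}, forall h, h \in U <-> P h.
Proof. by case=> P0 PD; exact: linear_pred_vspace P0 PD. Qed.

Lemma nonzero_vector W : W != 0%VS -> exists2 h : tensor_space T, h \in W & h <> 0.
Proof. by move=> Wn0; exists (vpick W); [exact: memv_pick | apply/eqP; rewrite vpick0]. Qed.

Definition tensor_orthogonal (e : seq T) W h : Prop :=
  forall h', h' \in W -> tensor_dot e h' h = 0.

Lemma tensor_orthogonal_linear e W : linear_pred (tensor_orthogonal e W).
Proof.
split=> [h' _|c u v u0 v0 h' h'W]; first exact: tensor_dot0r.
by rewrite tensor_dot_linear u0 // v0 // mulr0 addr0.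
Qed.

Lemma mem_linear_pred W : linear_pred (fun h : tensor_space T => h \in W).
Proof. by split=> [|a u v]; [exact: tensor_mem0 | exact: tensor_mem_linear]. Qed.

(** The products with a basis of W1 are dim W1 linear conditions. *)
Lemma dim_orthogonal e W1 W2 W :
    (forall h, h \in W -> tensor_orthogonal e W1 h -> h \in W2) ->
  (\dim W <= \dim W2 + \dim W1)%N.
Proof.
move=> sub; pose phi (j : 'I_(\dim W1)) h := tensor_dot e (vbasis W1)`_j h.
have phi_lin j a h h' : phi j (a *: h + h') = a * phi j h + phi j h'.
  exact: tensor_dot_linear.
have := @tensor_dim_ge _ _ _ phi phi_lin W W2; rewrite card_ord; apply => h hW h0.
apply: sub => // h' /coord_vbasis ->; rewrite tensor_dotC.
rewrite (big_morph (tensor_dot e h) (tensor_dotDr e h) (tensor_dot0r e h)) big1 // => j _.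
by rewrite tensor_dotZr tensor_dotC [tensor_dot _ _ _](h0 j) mulr0.
Qed.

End InvariantSpaces.

Section InvariantComplement.

Variables (R : realType) (T : vectType R).
Variables (g : {dot T for idfun}) (xi : T) (F : 'End(T)).
Hypothesis hF : almost_contact_metric g xi F.
Local Notation H := (structure_group g xi F).
Local Notation invariant := (H_invariant g xi F).
Implicit Types (h : tensor_space T) (W : {vspace (tensor_space T)}).

Lemma tensor_dot_pull e a h h' : H a -> orthonormal_basis g e ->
  tensor_dot e (pull a h) (pull a h') = tensor_dot e h h'.
Proof.
move=> aH oe; have [be on] := andP oe.
have oae : orthonormal_basis g (map a e).
  rewrite /orthonormal_basis (orthonormal_map aH on) andbT.
  rewrite basisEdim size_map; have := be; rewrite basisEdim => /andP[_ ->].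
  rewrite andbT -limg_span (span_basis be).
  by rewrite (lker0_limgf (H_lker0 aH)).
rewrite -[RHS](tensor_dot_indep h h' oae oe) /tensor_dot big_map.
apply: eq_bigr => X _; rewrite big_map; apply: eq_bigr => Y _; rewrite big_map.
by apply: eq_bigr => Z _; rewrite !pull_app.
Qed.

Definition common_vector W1 W2 : Prop :=
  exists h, [/\ h <> 0, h \in W1 & h \in W2].

Lemma irreducible_intro W : W != 0%VS ->
    (forall W1 : {vspace (tensor_space T)}, (W1 <= W)%VS -> invariant W1 ->
       W1 = 0%VS \/ W1 = W) ->
  H_irreducible g xi F W.
Proof. by move=> W0 irr; split. Qed.

(** The orthogonal complement of an invariant subspace is invariant and meets
    it trivially, so it vanishes if any two nonzero invariant subspaces meet. *)
Lemma irreducible_of_meet e W : orthonormal_basis g e -> W != 0%VS -> invariant W ->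
    (forall W1 W2, (forall h, h \in W1 -> h \in W) ->
       (forall h, h \in W2 -> h \in W) -> invariant W1 -> invariant W2 ->
       W1 != 0%VS -> W2 != 0%VS -> common_vector W1 W2) ->
  H_irreducible g xi F W.
Proof.
move=> oe W0 invW meet; apply: irreducible_intro => // W1 sW1 inv1.
have [->|W1n0] := eqVneq W1 0%VS; [by left | right]; apply/eqP.
rewrite eqEdim sW1 /= leqNgt; apply/negP => ltW.
have [W2 W2P] := linear_pred_space
  (linear_pred_and (mem_linear_pred W) (tensor_orthogonal_linear e W1)).
have s1 h : h \in W1 -> h \in W by exact: (subvP sW1).
have s2 h : h \in W2 -> h \in W by case/W2P.
have inv2 : invariant W2.
  apply/H_invariantP => a h aH /W2P[hW h0]; apply/W2P.
  split=> [|h' h'W]; first exact: invariant_pull invW aH hW.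
  have aH' := H_inv aH.
  have -> : h' = pull a (pull a^-1%VF h').
    by apply: evP => X Y Z; rewrite !pullE !(H_K aH).
  by rewrite tensor_dot_pull //; apply: h0; exact: invariant_pull inv1 aH' h'W.
have W2n0 : W2 != 0%VS.
  rewrite -dimv_eq0 -lt0n -(ltn_add2r (\dim W1)) add0n; apply: leq_trans ltW _.
  by apply: (@dim_orthogonal _ _ e) => h hW h0; apply/W2P.
have [h [hn0 h1 h2]] := meet _ _ s1 s2 inv1 inv2 W1n0 W2n0.
have [_ o] := (W2P h).1 h2.
exact: hn0 (tensor_dot_eq0 oe (o h h1)).
Qed.

End InvariantComplement.

(** * A criterion for irreducibility *)

Section FrameCriterion.

Variables (R : realType) (T : vectType R).
Variables (g : {dot T for idfun}) (xi : T) (F : 'End(T)).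
Hypothesis hF : almost_contact_metric g xi F.
Local Notation H := (structure_group g xi F).
Local Notation invariant := (H_invariant g xi F).
Local Notation adapted := (adapted_basis g xi F).
Implicit Types (X Y Z U x y z : T) (h : tensor_space T) (W : {vspace (tensor_space T)}).

Variables (n : nat).
Hypothesis dimT : \dim {:T} = n.*2.+1.

Definition tensor_linear (P : tensor_space T -> tensor_space T) : Prop :=
  forall c h h', P (c *: h + h') = c *: P h + P h'.

Definition preserves_invariant (P : tensor_space T -> tensor_space T) : Prop :=
  forall W h, invariant W -> h \in W -> P h \in W.

(** The polynomials in elements of the structure group are of this kind. *)
Definition group_operator P : Prop := tensor_linear P /\ preserves_invariant P.

Lemma group_operator_pull a c : H a -> group_operator (fun h => c *: pull a h + h).
Proof.
move=> aH; split=> [k h h'|W h invW hW].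
  apply: evP => X Y Z.
  pose p u := ev u (a X) (a Y) (a Z); pose q u := ev u X Y Z.
  have l : ev (c *: pull a (k *: h + h') + (k *: h + h')) X Y Z =
      c * (k * p h + p h') + (k * q h + q h') by rewrite !(ev_linear, pullE).
  have r : ev (k *: (c *: pull a h + h) + (c *: pull a h' + h')) X Y Z =
      k * (c * p h + q h) + (c * p h' + q h') by rewrite !(ev_linear, pullE).
  by apply: etrans l _; apply: etrans _ (esym r); ring.
by apply: tensor_mem_linear => //; exact: invariant_pull invW aH hW.
Qed.

(** Twice the projection on the eigenvalue -1, when a is an involution. *)
Definition anti_part a h : tensor_space T := -1 *: pull a h + h.

Lemma ev_anti_part a h X Y Z :
  ev (anti_part a h) X Y Z = ev h X Y Z - ev h (a X) (a Y) (a Z).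
Proof. by rewrite ev_linear pullE mulN1r addrC. Qed.

Lemma group_operator_anti_part a : H a -> group_operator (anti_part a).
Proof. exact: group_operator_pull. Qed.

Lemma group_operator_comp P Q : group_operator P -> group_operator Q ->
  group_operator (fun h => P (Q h)).
Proof.
move=> [PL PI] [QL QI]; split=> [c h h'|W h invW hW]; first by rewrite QL PL.
by apply: (PI W) => //; apply: QI.
Qed.

Lemma nth_map0 (a : 'End(T)) D i : nth 0 (map a D) i = a (nth 0 D i).
Proof.
have [iD|iD] := ltnP i (size D); first by rewrite (nth_map 0).
by rewrite !nth_default ?size_map ?linear0.
Qed.

Variables (x : T) (E : seq T) (W : {vspace (tensor_space T)}).
Variables (phi : seq T -> tensor_space T -> R) (P : tensor_space T -> tensor_space T).
Hypothesis aE : adapted (x :: E).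
Hypotheses (invW : invariant W) (W0 : W != 0%VS).
Hypothesis phi_linear : forall D a h h', phi D (a *: h + h') = a * phi D h + phi D h'.
Hypothesis phi_pull : forall a D h, H a -> phi D (pull a h) = phi (map a D) h.
Hypothesis phi_FF : forall h, phi (F (F x) :: E) h = - phi (x :: E) h.
Hypothesis phi_detect : forall h, h \in W ->
  (forall D, adapted D -> phi D h = 0) -> h = 0.
Hypothesis opP : group_operator P.
Hypothesis P_inj : forall h, h \in W ->
  phi (x :: E) h = 0 -> phi (F x :: E) h = 0 -> P h = 0.
Hypothesis P_phi : forall h, h \in W -> P h = 0 -> phi (x :: E) h = 0.

(** Let p and q be the values of phi at the frames x :: E and F x :: E, and J
    the rotation of the complex line of x that maps x to F x. Then h and its
    image under J have values (p, q) and (q, -p), so that a combination of the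
    two has values (1, 0). On this normalized tensor P takes a value that
    depends on W only. *)
Theorem irreducible_criterion : H_irreducible g xi F W.
Proof.
have [PL PI] := opP.
have phi0 D : phi D 0 = 0 by have := phi_linear D 1 0 0; rewrite scaler0 addr0; lra.
have xE : x \in x :: E by rewrite mem_head.
have xV := adapted_contact hF aE xE.
have xx : g x x = 1 by rewrite (adapted_g hF aE) // eqxx.
have [J JH [J_id Jx]] := complex_line_J hF xV xx.
have JE D : map J (D :: E) = J D :: E.
  congr (_ :: _); rewrite -[RHS]map_id; apply/eq_in_map => y yE.
  have yE' : y \in x :: E by rewrite inE yE orbT.
  apply: J_id; last by rewrite (adapted_gF hF aE).
  rewrite (adapted_g hF aE) //; case: (y =P x) => // yx.
  by have := adapted_uniq hF aE; rewrite /= -yx yE.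
have phi_J h : phi (x :: E) (pull J h) = phi (F x :: E) h by rewrite phi_pull // JE Jx.
have phi_JF h : phi (F x :: E) (pull J h) = - phi (x :: E) h.
  by rewrite phi_pull // JE (H_F JH) Jx phi_FF.
have unit_elt W1 : (forall h, h \in W1 -> h \in W) -> invariant W1 ->
    W1 != 0%VS ->
    exists h, h \in W1 /\ (phi (x :: E) h = 1 /\ phi (F x :: E) h = 0).
  move=> sW1 inv1 /nonzero_vector[h0 [h0W h0n0]].
  have [D [aD phiDn0]] : exists D, adapted D /\ phi D h0 != 0.
    apply: contrapT => noD; apply: h0n0; apply: phi_detect; first exact: sW1.
    by move=> D aD; apply/eqP/negPn/negP => phin0; apply: noD; exists D.
  have [a aH ED] := adapted_transitive hF dimT aE aD.
  pose h := pull a h0; pose p := phi (x :: E) h; pose q := phi (F x :: E) h.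
  have pn0 : p != 0 by rewrite /p phi_pull // ED.
  have hW : h \in W1 by exact: invariant_pull inv1 aH h0W.
  pose N := p ^+ 2 + q ^+ 2.
  have Nn0 : N != 0.
    by rewrite gt_eqF // ltr_wpDr ?sqr_ge0 // lt_neqAle sqr_ge0 eq_sym expf_neq0.
  exists ((p / N) *: h + ((q / N) *: pull J h + 0)); split.
    do 2!apply: tensor_mem_linear => //; last exact: tensor_mem0.
    exact: invariant_pull inv1 JH hW.
  rewrite !phi_linear !phi0 phi_J phi_JF -/p -/q !addr0; split; last by ring.
  by rewrite mulrAC [q / N * q]mulrAC -mulrDl -!expr2 mulfV.
apply: (irreducible_of_meet (adapted_orthonormal aE) W0 invW).
move=> W1 W2 s1 s2 i1 i2 n1 n2.
have [h1 [h1W [e1 f1]]] := unit_elt W1 s1 i1 n1.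
have [h2 [h2W [e2 f2]]] := unit_elt W2 s2 i2 n2.
have P12 : P h1 = P h2.
  have : P ((-1) *: h2 + h1) = 0.
    apply: P_inj; rewrite ?phi_linear ?e1 ?f1 ?e2 ?f2; [|ring|ring].
    by apply: tensor_mem_linear; [exact: s2 | exact: s1].
  rewrite PL => e; apply: evP => X Y Z.
  have : ev (-1 *: P h2 + P h1) X Y Z = 0 by rewrite e ev0.
  by rewrite ev_linear; lra.
exists (P h1); split; [|exact: PI|by rewrite P12; exact: PI].
by move=> /(P_phi (s1 _ h1W))/eqP; rewrite e1 oner_eq0.
Qed.

End FrameCriterion.

(** * Frames and their symmetries *)

Section FrameCoordinates.

Variables (R : realType) (T : vectType R).
Variables (g : {dot T for idfun}) (xi : T) (F : 'End(T)).
Hypothesis hF : almost_contact_metric g xi F.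
Local Notation V := (contact_space g xi).
Local Notation H := (structure_group g xi F).
Local Notation adapted := (adapted_basis g xi F).
Local Notation group_operator := (group_operator g xi F).
Implicit Types (X Y Z U x y z : T) (h : tensor_space T) (W : {vspace (tensor_space T)}).

Variables (n : nat) (E : seq T).
Hypothesis dimT : \dim {:T} = n.*2.+1.
Hypothesis aE : adapted E.

Let e (i : 'I_n) : T := E`_i.
Local Notation Fk := (Fk F).
Let size_E : size E = n := adapted_size dimT aE.

Lemma H_Fk a c X : H a -> a (Fk c X) = Fk c (a X).
Proof. by move=> aH; case: c; rewrite //= (H_F aH). Qed.

Lemma frame_mem i : e i \in E.
Proof. by rewrite mem_nth ?size_E. Qed.

Lemma frame_V i : e i \in V.
Proof. exact: (adapted_contact hF aE (frame_mem i)). Qed.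

Lemma frame_g i j : g (e i) (e j) = if i == j then 1 else 0.
Proof.
rewrite (adapted_g hF aE) ?frame_mem // nth_uniq ?size_E ?(adapted_uniq hF aE) //.
by rewrite -val_eqE /=; case: eqP.
Qed.

Lemma frame_gF i j : g (e i) (F (e j)) = 0.
Proof. by rewrite (adapted_gF hF aE) ?frame_mem. Qed.

Lemma Fk_g c X Y : Y \in V -> g (Fk c X) (Fk c Y) = g X Y.
Proof. by case: c => //= YV; rewrite (gFF hF). Qed.

Lemma frame_gFk c i j : i != j -> g (e i) (Fk c (e j)) = 0.
Proof. by case: c => /negPf ij; rewrite /= ?frame_gF // frame_g ij. Qed.

Lemma frame_gFFk c i j : i != j -> g (e i) (F (Fk c (e j))) = 0.
Proof.
move/negPf => ij; case: c; rewrite /= ?frame_gF // (FF hF (frame_V j)) gNr frame_g ij.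
exact: oppr0.
Qed.

Definition flip_sign (m i : nat) : R := if i == m then -1 else 1.

Lemma frame_flip (m : 'I_n) : exists2 s, H s &
  forall c i, s (Fk c (e i)) = flip_sign m i *: Fk c (e i).
Proof.
have [|s sH [s_id s_m]] := complex_line_flip hF (frame_V m); first by rewrite frame_g eqxx.
exists s => // c i; rewrite (H_Fk c _ sH) -[flip_sign m i *: _]addr0.
have -> : s (e i) = flip_sign m i *: e i + 0.
  rewrite addr0 /flip_sign; have [/val_inj->|im] := eqVneq (i : nat) m.
    by rewrite s_m scaleN1r.
  have {}im : (i == m) = false by apply: contra_neqF im => /eqP->.
  by rewrite scale1r s_id // ?frame_gF // frame_g im.
by rewrite Fk_linear; congr (_ + _); case: c; rewrite //= linear0.
Qed.

Lemma frame_J (m : 'I_n) : exists2 J, H J &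
  forall c i, J (Fk c (e i)) = Fk c (if i == m then F (e i) else e i).
Proof.
have [|J JH [J_id J_m]] := complex_line_J hF (frame_V m); first by rewrite frame_g eqxx.
exists J => // c i; rewrite (H_Fk c _ JH); congr Fk.
have [->|im] := eqVneq i m; first by rewrite J_m.
by rewrite J_id // ?frame_gF // frame_g (negPf im).
Qed.

Lemma frame_pair X Y : X \in V -> Y \in V -> g X X = 1 -> g Y Y = 1 ->
    g X Y = 0 -> g X (F Y) = 0 -> (2 <= n)%N -> exists D, adapted [:: X, Y & D].
Proof.
move=> XV YV XX YY XY XFY n2; apply: (unitary_frame_extend hF dimT (s := [:: X; Y])) => //.
apply: (unitary_frame_cons hF) => // [Z|]; first by rewrite inE => /eqP->.
by apply: (unitary_frame_cons hF) => //; exact: unitary_frame0.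
Qed.

Lemma frame_triple X Y Z : X \in V -> Y \in V -> Z \in V ->
    g X X = 1 -> g Y Y = 1 -> g Z Z = 1 ->
    g X Y = 0 -> g X (F Y) = 0 -> g X Z = 0 -> g X (F Z) = 0 -> g Y Z = 0 -> g Y (F Z) = 0 ->
  (3 <= n)%N -> exists D, adapted [:: X, Y, Z & D].
Proof.
move=> XV YV ZV XX YY ZZ XY XFY XZ XFZ YZ YFZ n3.
apply: (unitary_frame_extend hF dimT (s := [:: X; Y; Z])) => //.
apply: (unitary_frame_cons hF) => // [U|].
  by rewrite !inE => /orP[/eqP->|/eqP->].
apply: (unitary_frame_cons hF) => // [U|]; first by rewrite inE => /eqP->.
by apply: (unitary_frame_cons hF) => //; exact: unitary_frame0.
Qed.

(** Unit vectors on the bisectors of two axes of a frame belong to frames too;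
    evaluating on them relates coordinates with repeated indices. *)
Definition bisector (d : R) X Y : T := (Num.sqrt 2)^-1 *: (d *: Y + X).

Lemma sqr_rsqrt2 : (Num.sqrt 2)^-1 * (Num.sqrt 2)^-1 = 2^-1 :> R.
Proof. by rewrite -invfM -expr2 sqr_sqrtr // ler0n. Qed.

Lemma bisector_V d X Y : X \in V -> Y \in V -> bisector d X Y \in V.
Proof. by move=> XV YV; rewrite /bisector !(memvZ, memvD). Qed.

Lemma bisector_g d d' X Y : g X X = 1 -> g Y Y = 1 -> g X Y = 0 ->
  g (bisector d X Y) (bisector d' X Y) = 2^-1 * (1 + d * d').
Proof.
move=> XX YY XY; rewrite /bisector gZl gZr mulrA sqr_rsqrt2 !gE XX YY (gC g Y X) XY; ring.
Qed.

Lemma bisector_gF d d' X Y : Y \in V -> g X (F Y) = 0 ->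
  g (bisector d X Y) (F (bisector d' X Y)) = 0.
Proof.
move=> YV XFY; rewrite /bisector !(linearZ, linearD) /= !gE !(gXFX hF) XFY.
have -> : g Y (F X) = 0 by rewrite gC (gFl hF) XFY oppr0.
by ring.
Qed.

End FrameCoordinates.

(** * Irreducibility: linear and bilinear forms *)

(** Over an abstract field, whose arithmetic does not compute. *)
Lemma dimension_formulas_neq0 (K : realFieldType) (m : K) (i : 'I_12) : 3 <= m ->
  [:: 1 / 3 * m * (m - 1) * (m - 2); 2 / 3 * m * (m - 1) * (m + 1); m * (m + 1) * (m - 2);
      2 * m; m ^+ 2 - 1; m ^+ 2 - m; 1; m ^+ 2 - 1; m ^+ 2 + m; 1; 2 * m; m ^+ 2 - m]`_i != 0.
Proof.
move=> m3; have mm : 3 * m <= m ^+ 2 by rewrite expr2 ler_wpM2r //; lra.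
have [m0 m1 m2 m4] : [/\ 0 < m, 0 < m - 1, 0 < m - 2 & 0 < m + 1] by split; lra.
case: i => i lti /=; ord_cases i lti 12%N; rewrite /= ?oner_neq0 //; apply: lt0r_neq0.
all: try by rewrite !mulr_gt0 // invr_gt0; lra.
all: lra.
Qed.

Lemma Tbar_dims_neq0 n (i : 'I_12) : (3 <= n)%N -> (Tbar_dims n)`_i != 0.
Proof. by move=> n3; apply: dimension_formulas_neq0; rewrite ler_nat. Qed.

Lemma irreducible_line (R : realType) (T : vectType R) (g : {dot T for idfun}) (xi : T)
    (F : 'End(T)) (W : {vspace (tensor_space T)}) :
  \dim W = 1%N -> H_irreducible g xi F W.
Proof.
move=> W1; split=> [|W' sW _]; first by rewrite -dimv_eq0 W1.
have [W'0|W'n0] := eqVneq W' 0%VS; [by left | right; apply/eqP].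
by rewrite eqEdim sW W1 lt0n dimv_eq0.
Qed.

Section Irreducibility.

Variables (R : realType) (T : vectType R).
Variables (g : {dot T for idfun}) (xi : T) (F : 'End(T)).
Hypothesis hF : almost_contact_metric g xi F.
Local Notation V := (contact_space g xi).
Local Notation H := (structure_group g xi F).
Local Notation adapted := (adapted_basis g xi F).
Local Notation Tbar := (Tbar g xi F).
Local Notation group_operator := (group_operator g xi F).
Implicit Types (X Y Z U : T) (h : tensor_space T).

Variables (n : nat) (x y z : T) (E1 : seq T).
Hypothesis n3 : (3 <= n)%N.
Hypothesis dimT : \dim {:T} = n.*2.+1.
Local Notation E := [:: x, y, z & E1].
Hypothesis aE : adapted E.
Local Notation Fk := (Fk F).

Let e (i : 'I_n) : T := E`_i.
Let o0 : 'I_n := Ordinal (ltnW (ltnW n3)).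
Let o1 : 'I_n := Ordinal (ltnW n3).
Let o2 : 'I_n := Ordinal n3.
Let eV i : e i \in V := frame_V hF dimT aE i.
Let FkV c i : Fk c (e i) \in V := Fk_V hF c (eV i).
Let gee i : g (e i) (e i) = 1.
Proof. by rewrite (frame_g hF dimT aE) eqxx. Qed.

Let pull_flip (s : 'End(T)) (m : 'I_n) h c i j k :
    (forall c i, s (Fk c (e i)) = flip_sign R m i *: Fk c (e i)) ->
  ev h (s (e i)) (s (e j)) (s (Fk c (e k))) =
  flip_sign R m i * flip_sign R m j * flip_sign R m k * ev h (e i) (e j) (Fk c (e k)).
Proof.
move=> sE; have se l : s (e l) = flip_sign R m l *: e l by exact: (sE false).
by rewrite sE !se evZl evZm evZr; ring.
Qed.

Section OneSpace.

Variable W : {vspace (tensor_space T)}.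
Hypotheses (invW : H_invariant g xi F W) (W0 : W != 0%VS).

Section OneForm.

Variable th : tensor_space T -> T -> R.
Hypothesis th_linear : forall a h h' X, th (a *: h + h') X = a * th h X + th h' X.
Hypothesis th_scalar : forall h, scalar (th h).
Hypothesis th_pull : forall a h X, H a -> th (pull a h) X = th h (a X).
Hypothesis th_inj : forall h, h \in W -> {in V, forall X, th h X = 0} -> h = 0.

(** The operator 1 - s, with s = -1 on the complex line of x, keeps only the
    coordinates of th along that line. *)
Lemma irreducible_one_form : H_irreducible g xi F W.
Proof.
have thN h X : th h (- X) = - th h X := functionalN (th_scalar h) X.
have [s sH sE] := frame_flip hF dimT aE o0.
have th_flip c h i : th (anti_part s h) (Fk c (e i)) =
    (1 - flip_sign R 0 i) * th h (Fk c (e i)).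
  by rewrite th_linear th_pull // sE (functionalZ (th_scalar h)); ring.
pose phi D h := th h (nth 0 D 0%N).
apply: (irreducible_criterion hF dimT (phi := phi) (P := anti_part s) aE invW W0).
- by move=> D a h h'; exact: th_linear.
- by move=> a D h aH; rewrite /phi th_pull // nth_map0.
- by move=> h; rewrite /phi /= (FF hF (eV o0)) thN.
- move=> h hW h0; apply: th_inj => //.
  have unit X : X \in V -> g X X = 1 -> th h X = 0.
    move=> XV XX; have [||D aD] := unitary_frame_extend hF dimT (s := [:: X]).
    + by apply: (unitary_frame_cons hF) => //; exact: unitary_frame0.
    + by rewrite /= (leq_trans _ n3).
    + exact: (h0 _ aD).
  apply: (scalar_frame_eq0 dimT aE) => [|i]; first exact: th_scalar.
  have ee : g (e i) (e i) = 1 by rewrite (frame_g hF dimT aE) eqxx.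
  split; first exact: (unit _ (eV i) ee).
  by apply: (unit _ (FV hF _)); rewrite (gFF hF _ (eV i)).
- exact: group_operator_anti_part.
- move=> h hW hx hFx; apply: th_inj; first exact: (group_operator_anti_part sH).2.
  have th0 c i : th (anti_part s h) (Fk c (e i)) = 0.
    rewrite th_flip /flip_sign; case: (eqVneq (i : nat) 0%N) => [i0|_].
      suff -> : th h (Fk c (e i)) = 0 by rewrite mulr0.
      by rewrite /e i0; case: c.
    by rewrite subrr mul0r.
  apply: (scalar_frame_eq0 dimT aE) => [|i]; first exact: th_scalar.
  by split; [exact: (th0 false) | exact: (th0 true)].
- move=> h hW Ph0; have := th_flip false h o0; rewrite Ph0.
  have -> : th 0 (Fk false (e o0)) = 0.
    by have := th_linear (-1) 0 0 (Fk false (e o0)); rewrite scaler0 addr0; lra.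
  by rewrite /flip_sign eqxx /phi /e /=; lra.
Qed.

End OneForm.

Section BilinearForm.

Variable b : tensor_space T -> T -> T -> R.
Variables eps delta : R.
Hypothesis b_linear : forall a h h' X Y, b (a *: h + h') X Y = a * b h X Y + b h' X Y.
Hypothesis b_bilinear : forall h, bilinear_form (b h).
Hypothesis b_pull : forall a h X Y, H a -> b (pull a h) X Y = b h (a X) (a Y).
Hypothesis b_inj : forall h, h \in W -> {in V &, forall X Y, b h X Y = 0} -> h = 0.
Hypothesis delta2 : delta ^+ 2 = 1.
Hypothesis b_sym : forall h, h \in W -> {in V &, forall X Y, b h X Y = eps * b h Y X}.
Hypothesis b_F : forall h, h \in W ->
  {in V &, forall X Y, b h (F X) (F Y) = delta * b h X Y}.
Hypothesis b_trace : forall h, h \in W ->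
  delta = -1 \/ forall c, \sum_i b h (e i) (Fk c (e i)) = 0.

(** With s0 and s1 equal to -1 on the complex lines of x and y, the operator
    (1 - s0)(1 - s1) keeps only the coordinates of b with indices 0 and 1. A
    form that vanishes on all pairs from adapted bases is diagonal; its values
    on bisectors show that it is a combination of the metric and of the
    fundamental form, which b_trace excludes. *)
Lemma irreducible_bilinear_form : H_irreducible g xi F W.
Proof.
have bl h a X X' Y : b h (a *: X + X') Y = a * b h X Y + b h X' Y by apply (b_bilinear h).
have br h a X Y Y' : b h X (a *: Y + Y') = a * b h X Y + b h X Y' by apply (b_bilinear h).
have b0l h Y : b h 0 Y = 0 by have := bl h (-1) 0 0 Y; rewrite scaler0 addr0; lra.
have b0r h X : b h X 0 = 0 by have := br h (-1) X 0 0; rewrite scaler0 addr0; lra.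
have bZl h a X Y : b h (a *: X) Y = a * b h X Y.
  by have := bl h a X 0 Y; rewrite !addr0 b0l addr0.
have bZr h a X Y : b h X (a *: Y) = a * b h X Y.
  by have := br h a X Y 0; rewrite !addr0 b0r addr0.
have bNl h X Y : b h (- X) Y = - b h X Y by rewrite -scaleN1r bZl mulN1r.
have bNr h X Y : b h X (- Y) = - b h X Y by rewrite -scaleN1r bZr mulN1r.
have bFC h X Y : h \in W -> X \in V -> Y \in V -> b h (F X) Y = - delta * b h X (F Y).
  move=> hW XV YV; have := b_F hW XV (FV hF Y); rewrite (FF hF YV) bNr; lra.
have [s0 s0H s0E] := frame_flip hF dimT aE o0.
have [s1 s1H s1E] := frame_flip hF dimT aE o1.
pose P h := anti_part s0 (anti_part s1 h).
have opP : group_operator P by apply: group_operator_comp; exact: group_operator_anti_part.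
have b_flip s (m : 'I_n) h i j c :
    H s -> (forall c i, s (Fk c (e i)) = flip_sign R m i *: Fk c (e i)) ->
    b (anti_part s h) (e i) (Fk c (e j)) =
    (1 - flip_sign R m i * flip_sign R m j) * b h (e i) (Fk c (e j)).
  move=> sH sE; rewrite b_linear b_pull // sE -[s (e i)]/(s (Fk false (e i))) sE.
  by rewrite bZl bZr; ring.
have b_P h i j c : b (P h) (e i) (Fk c (e j)) =
    (1 - flip_sign R 0 i * flip_sign R 0 j) * (1 - flip_sign R 1 i * flip_sign R 1 j)
    * b h (e i) (Fk c (e j)).
  by rewrite (b_flip s0 o0) // (b_flip s1 o1) // mulrA.
pose phi D h := b h (nth 0 D 0%N) (nth 0 D 1%N).
apply: (irreducible_criterion hF dimT (phi := phi) (P := P) aE invW W0) => //.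
- by move=> D a h h'; exact: b_linear.
- by move=> a D h aH; rewrite /phi b_pull // !nth_map0.
- by move=> h; rewrite /phi /= (FF hF (eV o0)) bNl.
- move=> h hW h0.
  have pair0 X Y : X \in V -> Y \in V -> g X X = 1 -> g Y Y = 1 -> g X Y = 0 ->
      g X (F Y) = 0 -> b h X Y = 0.
    move=> XV YV XX YY XY XFY; have [|D aD] := frame_pair hF dimT XV YV XX YY XY XFY.
      exact: ltnW n3.
    exact: (h0 _ aD).
  have off c i j : i != j -> b h (e i) (Fk c (e j)) = 0.
    move=> ij; apply: pair0 => //; rewrite ?(Fk_g hF) //.
      by rewrite (frame_gFk hF dimT aE).
    by rewrite (frame_gFFk hF dimT aE).
  have offF d c i l : i != l -> b h (Fk d (e l)) (Fk c (e i)) = 0.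
    move=> il; have li : l != i by rewrite eq_sym.
    case: d; last exact: off.
    rewrite bFC //; case: c; rewrite /= ?(FF hF (eV i)) ?bNr.
      by have := off false l i li; rewrite /= => ->; rewrite oppr0 mulr0.
    by have := off true l i li; rewrite /= => ->; rewrite mulr0.
  have offFF d c i l : i != l -> b h (e i) (Fk c (Fk d (e l))) = 0.
    move=> il; case: d; case: c; rewrite /= ?(FF hF (eV l)) ?bNr.
    - by have := off false i l il; rewrite /= => ->; rewrite oppr0.
    - by have := off true i l il; rewrite /=.
    - by have := off true i l il; rewrite /=.
    - by have := off false i l il; rewrite /=.
  have diag d c i l : i != l ->
      b h (e i) (Fk c (e i)) = b h (Fk d (e l)) (Fk c (Fk d (e l))).
    move=> il; set U := Fk d (e l).
    have UV : U \in V := FkV d l.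
    have UU : g U U = 1 by rewrite /U (Fk_g hF) ?gee.
    have iU : g (e i) U = 0 by rewrite (frame_gFk hF dimT aE).
    have iFU : g (e i) (F U) = 0 by rewrite (frame_gFFk hF dimT aE).
    have bV d' : bisector d' (e i) U \in V by exact: (bisector_V d' (eV i) UV).
    have bg d' d'' := bisector_g d' d'' (gee i) UU iU.
    have bgF d' d'' := bisector_gF hF d' d'' UV iFU.
    have : b h (bisector 1 (e i) U) (Fk c (bisector (-1) (e i) U)) = 0.
      apply: pair0.
      + exact: bV.
      + exact: (Fk_V hF c (bV _)).
      + by rewrite bg; field.
      + by rewrite (Fk_g hF c _ (bV _)) bg; field.
      + by case: (c); rewrite /= ?bgF // bg; ring.
      + by case: (c); rewrite /= ?bgF // (FF hF (bV _)) gNr bg; ring.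
    have cl := Fk_linear F c; rewrite /bisector -[(Num.sqrt 2)^-1 *: (-1 *: _ + _)]addr0 cl cl.
    have -> : Fk c 0 = 0 by case: (c); rewrite //= linear0.
    rewrite addr0 bZl bZr mulrA sqr_rsqrt2 bl !br offF // offFF //.
    have n2 : (2^-1 : R) != 0 by rewrite invr_neq0 ?pnatr_eq0.
    by move/eqP; rewrite mulf_eq0 (negPf n2) /= => /eqP; lra.
  have diag1 c i l : b h (e i) (Fk c (e i)) = b h (e l) (Fk c (e l)).
    by have [->|il] := eqVneq i l => //; exact: (diag false).
  have diag0 c i : b h (e i) (Fk c (e i)) = 0.
    have [l il] : exists l, i != l.
      by have [->|i0] := eqVneq i o0; [exists o1 | exists o0].
    have [d1|/(_ c)] := b_trace hW.
      have := diag true c i l il; rewrite (diag1 c i l) /=.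
      have -> : Fk c (F (e l)) = F (Fk c (e l)) by case: (c).
      by rewrite b_F // d1; lra.
    rewrite (eq_bigr (fun=> b h (e i) (Fk c (e i)))) => [|j _]; last exact: diag1.
    rewrite sumr_const card_ord => /eqP; rewrite mulrn_eq0 => /orP[/eqP n0|/eqP //].
    by move: n3; rewrite n0.
  apply: b_inj => //; apply: (bilinear_eq0 hF dimT aE (b_bilinear h) (b_F hW)) => c i j.
  by have [->|ij] := eqVneq i j; [exact: diag0 | exact: off].
- move=> h hW hxy hFxy; have PW : P h \in W by exact: opP.2.
  have hxFy : b h x (F y) = 0.
    have := hFxy; rewrite /phi /= (bFC h x y hW (eV o0) (eV o1)) => /eqP.
    rewrite mulf_eq0 oppr_eq0 => /orP[/eqP d0|/eqP //].
    by move: delta2; rewrite d0 expr0n => /eqP; rewrite eq_sym oner_eq0.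
  apply: b_inj => //; apply: (bilinear_eq0 hF dimT aE (b_bilinear _) (b_F PW)) => c i j.
  rewrite -/(Fk c _) b_P /flip_sign /e.
  case: (i : nat) => [|[|i']]; case: (j : nat) => [|[|j']] /=; try by ring.
  + suff -> : b h x (Fk c y) = 0 by rewrite mulr0.
    by case: c.
  + suff -> : b h y (Fk c x) = 0 by rewrite mulr0.
    rewrite (b_sym hW (eV o1) (FkV c o0)); case: c; first by rewrite [b h _ _]hFxy mulr0.
    by rewrite [b h _ _]hxy mulr0.
- move=> h hW Ph0; have := b_P h o0 o1 false; rewrite Ph0 /flip_sign /=.
  have -> : b 0 x y = 0.
    by have := b_linear (-1) 0 0 x y; rewrite scaler0 addr0; lra.
  by rewrite /phi /=; lra.
Qed.

End BilinearForm.

(** * Irreducibility: trilinear forms *)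

Section TrilinearForm.

Variable delta : R.
Hypothesis WB : forall h, h \in W -> Tbar h.
Hypothesis WC : forall h, h \in W -> concentrated_VVV g xi h.
Hypothesis WF : forall h, h \in W -> F_type g xi F delta h.

Let coords_eq0 h : h \in W ->
  (forall c i j k, ev h (e i) (e j) (Fk c (e k)) = 0) -> h = 0.
Proof. move=> hW; exact: (VVV_eq0 hF dimT aE (WB hW) (WC hW) (WF hW)). Qed.

Let skew h c i j k : h \in W ->
  ev h (e i) (e j) (Fk c (e k)) = - ev h (e i) (e k) (Fk c (e j)).
Proof. by move=> hW; exact: (Tbar_skew_Fk hF (WB hW)). Qed.

Let skew_xx h c i j : h \in W -> ev h (e i) (e j) (Fk c (e j)) = 0.
Proof. by move=> hW; apply: opp_eq0; exact: skew. Qed.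

Let Fg c i j : i != j -> g (e i) (Fk c (e j)) = 0.
Proof. exact: (frame_gFk hF dimT aE). Qed.

Let FFg c i j : i != j -> g (e i) (F (Fk c (e j))) = 0.
Proof. exact: (frame_gFFk hF dimT aE). Qed.

Let FkU c i : g (Fk c (e i)) (Fk c (e i)) = 1.
Proof. by rewrite (Fk_g hF). Qed.

Let bisV d i j : bisector d (e i) (e j) \in V.
Proof. exact: bisector_V. Qed.

Let bis_orth d i j U : g (e i) U = 0 -> g (e j) U = 0 -> g (bisector d (e i) (e j)) U = 0.
Proof. by move=> iU jU; rewrite /bisector gZl gPl iU jU; ring. Qed.

Let bis_unit d i j : i != j -> d ^+ 2 = 1 ->
  g (bisector d (e i) (e j)) (bisector d (e i) (e j)) = 1.
Proof.
move=> ij d2; rewrite bisector_g //; last exact: (Fg false ij).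
by rewrite -expr2 d2; field.
Qed.

Let ev_bis h d d' i j Z :
  ev h (bisector d (e i) (e j)) (bisector d' (e i) (e j)) Z =
  2^-1 * (ev h (e i) (e i) Z + d' * ev h (e i) (e j) Z + d * ev h (e j) (e i) Z
          + d * d' * ev h (e j) (e j) Z).
Proof.
rewrite /bisector evZl evZm mulrA sqr_rsqrt2 !evPl !evPm; ring.
Qed.

Let phi123 D h := ev h (nth 0 D 0%N) (nth 0 D 1%N) (nth 0 D 2%N).
Let phi221 D h := ev h (nth 0 D 1%N) (nth 0 D 1%N) (nth 0 D 0%N).

Let triple_eq0 h : (forall D, adapted D -> phi123 D h = 0) ->
  forall X Y Z, X \in V -> Y \in V -> Z \in V ->
    g X X = 1 -> g Y Y = 1 -> g Z Z = 1 ->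
    g X Y = 0 -> g X (F Y) = 0 -> g X Z = 0 -> g X (F Z) = 0 -> g Y Z = 0 -> g Y (F Z) = 0 ->
  ev h X Y Z = 0.
Proof.
move=> h0 X Y Z XV YV ZV XX YY ZZ XY XFY XZ XFZ YZ YFZ.
have [D aD] := frame_triple hF dimT XV YV ZV XX YY ZZ XY XFY XZ XFZ YZ YFZ n3.
exact: (h0 _ aD).
Qed.

Let distinct_eq0 h : (forall D, adapted D -> phi123 D h = 0) ->
  forall c i j k, i != j -> i != k -> j != k -> ev h (e i) (e j) (Fk c (e k)) = 0.
Proof.
move=> h0 c i j k ij ik jk; apply: (triple_eq0 h0) => //; rewrite ?Fg ?FFg //.
  exact: (Fg false ij).
exact: (FFg false ij).
Qed.

Let phi123_Fk h c : h \in W -> delta ^+ 2 = 1 -> phi123 E h = 0 ->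
  phi123 (F x :: [:: y, z & E1]) h = 0 -> ev h x y (Fk c z) = 0.
Proof.
move=> hW d2 h0 hF0; case: c; last exact: h0.
have := hF0; rewrite /phi123 /=.
rewrite (F_type_FC hF (WF hW) (eV o0) (eV o1) (eV o2)).
rewrite (Tbar_FC hF (WB hW) x (eV o1) (eV o2)) => /eqP.
rewrite mulf_eq0 oppr_eq0 => /orP[/eqP d0|/eqP //].
by move: d2; rewrite d0 expr0n => /eqP; rewrite eq_sym oner_eq0.
Qed.

Let coef (i j k m : nat) : R := 1 - flip_sign R m i * flip_sign R m j * flip_sign R m k.

Let ev_anti (s : 'End(T)) (m : 'I_n) h c i j k :
    (forall c i, s (Fk c (e i)) = flip_sign R m i *: Fk c (e i)) ->
  ev (anti_part s h) (e i) (e j) (Fk c (e k)) = coef i j k m * ev h (e i) (e j) (Fk c (e k)).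
Proof. by move=> sE; rewrite ev_anti_part (pull_flip _ _ _ _ _ sE) /coef; ring. Qed.

Section Alternating.

Hypothesis delta_alt : delta = -1.
Hypothesis alt : forall h, h \in W ->
  {in V & V & V, forall X Y Z, ev h X Y Z = - ev h Y X Z}.

(** The product of the 1 - s over the first three basis vectors keeps only the
    coordinates whose indices are a permutation of 0, 1, 2. *)
Lemma irreducible_alternating : H_irreducible g xi F W.
Proof.
have [s0 s0H s0E] := frame_flip hF dimT aE o0.
have [s1 s1H s1E] := frame_flip hF dimT aE o1.
have [s2 s2H s2E] := frame_flip hF dimT aE o2.
pose P h := anti_part s0 (anti_part s1 (anti_part s2 h)).
have opP : group_operator P by do 2!(apply: group_operator_comp; first exact: group_operator_anti_part); exact: group_operator_anti_part.
have PE h c i j k : ev (P h) (e i) (e j) (Fk c (e k)) =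
    coef i j k 0 * coef i j k 1 * coef i j k 2 * ev h (e i) (e j) (Fk c (e k)).
  by rewrite (ev_anti _ _ _ _ _ s0E) (ev_anti _ _ _ _ _ s1E) (ev_anti _ _ _ _ _ s2E) /= !mulrA.
have d2 : delta ^+ 2 = 1 by rewrite delta_alt sqrrN expr1n.
have swap h c i j k : h \in W ->
    ev h (e i) (e j) (Fk c (e k)) = - ev h (e j) (e i) (Fk c (e k)).
  by move=> hW; exact: alt.
apply: (irreducible_criterion hF dimT (phi := phi123) (P := P) aE invW W0) => //.
- by move=> D a h h'; exact: ev_linear.
- by move=> a D h aH; rewrite /phi123 pullE !nth_map0.
- by move=> h; rewrite /phi123 /= (FF hF (eV o0)) evNl.
- move=> h hW h0; apply: coords_eq0 => // c i j k.
  have [->|ij] := eqVneq i j; first by apply: opp_eq0; exact: swap.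
  have [->|jk] := eqVneq j k; first exact: skew_xx.
  have [->|ik] := eqVneq i k; first by rewrite swap // skew_xx // oppr0.
  exact: distinct_eq0.
- move=> h hW h0 hF0; have PW : P h \in W by exact: opP.2.
  have h012 c : ev h x y (Fk c z) = 0 by exact: phi123_Fk.
  have h102 c : ev h y x (Fk c z) = 0.
    by have := swap h c o1 o0 o2 hW; rewrite [in RHS]/e /= h012 oppr0.
  have h021 c : ev h x z (Fk c y) = 0.
    by have := skew c o0 o2 o1 hW; rewrite [in RHS]/e /= h012 oppr0.
  have h201 c : ev h z x (Fk c y) = 0.
    by have := swap h c o2 o0 o1 hW; rewrite [in RHS]/e /= h021 oppr0.
  have h120 c : ev h y z (Fk c x) = 0.
    by have := skew c o1 o2 o0 hW; rewrite [in RHS]/e /= h102 oppr0.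
  have h210 c : ev h z y (Fk c x) = 0.
    by have := skew c o2 o1 o0 hW; rewrite [in RHS]/e /= h201 oppr0.
  apply: coords_eq0 => // c i j k; rewrite PE /coef /flip_sign /e.
  case: (i : nat) => [|[|[|i']]]; case: (j : nat) => [|[|[|j']]];
    case: (k : nat) => [|[|[|k']]] /=; rewrite ?h012 ?h102 ?h021 ?h201 ?h120 ?h210; ring.
- move=> h hW Ph0; have := PE h false o0 o1 o2; rewrite Ph0 ev0 /coef /flip_sign /=.
  by rewrite /phi123 /e /=; lra.
Qed.

End Alternating.

Section TraceFree.

Hypothesis delta1 : delta = 1.
Hypothesis trace0 : forall h, h \in W -> {in V, forall Z, beta F E h Z = 0}.

(** Up to skew symmetry there are three coordinates with indices 0, 1, 2. Let
    a act as F on V, times a further F on the complex line of x. It multiplies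
    h(e_0, e_1, e_2) by 1 and the two coordinates in which e_0 is not the first
    argument by -1, so the factor 1 + a isolates the former. If h vanishes on
    all triples from adapted bases, bisectors show that h(e_i, e_i, Z) depends
    on Z only, for Z orthogonal to the complex line of e_i; then it is a
    multiple of beta(Z). *)
Lemma irreducible_trace_free : H_irreducible g xi F W.
Proof.
have [s0 s0H s0E] := frame_flip hF dimT aE o0.
have [s1 s1H s1E] := frame_flip hF dimT aE o1.
have [s2 s2H s2E] := frame_flip hF dimT aE o2.
have [J JH JE] := frame_J hF dimT aE o0.
have [I IH IE] := complex_unit hF.
have JeE i : J (e i) = if i == o0 then F (e i) else e i by exact: (JE false).
pose Q h := 1 *: pull (I \o J)%VF h + h.
have QE h X Y Z : ev (Q h) X Y Z = ev h (I (J X)) (I (J Y)) (I (J Z)) + ev h X Y Z.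
  by rewrite ev_linear pullE mul1r !comp_lfunE.
have IJH : H (I \o J)%VF.
  split=> [X Y||].
  - have gIJ : g ((I \o J)%VF X) ((I \o J)%VF Y) = g X Y.
      by rewrite !comp_lfunE (H_g IH) (H_g JH).
    exact: gIJ.
  - by rewrite comp_lfunE (H_xi JH) (H_xi IH).
  - by apply/lfunP => X; rewrite !comp_lfunE (H_F JH) (H_F IH).
pose P h := anti_part s0 (anti_part s1 (anti_part s2 (Q h))).
have opP : group_operator P.
  do 3!(apply: group_operator_comp; first exact: group_operator_anti_part).
  exact: group_operator_pull.
have PE h c i j k : ev (P h) (e i) (e j) (Fk c (e k)) =
    coef i j k 0 * coef i j k 1 * coef i j k 2 * ev (Q h) (e i) (e j) (Fk c (e k)).
  by rewrite (ev_anti _ _ _ _ _ s0E) (ev_anti _ _ _ _ _ s1E) (ev_anti _ _ _ _ _ s2E) /= !mulrA.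
have d2 : delta ^+ 2 = 1 by rewrite delta1 expr1n.
have IJ0 c : I (J (Fk c x)) = - Fk c x.
  rewrite (H_Fk c _ JH) (H_Fk c _ IH) [J x](JeE o0) IE ?(FF hF (eV o0)); last exact: FV.
  by case: c; rewrite //= linearN.
have IJ1 c i : i != o0 -> I (J (Fk c (e i))) = F (Fk c (e i)).
  move=> /negPf i0; rewrite (H_Fk c _ JH) JeE i0 (H_Fk c _ IH) IE //.
  by case: c.
have o10 : o1 != o0 by [].
have o20 : o2 != o0 by [].
have Q012 h c : h \in W -> ev (Q h) x y (Fk c z) = 2 * ev h x y (Fk c z).
  move=> hW; rewrite QE (IJ0 false) (IJ1 false o1) // (IJ1 c o2) // evNl.
  by rewrite (Tbar_FF (WB hW)) ?(eV o1) ?(FkV c o2) //; ring.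
have Qfst h c (i j : 'I_n) : h \in W -> i != o0 -> j != o0 ->
    ev (Q h) (e i) x (Fk c (e j)) = 0.
  move=> hW i0 j0; rewrite QE (IJ0 false) (IJ1 false i) // (IJ1 c j) // evNm.
  rewrite -(Tbar_FC hF (WB hW) _ (eV o0) (FkV c j)) (WF hW) ?(eV o0) // delta1.
  by rewrite mul1r addNr.
apply: (irreducible_criterion hF dimT (phi := phi123) (P := P) aE invW W0) => //.
- by move=> D a h h'; exact: ev_linear.
- by move=> a D h aH; rewrite /phi123 pullE !nth_map0.
- by move=> h; rewrite /phi123 /= (FF hF (eV o0)) evNl.
- move=> h hW h0.
  have iik c i k : i != k -> ev h (e i) (e i) (Fk c (e k)) = 0.
    move=> ik.
    have iil l : l != k -> ev h (e l) (e l) (Fk c (e k)) = ev h (e i) (e i) (Fk c (e k)).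
      move=> lk; have [->//|li] := eqVneq l i.
      have lV : g (e l) (e i) = 0 by exact: (Fg false li).
      have lFV : g (e l) (F (e i)) = 0 by exact: (FFg false li).
      have sq1 : (-1) ^+ 2 = 1 :> R by rewrite sqrrN expr1n.
      have : ev h (bisector 1 (e l) (e i)) (bisector (-1) (e l) (e i)) (Fk c (e k)) = 0.
        apply: (triple_eq0 h0) => //.
        + by rewrite bis_unit ?expr1n.
        + by rewrite bis_unit.
        + by rewrite bisector_g // mulrN1 subrr mulr0.
        + exact: (bisector_gF hF).
        + by apply: bis_orth; exact: Fg.
        + by apply: bis_orth; exact: FFg.
        + by apply: bis_orth; exact: Fg.
        + by apply: bis_orth; exact: FFg.
      have il : i != l by rewrite eq_sym.
      rewrite ev_bis (distinct_eq0 h0 c li lk ik) (distinct_eq0 h0 c il ik lk).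
      by lra.
    have := trace0 hW (FkV c k); rewrite /beta (big_nth 0) big_mkord.
    rewrite (adapted_size dimT aE).
    rewrite (bigD1 k) //= (eq_bigr (fun=> 2 * ev h (e i) (e i) (Fk c (e k)))); last first.
      move=> l lk; rewrite -/(e l) -!/(ev _ _ _ _) (WF hW) // delta1 iil //; ring.
    rewrite -/(e k) -!/(ev _ _ _ _) (WF hW) // delta1 skew_xx // mul1r addr0 add0r.
    rewrite sumr_const => /eqP; rewrite mulrn_eq0 mulf_eq0 pnatr_eq0 /=.
    case/orP=> [/eqP/card0_eq/(_ i)|/eqP //].
    by rewrite unfold_in /= ik.
  apply: coords_eq0 => // c i j k.
  have [->|jk] := eqVneq j k; first exact: skew_xx.
  have [->|ij] := eqVneq i j; first exact: iik.
  have [->|ik] := eqVneq i k; first by rewrite skew // iik ?oppr0 // eq_sym.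
  exact: distinct_eq0.
- move=> h hW h0 hF0; have PW : P h \in W by exact: opP.2.
  have QW : Q h \in W by exact: (group_operator_pull 1 IJH).2.
  have h012 c : ev (Q h) x y (Fk c z) = 0 by rewrite Q012 // phi123_Fk // mulr0.
  have h102 c : ev (Q h) y x (Fk c z) = 0 by exact: (Qfst h c o1 o2).
  have h201 c : ev (Q h) z x (Fk c y) = 0 by exact: (Qfst h c o2 o1).
  have h021 c : ev (Q h) x z (Fk c y) = 0.
    by have := skew c o0 o2 o1 QW; rewrite [in RHS]/e /= h012 oppr0.
  have h120 c : ev (Q h) y z (Fk c x) = 0.
    by have := skew c o1 o2 o0 QW; rewrite [in RHS]/e /= h102 oppr0.
  have h210 c : ev (Q h) z y (Fk c x) = 0.
    by have := skew c o2 o1 o0 QW; rewrite [in RHS]/e /= h201 oppr0.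
  apply: coords_eq0 => // c i j k; rewrite PE /coef /flip_sign /e.
  case: (i : nat) => [|[|[|i']]]; case: (j : nat) => [|[|[|j']]];
    case: (k : nat) => [|[|[|k']]] /=; rewrite ?h012 ?h102 ?h021 ?h201 ?h120 ?h210; ring.
- move=> h hW Ph0; have := PE h false o0 o1 o2; rewrite Ph0 ev0 (Q012 h false hW).
  by rewrite /coef /flip_sign /= /phi123 /e /=; lra.
Qed.

End TraceFree.

Section Cyclic.

Hypothesis delta_cyc : delta = -1.
Hypothesis cyclic : forall h, h \in W ->
  {in V & V & V, forall X Y Z, ev h X Y Z + ev h Y Z X + ev h Z X Y = 0}.

(** The coordinates with three distinct indices are not determined by one of
    them, so phi uses the indices 1, 1, 0. In P, the factor of s0 keeps the
    coordinates with an odd number of indices 0, that of s1 those with an even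
    number of indices 1, and 1 - J, where J is the rotation by F on the complex
    line of y, kills those without index 1. If phi vanishes on all adapted
    bases then polarization makes h alternating in the first two arguments,
    and an alternating tensor of vanishing cyclic sum is zero. *)
Lemma irreducible_cyclic : H_irreducible g xi F W.
Proof.
have [s0 s0H s0E] := frame_flip hF dimT aE o0.
have [s1 s1H s1E] := frame_flip hF dimT aE o1.
have [J JH JE] := frame_J hF dimT aE o1.
have JeE i : J (e i) = if i == o1 then F (e i) else e i by exact: (JE false).
pose S h := 1 *: pull s1 h + h.
pose P h := anti_part s0 (S (anti_part J h)).
have opP : group_operator P.
  apply: group_operator_comp; first exact: group_operator_anti_part.
  by apply: group_operator_comp; [exact: group_operator_pull | exact: group_operator_anti_part].
have PE h c i j k : ev (P h) (e i) (e j) (Fk c (e k)) =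
    coef i j k 0 * (2 - coef i j k 1) * ev (anti_part J h) (e i) (e j) (Fk c (e k)).
  have e1 h' : ev (S h') (e i) (e j) (Fk c (e k)) =
      (2 - coef i j k 1) * ev h' (e i) (e j) (Fk c (e k)).
    by rewrite ev_linear pullE (pull_flip _ _ _ _ _ s1E) /coef /=; ring.
  by rewrite (ev_anti _ _ _ _ _ s0E) e1 mulrA.
have Jfix c i : i != o1 -> J (Fk c (e i)) = Fk c (e i).
  by move=> /negPf i1; rewrite (H_Fk c _ JH) JeE i1.
have J1 c : J (Fk c y) = F (Fk c y).
  by rewrite (H_Fk c _ JH) [J y](JeE o1); case: c.
have o01 : o0 != o1 by [].
have Jid h c (i j k : 'I_n) : i != o1 -> j != o1 -> k != o1 ->
    ev (anti_part J h) (e i) (e j) (Fk c (e k)) = 0.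
  by move=> i1 j1 k1; rewrite ev_anti_part (Jfix false i) // (Jfix false j) // Jfix // subrr.
have J110 h c : h \in W -> ev (anti_part J h) y y (Fk c x) = 2 * ev h y y (Fk c x).
  move=> hW; rewrite ev_anti_part (J1 false) (Jfix c o0) // (WF hW) ?(eV o1) ?(FkV c o0) //.
  by rewrite delta_cyc; ring.
have cyc h c X Y Z : h \in W -> X \in V -> Y \in V -> Z \in V ->
    ev h X Y (Fk c Z) + ev h Y Z (Fk c X) + ev h Z X (Fk c Y) = 0.
  move=> hW XV YV ZV; case: c; last exact: cyclic.
  rewrite /= -[X in _ + X + _](Tbar_FC hF (WB hW)) // -[X in _ + X](Tbar_FC hF (WB hW)) //.
  have := cyclic hW XV YV (FV hF Z).
  by rewrite (F_type_FC hF (WF hW)) // delta_cyc opprK mul1r.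
apply: (irreducible_criterion hF dimT (phi := phi221) (P := P) aE invW W0) => //.
- by move=> D a h h'; exact: ev_linear.
- by move=> a D h aH; rewrite /phi221 pullE !nth_map0.
- by move=> h; rewrite /phi221 /= (FF hF (eV o0)) evNr.
- move=> h hW h0.
  have pair0 X Y : X \in V -> Y \in V -> g X X = 1 -> g Y Y = 1 -> g X Y = 0 ->
      g X (F Y) = 0 -> ev h X X Y = 0.
    move=> XV YV XX YY XY XFY; have YX : g Y X = 0 by rewrite gC.
    have YFX : g Y (F X) = 0 by rewrite gC (gFl hF) XFY oppr0.
    have [|D aD] := frame_pair hF dimT YV XV YY XX YX YFX; first exact: ltnW n3.
    exact: (h0 _ aD).
  have iik c i k : i != k -> ev h (e i) (e i) (Fk c (e k)) = 0.
    by move=> ik; apply: pair0; rewrite ?Fg ?FFg.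
  have swap c i j k : i != j -> i != k -> j != k ->
      ev h (e i) (e j) (Fk c (e k)) = - ev h (e j) (e i) (Fk c (e k)).
    move=> ij ik jk.
    have : ev h (bisector 1 (e i) (e j)) (bisector 1 (e i) (e j)) (Fk c (e k)) = 0.
      apply: pair0 => //.
      + by rewrite bis_unit ?expr1n.
      + by apply: bis_orth; exact: Fg.
      + by apply: bis_orth; exact: FFg.
    by rewrite ev_bis !iik //; lra.
  apply: coords_eq0 => // c i j k.
  have [->|jk] := eqVneq j k; first exact: skew_xx.
  have [->|ij] := eqVneq i j; first exact: iik.
  have [->|ik] := eqVneq i k; first by rewrite skew // iik ?oppr0 // eq_sym.
  have := cyc h c _ _ _ hW (eV i) (eV j) (eV k).
  have [ji ki kj] : [/\ j != i, k != i & k != j] by rewrite ![_ == i]eq_sym [k == j]eq_sym.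
  rewrite (skew c j k i hW) (swap c j i k ji jk ik) (swap c k i j ki kj ij).
  by rewrite (skew c i k j hW); lra.
- move=> h hW h0 hF0; have PW : P h \in W by exact: opP.2.
  have JW : anti_part J h \in W by exact: (group_operator_anti_part JH).2.
  have h110 c : ev (anti_part J h) y y (Fk c x) = 0.
    by rewrite J110 //; case: c; rewrite [ev _ _ _ _](h0, hF0) mulr0.
  have h101 c : ev (anti_part J h) y x (Fk c y) = 0.
    by have := skew c o1 o0 o1 JW; rewrite [in RHS]/e /= h110 oppr0.
  have h011 c : ev (anti_part J h) x y (Fk c y) = 0 by exact: (skew_xx c o0 o1 JW).
  apply: coords_eq0 => // c i j k; rewrite PE.
  have Jid' a b d : (a < n)%N -> (b < n)%N -> (d < n)%N -> a != 1%N -> b != 1%N -> d != 1%N ->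
      ev (anti_part J h) E`_a E`_b (Fk c E`_d) = 0.
    by move=> an bn dn a1 b1 d1; exact: (Jid h c (Ordinal an) (Ordinal bn) (Ordinal dn)).
  case: i j k => [i ltin] [j ltjn] [k ltkn]; rewrite /coef /flip_sign /e /=.
  case: i ltin => [|[|i]] ltin; case: j ltjn => [|[|j]] ltjn; case: k ltkn => [|[|k]] ltkn /=;
    rewrite ?h110 ?h101 ?h011; first [by rewrite (Jid' _ _ _ ltin ltjn ltkn) // mulr0 | ring].
- move=> h hW Ph0; have := PE h false o1 o1 o0; rewrite Ph0 ev0 (J110 h false hW).
  by rewrite /coef /flip_sign /= /phi221 /e /=; lra.
Qed.

End Cyclic.

End TrilinearForm.

End OneSpace.

(** * Irreducibility of the twelve components *)

Local Notation comp i := (Tbar_component g xi F n E i).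
Local Notation "# k" := (@Ordinal 12 k isT) (at level 8, format "# k").

Let frame_sum (f : T -> R) : \sum_(X <- E) f X = \sum_(i < n) f (e i).
Proof. by rewrite (big_nth 0) big_mkord (adapted_size dimT aE). Qed.

Section VVxi.

Variables (W : {vspace (tensor_space T)}) (i : 'I_12) (eps delta : R).
Hypotheses (invW : H_invariant g xi F W) (W0 : W != 0%VS).
Hypothesis i4 : (4 <= i < 10)%N.
Hypothesis hW : forall h, h \in W -> comp i h.
Hypothesis delta2 : delta ^+ 2 = 1.
Hypothesis types : forall h, h \in W -> xi_sym g xi eps h /\ xi_F_type g xi F delta h.
Hypothesis traces : forall h, h \in W ->
  delta = -1 \/ forall c, \sum_i ev h (e i) (Fk c (e i)) xi = 0.

Lemma irreducible_VVxi : H_irreducible g xi F W.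
Proof.
apply: (irreducible_bilinear_form invW W0
  (b := fun h X Y => ev h X Y xi) (eps := eps) (delta := delta)) => //.
- by move=> a h h' X Y; exact: ev_linear.
- by move=> h; split=> *; rewrite (evPl, evPm).
- by move=> a h X Y aH; rewrite pullE (H_xi aH).
- by move=> h /hW ch; apply: (VVxi_eq0 hF (proj1 ch)); exact: component_VVxi i4 ch.
- by move=> h hw; exact: (types hw).1.
- by move=> h hw; exact: (types hw).2.
Qed.

End VVxi.

Variable W : 'I_12 -> {vspace (tensor_space T)}.
Hypothesis hW : forall i h, h \in W i <-> comp i h.
Hypothesis W0 : forall i, W i != 0%VS.
Hypotheses (dim6 : \dim (W #6) = 1%N) (dim9 : \dim (W #9) = 1%N).

Lemma component_invariant i : H_invariant g xi F (W i).
Proof.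
apply/H_invariantP => a h aH /hW ch; apply/hW.
exact: pull_component aH _ _ ch.
Qed.

Let WB i h : h \in W i -> Tbar h.
Proof. by move/hW; case. Qed.

Let WC (i : 'I_12) h : (i < 4)%N -> h \in W i -> concentrated_VVV g xi h.
Proof. by move=> i4 /hW; exact: component_VVV. Qed.

Let sq1 : (1 : R) ^+ 2 = 1. Proof. exact: expr1n. Qed.
Let sqN1 : (-1 : R) ^+ 2 = 1. Proof. by rewrite sqrrN expr1n. Qed.

Lemma irreducible_T1 : H_irreducible g xi F (W #0).
Proof.
have t1 h : h \in (W #0) -> T1 g xi h by move/hW; case.
apply: (irreducible_alternating (@component_invariant #0) (W0 #0) (delta := -1)) => //.
- exact: WB.
- by move=> h; exact: WC.
- by move=> h hw; exact: (T1_F_type hF (WB hw) (t1 _ hw)).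
- by move=> h /t1[].
Qed.

Lemma irreducible_T2 : H_irreducible g xi F (W #1).
Proof.
have t2 h : h \in (W #1) -> T2 g xi h by move/hW; case.
apply: (irreducible_cyclic (@component_invariant #1) (W0 #1) (delta := -1)) => //.
- exact: WB.
- by move=> h; exact: WC.
- by move=> h hw; exact: (T2_F_type hF (WB hw) (t2 _ hw)).
- by move=> h /t2[].
Qed.

Lemma irreducible_T3 : H_irreducible g xi F (W #2).
Proof.
have t3 h : h \in (W #2) -> T3 g xi F E h by move/hW; case.
apply: (irreducible_trace_free (@component_invariant #2) (W0 #2) (delta := 1)) => //.
- exact: WB.
- by move=> h; exact: WC.
- by move=> h hw; exact: (T3_F_type (t3 _ hw)).
- by move=> h /t3[].
Qed.

Lemma irreducible_T4 : H_irreducible g xi F (W #3).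
Proof.
apply: (irreducible_one_form (@component_invariant #3) (W0 #3) (th := beta F E)).
- by move=> *; exact: beta_linear.
- by move=> h a X Y; exact: beta_lin.
- by move=> a h X aH; exact: (beta_pull dimT aE aH).
- by move=> h /hW[Bh t4]; exact: (T4_eq0 hF Bh t4).
Qed.

Lemma irreducible_T5 : H_irreducible g xi F (W #4).
Proof.
have t5 h : h \in (W #4) -> T5 g xi F E h by move/hW; case.
apply: (irreducible_VVxi (i := #4) (eps := -1) (delta := 1) (@component_invariant #4) (W0 #4)) => //.
- by move=> h /hW.
- by move=> h /t5/T5_types.
move=> h hw; right; have [s f b _] := t5 _ hw; case=> /=; last first.
  by apply: big1 => i _; apply: opp_eq0; exact: s.
move: b; rewrite /beta_bar frame_sum (eq_bigr (fun i => 2 * ev h (e i) (F (e i)) xi)).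
  by rewrite -mulr_sumr => /eqP; rewrite mulf_eq0 pnatr_eq0 => /eqP.
by move=> i _; rewrite [h (F _) _ _]s ?(FV hF) // /ev; ring.
Qed.

Lemma irreducible_T6 : H_irreducible g xi F (W #5).
Proof.
apply: (irreducible_VVxi (i := #5) (eps := -1) (delta := -1) (@component_invariant #5) (W0 #5)) => //.
- by move=> h /hW.
- by move=> h /hW[_] /T6_types.
- by left.
Qed.

Lemma irreducible_T8 : H_irreducible g xi F (W #7).
Proof.
have t8 h : h \in (W #7) -> T8 g xi F E h by move/hW; case.
apply: (irreducible_VVxi (i := #7) (eps := 1) (delta := 1) (@component_invariant #7) (W0 #7)) => //.
- by move=> h /hW.
- by move=> h /t8/T8_types.
move=> h hw; right; have [s f b _] := t8 _ hw; case=> /=.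
  apply: big1 => i _; have := f _ _ (eV i) (FV hF (e i)).
  have := s _ _ (eV i) (FV hF (e i)); rewrite -!/(ev _ _ _ _) (FF hF (eV i)) evNm /=.
  by lra.
move: b; rewrite /beta frame_sum (eq_bigr (fun i => 2 * ev h (e i) (e i) xi)).
  by rewrite -mulr_sumr => /eqP; rewrite mulf_eq0 pnatr_eq0 => /eqP.
by move=> i _; rewrite f // /ev; ring.
Qed.

Lemma irreducible_T9 : H_irreducible g xi F (W #8).
Proof.
apply: (irreducible_VVxi (i := #8) (eps := 1) (delta := -1) (@component_invariant #8) (W0 #8)) => //.
- by move=> h /hW.
- by move=> h /hW[_] /T9_types.
- by left.
Qed.

Lemma irreducible_T11 : H_irreducible g xi F (W #10).
Proof.
apply: (irreducible_one_form (@component_invariant #10) (W0 #10) (th := fun h X => ev h xi X xi)).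
- by move=> *; exact: ev_linear.
- by move=> h; exact: ev_scalar2.
- by move=> a h X aH; rewrite pullE (H_xi aH).
- by move=> h /hW[Bh t11]; exact: (T11_eq0 hF Bh t11).
Qed.

Lemma irreducible_T12 : H_irreducible g xi F (W #11).
Proof.
apply: (irreducible_bilinear_form (@component_invariant #11) (W0 #11)
  (b := fun h X Y => ev h xi X Y) (eps := -1) (delta := -1)) => //.
- by move=> a h h' X Y; exact: ev_linear.
- by move=> h; split=> *; rewrite (evPm, evPr).
- by move=> a h X Y aH; rewrite pullE (H_xi aH).
- by move=> h /hW[Bh t12]; exact: (T12_eq0 hF Bh t12).
- by move=> h hw X Y XV YV; rewrite mulN1r (Tbar_skew (WB hw)).
- by move=> h hw X Y XV YV; rewrite mulN1r (Tbar_FF (WB hw)).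
- by left.
Qed.

Lemma component_irreducible i : H_irreducible g xi F (W i).
Proof.
case: i => i lti; have ltE (j : 'I_12) : i = j :> nat -> W (Ordinal lti) = W j.
  by move=> ij; congr W; exact: val_inj.
nat_cases i 12%N => //.
- by rewrite (ltE #0) //; exact: irreducible_T1.
- by rewrite (ltE #1) //; exact: irreducible_T2.
- by rewrite (ltE #2) //; exact: irreducible_T3.
- by rewrite (ltE #3) //; exact: irreducible_T4.
- by rewrite (ltE #4) //; exact: irreducible_T5.
- by rewrite (ltE #5) //; exact: irreducible_T6.
- by rewrite (ltE #6) //; exact: irreducible_line.
- by rewrite (ltE #7) //; exact: irreducible_T8.
- by rewrite (ltE #8) //; exact: irreducible_T9.
- by rewrite (ltE #9) //; exact: irreducible_line.
- by rewrite (ltE #10) //; exact: irreducible_T11.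
- by rewrite (ltE #11) //; exact: irreducible_T12.
Qed.

End Irreducibility.

(** * The decomposition *)

Lemma component_indep (R : realType) (T : vectType R) (g : {dot T for idfun}) (xi : T)
    (F : 'End(T)) (hF : almost_contact_metric g xi F) (n : nat) (E E' : seq T) i h :
    adapted_basis g xi F E -> adapted_basis g xi F E' ->
  Tbar_component g xi F n E i h <-> Tbar_component g xi F n E' i h.
Proof.
move=> aE aE'.
by rewrite /Tbar_component /T3 /T4 /T5 /T7 /T8 /T10 (beta_indep aE aE') (beta_bar_indep hF aE aE').
Qed.

Lemma tensor_space_decomposition (R : realType) (n : nat) (hn : (3 <= n)%N)
  (T : vectType R) (dimT : \dim {:T} = n.*2.+1)
  (g : {dot T for idfun}) (xi : T) (F : 'End(T))
  (hF : almost_contact_metric g xi F) :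
  exists (TT : {vspace (tensor_space T)}) (W : 'I_12 -> {vspace (tensor_space T)}),
    [/\ forall h, h \in TT <-> Tbar g xi F h,
        forall E, adapted_basis g xi F E ->
          forall i h, h \in W i <-> Tbar_component g xi F n E i h &
    [/\ TT = (\sum_i W i)%VS /\ directv (\sum_i W i),
        forall e, orthonormal_basis g e ->
          forall i j, i != j -> forall h h', h \in W i -> h' \in W j ->
          tensor_dot e h h' = 0,
        forall i, H_invariant g xi F (W i),
        forall i, H_irreducible g xi F (W i) &
        forall i, (\dim (W i))%:R = (Tbar_dims n)`_i :> rat]].
Proof.
have n1 : (1 < n)%N by exact: ltnW.
have [E0 aE0] := adapted_basis_exists dimT hF.
have [x [y [z [E1 E0E]]]] : exists x y z E1, E0 = [:: x, y, z & E1].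
  move: hn; rewrite -(adapted_size dimT aE0).
  by case: E0 {aE0} => [|x [|y [|z E1]]] // _; exists x, y, z, E1.
subst E0; set E := [:: x, y, z & E1] in aE0 *.
have [TT hTT] := linear_pred_space (Tbar_linear g xi F).
have [W hW] := fin_all_exists (fun i => linear_pred_space (component_linear g xi F n E i)).
have compS i h : Tbar_component g xi F n E i h -> h \in (\sum_i W i)%VS.
  move=> /hW hWi; exact: (subvP (sumv_sup i isT (subvv _))).
have sumW h : Tbar g xi F h -> h \in (\sum_i W i)%VS.
  exact: (Tbar_sum hF n1 dimT aE0 compS).
have dims := component_dims hF n1 dimT aE0 hW sumW.
have W0 i : W i != 0%VS.
  by rewrite -dimv_eq0 -(pnatr_eq0 rat) dims Tbar_dims_neq0.
have W6 := dim_W6 hF n1 dimT aE0 hW.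
have W9 := dim_W9 hF n1 dimT aE0 hW.
have orth e : orthonormal_basis g e -> forall i j, i != j -> forall h h',
    h \in W i -> h' \in W j -> tensor_dot e h h' = 0.
  move=> oe i j ij h h' hi hj; rewrite (tensor_dot_indep h h' oe (adapted_orthonormal aE0)).
  by apply: (component_dot hF aE0 ij); [exact: (hW i h).1 | exact: (hW j h').1].
exists TT, W; split; first exact: hTT.
  move=> E' aE' i h; apply: (iff_trans (hW i h)); exact: component_indep.
split; [split| exact: orth | | | exact: dims].
- apply/eqP; rewrite eqEsubv; apply/andP; split.
    by apply/subvP => h /hTT; exact: sumW.
  by apply/subv_sumP => i _; apply/subvP => h hi; exact: ((hTT h).2 (proj1 ((hW i h).1 hi))).
- exact: (orthogonal_directv (adapted_orthonormal aE0) (orth _ (adapted_orthonormal aE0))).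
- by move=> i; exact: (component_invariant hF dimT aE0 hW).
- exact: (component_irreducible hF hn dimT aE0 hW W0 W6 W9).
Qed.

Theorem theorem6p3 (R : realType) (n : nat) (hn : (3 <= n)%N)
  (T : vectType R) (dimT : \dim {:T} = n.*2.+1)
  (g : {dot T for idfun}) (xi : T) (F : 'End(T))
  (hF : almost_contact_metric g xi F) :
  exists (TT : {vspace (tensor3 R T)}) (W : 'I_12 -> {vspace (tensor3 R T)}),
    [/\ forall h, h \in TT <-> Tbar g xi F h,
        forall E, adapted_basis g xi F E ->
          forall i h, h \in W i <-> Tbar_component g xi F n E i h &
    [/\ TT = (\sum_i W i)%VS /\ directv (\sum_i W i),
        forall e, orthonormal_basis g e ->
          forall i j, i != j -> forall h h', h \in W i -> h' \in W j ->
          tensor_dot e h h' = 0,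
        forall i, H_invariant g xi F (W i),
        forall i, H_irreducible g xi F (W i) &
        forall i, (\dim (W i))%:R = (Tbar_dims n)`_i :> rat]].
Proof. exact (@tensor_space_decomposition R n hn T dimT g xi F hF). Qed.
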